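(* Let $\Phi=\{\phi_k,\psi_k\}_{k=0}^\infty$ be a biorthogonal wavelet type system on $[0,1]$. If $\{\phi_k\}_{k\ge 0}$ is a basis in $L^2[0,1]$, then $\{\phi_k\}_{k\ge 0}$ is an unconditional basis in the atomic Hardy space $H^1[0,1]$.
   Context: **Biorthogonal wavelet type system.** Real functions $\phi_k,\psi_k$ on $[0,1]$, $k\ge0$, with $\int_0^1\phi_k\psi_m=\delta_{km}$, such that the following holds. Let $\xi(x)=(1+|x|)^{-1-\delta}$ for some $0<\delta<1$. Let $t_1=\frac12$ (with $n=0$ for $k=1$), and for $k\ge2$ write uniquely $k=2^n+j$ with $1\le j\le2^n$, $n\ge0$, and put $t_k=\frac{2j-1}{2^{n+1}}$. Then, for some constants $c>0$ and $0<\alpha\le1$: - $\phi_0(x)=\psi_0(x)\equiv1$; - $|\phi_k(x)|+|\psi_k(x)|\le c\,2^{n/2}\xi(2^n(x-t_k))$ for $k\ge1$; - $|\phi_k(t)-\phi_k(t')|+|\psi_k(t)-\psi_k(t')|\le c\,2^{n/2}(2^n|t-t'|)^\alpha\,\xi(2^n(t-t_k))$ whenever $|t-t'|\le2^{-n}$, $k\ge1$. **Hardy space.** $H^1[0,1]$ is the atomic Hardy space: functions $f=\sum_i c_ia_i$ with $\sum_i|c_i|<\infty$, where each $a_i$ is either the constant function $1$ or an atom, i.e. a function supported in an interval $I\subset[0,1]$ with $\|a\|_\infty\le|I|^{-1}$ and $\int a=0$; the norm is $\inf\sum_i|c_i|$ over all such representations. Its dual is $\mathrm{BMO}[0,1]$.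 *)

(* Defs.v *)
From HB Require Import structures.
From mathcomp Require Import all_boot all_order all_algebra.
From mathcomp Require Import all_classical all_reals all_analysis.

Set Implicit Arguments.
Unset Strict Implicit.
Unset Printing Implicit Defensive.

Import Order.TTheory GRing.Theory Num.Theory.
Import numFieldNormedType.Exports.

Local Open Scope classical_set_scope.
Local Open Scope ring_scope.

(* A function on [0,1] is represented by a function R -> R of which only the
   values on [0,1] matter. *)

Section wavelet_type_systems.
Context {R : realType}.
Implicit Types (phi psi : nat -> R -> R) (f g : R -> R).

Definition unit_itv : set R := `[0, 1]%classic.

Definition biorthogonal phi psi : Prop :=
  forall k m : nat,
    (\int[@lebesgue_measure R]_(x in unit_itv) (phi k x * psi m x)%:E
     = ((k == m)%:R : R)%:E)%E.

Definition xi (delta x : R) : R := (1 + `|x|) `^ (- 1 - delta).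

Definition size_bound (c delta : R) (n : nat) (t : R) f g : Prop :=
  forall x, unit_itv x ->
    `|f x| + `|g x| <= c * 2 `^ (n%:R / 2) * xi delta (2 ^+ n * (x - t)).

Definition holder_bound (c delta alpha : R) (n : nat) (t : R) f g : Prop :=
  forall s s', unit_itv s -> unit_itv s' -> `|s - s'| <= 2 ^- n ->
    `|f s - f s'| + `|g s - g s'| <=
      c * 2 `^ (n%:R / 2) * (2 ^+ n * `|s - s'|) `^ alpha
        * xi delta (2 ^+ n * (s - t)).

Definition wavelet_bounds (c delta alpha : R) (n : nat) (t : R) f g : Prop :=
  size_bound c delta n t f g /\ holder_bound c delta alpha n t f g.

Definition wavelet_type_system phi psi : Prop :=
  biorthogonal phi psi /\
  exists delta c alpha : R,
    [/\ 0 < delta < 1, 0 < c & 0 < alpha <= 1] /\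
    [/\ forall x, unit_itv x -> phi 0%N x = 1 /\ psi 0%N x = 1,
        wavelet_bounds c delta alpha 0 2^-1 (phi 1%N) (psi 1%N) &
        forall n j : nat, (1 <= j <= 2 ^ n)%N ->
          wavelet_bounds c delta alpha n ((2 * j%:R - 1) / 2 ^+ n.+1)
            (phi (2 ^ n + j)%N) (psi (2 ^ n + j)%N)].

End wavelet_type_systems.

(* A space of functions is given by its set [V] of elements and its norm [N],
   a seminorm on [V] vanishing exactly on the functions null almost everywhere
   on [0,1]; elements are thereby identified when equal almost everywhere. *)
Section bases.
Context {R : realType}.
Variables (V : set (R -> R)) (N : (R -> R) -> \bar R).
Implicit Types (e : nat -> R -> R) (c : nat -> R) (f : R -> R).

Definition norm_sums e c f : Prop :=
  (fun n => N (fun x => f x - \sum_(k < n) c k * e k x)) @ \oo --> (0 : \bar R)%E.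

Definition schauder_basis e : Prop :=
  (forall k, V (e k)) /\
  (forall f, V f -> exists! c, norm_sums e c f).

Definition unconditional_basis e : Prop :=
  schauder_basis e /\
  (forall f c, V f -> norm_sums e c f ->
     forall sigma : nat -> nat, bijective sigma ->
       norm_sums (e \o sigma) (c \o sigma) f).

End bases.

Section function_spaces.
Context {R : realType}.
Local Notation mu := (@lebesgue_measure R).
Implicit Types (f : R -> R).

Definition Lp01 (p : \bar R) : set (R -> R) :=
  [set f | f \_ unit_itv \in Lfun mu p].

Definition Lp01_norm (p : \bar R) f : \bar R :=
  ('N[mu]_p [EFin \o (f \_ unit_itv)])%E.

(* Taking the supporting interval [u, v] closed is no restriction, since an
   interval and its closure have the same length. *)
Definition atom (a : R -> R) : Prop :=
  exists u v : R,
    [/\ 0 <= u, u < v & v <= 1] /\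
    [/\ measurable_fun setT a,
        forall x, x \notin `[u, v] -> a x = 0,
        ('N[mu]_+oo [EFin \o a] <= ((v - u)^-1)%:E)%E &
        (\int[mu]_(x in unit_itv) (a x)%:E = 0)%E].

Definition atom_or_one (a : R -> R) : Prop :=
  (forall x, unit_itv x -> a x = 1) \/ atom a.

(* Since atoms have L^1 norm at most 1, the series \sum_i c_i a_i converges
   absolutely in L^1[0,1], and its sum is understood there. *)
Definition atomic_decomposition f (c : nat -> R) (a : nat -> R -> R) : Prop :=
  [/\ forall i, atom_or_one (a i),
      (\sum_(0 <= i <oo) `|c i|%:E < +oo)%E &
      norm_sums (Lp01_norm 1%E) a c f].

Definition H1 : set (R -> R) :=
  [set f | Lp01 1%E f /\ exists c a, atomic_decomposition f c a].

Definition H1_norm f : \bar R :=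
  ereal_inf [set s | exists c a, atomic_decomposition f c a /\
                       s = (\sum_(0 <= i <oo) `|c i|%:E)%E].

End function_spaces.

(* Main.v *)
Require Import Defs.
From mathcomp Require Import all_boot all_order all_algebra.
From mathcomp Require Import all_classical all_reals all_analysis.
From mathcomp Require Import measurable_realfun ess_sup_inf ring lra zify.

Set Implicit Arguments.
Unset Strict Implicit.
Unset Printing Implicit Defensive.

Import Order.TTheory GRing.Theory Num.Theory.
Import numFieldNormedType.Exports.

Local Open Scope classical_set_scope.
Local Open Scope ring_scope.

(** The coefficient of phi_k in an expansion of f can only be the integral of
    f psi_k, by biorthogonality; write P_s f for the sum of these terms over a
    finite set s of indices.  The operators P_s are bounded on H^1 uniformly in s
    (proj_ca), and the functions reproduced by all large P_s are dense in H^1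
    (dense_ca).  Hence P_s f tends to f along the directed family of finite sets
    (proj_converges), which is convergence of the series in every order
    (norm_sums_perm).

    The uniform bound need only be proved on one atom a, supported in an interval
    of length about 2^-N around u (one_atom_bound).  The terms of P_s a are
    treated in three groups.
    - Levels n <= N: psi_k is nearly constant on the support of a, and the
      cancellation of a makes the coefficients decay like rho^(N - n); the terms
      are summable in H^1 in norm (coarse_part).
    - Levels n > N with centers far from u: the decay of psi_k makes the terms
      summable in H^1 in norm as well (far_part).
    - Levels n > N with centers near u: their sum f has mean zero, decays away
      from u like phi_k does, and has an L^2 norm controlled by that of a, so it
      has bounded H^1 norm (near_part).

    The L^2 control holds for arbitrary s, which a mere basis of L^2 does not
    give: it comes from the almost orthogonality of functions with cancellation,
    decay and smoothness.  The inner products of the phi_k between levels n and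
    n' decay geometrically in |n - n'|, and Schur's test with weights 2^(-n/2)
    bounds the synthesis operator (synthesis_L2); duality gives the Bessel
    inequality for the psi_k (analysis_L2).

    Passing from L^2 to H^1 (fa_L2) is a Calderon-Zygmund argument on dyadic
    averages: stop at the intervals where the mean square of g is large; what
    remains is bounded, and the same statement with fewer dyadic generations
    applies on the stopped intervals, whose total contribution is at most 3/8 of
    the bound to be proved.  A function concentrated near a point is cut into
    dyadic annuli to reduce to this case (fa_molecule).

    The basis hypothesis enters only through density: an atom a is the L^2 limit
    of combinations of the phi_k, whose successive differences are continuous and
    so have H^1 norm at most a constant times their L^2 norm (dense_atom).

    All estimates replace (1 + 2^n |x - t|)^(-1 - delta) by a finite sum of
    indicators of dyadic neighbourhoods of t with geometric coefficients (weight,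
    xi_weight); sums and integrals of it then reduce to counting centers in an
    interval and measuring the interval. *)

(** * Integration on the unit interval *)

Section integration.
Context {R : realType}.
Local Notation mu := (@lebesgue_measure R).
Implicit Types (f g h : R -> R) (u v c : R).

(** Half-open, so that the indicators [chi] of half-open subintervals add up
    exactly; the omitted point 1 is a null set. *)
Definition D01 : set R := `[0, 1[%classic.

Lemma D01P x : D01 x <-> 0 <= x /\ x < 1.
Proof. by rewrite /D01/= in_itv/=; split => [/andP[]|[-> ->]]. Qed.

Lemma measurable_D01 : @measurable _ (measurableTypeR R) D01.
Proof. exact: measurable_itv. Qed.

Lemma mu_D01 : mu D01 = 1%:E.
Proof. by rewrite lebesgue_measure_itv/= lte_fin ltr01 -EFinB subr0. Qed.

Definition integrable01 f := mu.-integrable D01 (EFin \o f).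

Definition int01 f : R := \int[mu]_(x in D01) f x.

Definition bddmeas f := @measurable_fun _ _ (measurableTypeR R) R D01 f /\ exists M,
    forall x, D01 x -> `|f x| <= M.

Definition ucont f := (exists M, forall x, D01 x -> `|f x| <= M) /\
  forall e, 0 < e -> exists2 d, 0 < d &
  forall s t, D01 s -> D01 t -> `|s - t| <= d -> `|f s - f t| <= e.

Definition chi u v (x : R) : R := ((u <= x) && (x < v))%:R.

Lemma eq_integrable01 f g : (forall x, D01 x -> f x = g x) -> integrable01 f ->
    integrable01 g.
Proof.
move=> fg; apply: eq_integrable; first exact: measurable_D01.
by move=> x /set_mem xD /=; rewrite fg.
Qed.

Lemma eq_int01 f g : (forall x, D01 x -> f x = g x) -> int01 f = int01 g.
Proof. by move=> fg; apply: eq_Rintegral => x /set_mem; exact: fg. Qed.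

Lemma integrable01D f g : integrable01 f -> integrable01 g ->
    integrable01 (fun x => f x + g x).
Proof. by move=> hf hg; have := integrableD measurable_D01 hf hg. Qed.

Lemma integrable01B f g : integrable01 f -> integrable01 g ->
    integrable01 (fun x => f x - g x).
Proof. by move=> hf hg; have := integrableB measurable_D01 hf hg. Qed.

Lemma integrable01Z c f : integrable01 f -> integrable01 (fun x => c * f x).
Proof. by move=> hf; have := integrableZl measurable_D01 c hf. Qed.

Lemma integrable01_abs f : integrable01 f -> integrable01 (fun x => `|f x|).
Proof. by move=> hf; have := integrable_norm hf. Qed.

Lemma bddmeas_integrable01 f : bddmeas f -> integrable01 f.
Proof.
move=> [mf [M hM]]; apply: measurable_bounded_integrable.
- exact: measurable_D01.
- by rewrite [X in (X < _)%E]mu_D01 ltry.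
- exact: mf.
- by exists M; split; [exact: num_real|move=> y My x /hM /le_trans; apply; exact: ltW].
Qed.

Lemma integrable01M f g : integrable01 f -> bddmeas g -> integrable01 (fun x => f x * g x).
Proof.
move=> hf [mg [M hM]].
have : mu.-integrable D01 ((EFin \o f) \* (EFin \o g))%E.
  apply: integrableMl => //; first exact: measurable_D01.
  by exists M; split; [exact: num_real|move=> y My x /hM /le_trans; apply; exact: ltW].
by apply: eq_integrable => [|x _ /=]; [exact: measurable_D01|rewrite EFinM].
Qed.

Lemma bddmeas_cst c : bddmeas (fun _ => c).
Proof. by split; [exact: measurable_cst|exists `|c|]. Qed.

Lemma integrable01_cst c : integrable01 (fun _ => c).
Proof. exact/bddmeas_integrable01/bddmeas_cst. Qed.

Lemma bddmeasD f g : bddmeas f -> bddmeas g -> bddmeas (fun x => f x + g x).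
Proof.
move=> [mf [M hM]] [mg [N hN]]; split; first exact: measurable_funD.
by exists (M + N) => x xD; rewrite (le_trans (ler_normD _ _))// lerD// ?hM// hN.
Qed.

Lemma bddmeasM f g : bddmeas f -> bddmeas g -> bddmeas (fun x => f x * g x).
Proof.
move=> [mf [M hM]] [mg [N hN]]; split; first exact: measurable_funM.
by exists (M * N) => x xD; rewrite normrM ler_pM// ?hM// hN.
Qed.

Lemma bddmeasZ c f : bddmeas f -> bddmeas (fun x => c * f x).
Proof. by move=> hf; apply: bddmeasM hf; exact: bddmeas_cst. Qed.

Lemma bddmeasB f g : bddmeas f -> bddmeas g -> bddmeas (fun x => f x - g x).
Proof.
move=> hf hg; have := bddmeasD hf (bddmeasZ (-1) hg).
by under [X in bddmeas X -> _]eq_fun do rewrite mulN1r.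
Qed.

Lemma bddmeas_abs f : bddmeas f -> bddmeas (fun x => `|f x|).
Proof.
move=> [mf [M hM]]; split; first exact: measurableT_comp.
by exists M => x xD; rewrite normr_id hM.
Qed.

Lemma bddmeas_sum (J : Type) (s : seq J) (P : pred J) (F : J -> R -> R) :
  (forall i, P i -> bddmeas (F i)) -> bddmeas (fun x => \sum_(i <- s | P i) F i x).
Proof.
move=> hF; elim: s => [|i s ih].
  rewrite [X in bddmeas X](_ : _ = fun=> 0); first exact: bddmeas_cst.
  by apply/funext => x; rewrite big_nil.
have [Pi|Pi] := boolP (P i).
  rewrite [X in bddmeas X](_ : _ = fun x => F i x + \sum_(j <- s | P j) F j x).
    by apply: bddmeasD => //; exact: hF.
  by apply/funext => x; rewrite big_cons Pi.
rewrite [X in bddmeas X](_ : _ = fun x => \sum_(j <- s | P j) F j x)//.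
by apply/funext => x; rewrite big_cons (negPf Pi).
Qed.

Lemma integrable01_sum (J : Type) (s : seq J) (P : pred J) (F : J -> R -> R) :
  (forall i, P i -> integrable01 (F i)) ->
      integrable01 (fun x => \sum_(i <- s | P i) F i x).
Proof.
move=> hF; elim: s => [|i s ih].
  rewrite [X in integrable01 X](_ : _ = fun=> 0); first exact: integrable01_cst.
  by apply/funext => x; rewrite big_nil.
have [Pi|Pi] := boolP (P i).
  rewrite [X in integrable01 X](_ : _ = fun x => F i x + \sum_(j <- s | P j) F j x).
    by apply: integrable01D => //; exact: hF.
  by apply/funext => x; rewrite big_cons Pi.
rewrite [X in integrable01 X](_ : _ = fun x => \sum_(j <- s | P j) F j x)//.
by apply/funext => x; rewrite big_cons (negPf Pi).
Qed.

Lemma int01D f g : integrable01 f -> integrable01 g ->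
    int01 (fun x => f x + g x) = int01 f + int01 g.
Proof. by move=> hf hg; exact: (RintegralD measurable_D01 hf hg). Qed.

Lemma int01B f g : integrable01 f -> integrable01 g ->
    int01 (fun x => f x - g x) = int01 f - int01 g.
Proof. by move=> hf hg; exact: (RintegralB measurable_D01 hf hg). Qed.

Lemma int01Z c f : integrable01 f -> int01 (fun x => c * f x) = c * int01 f.
Proof. by move=> hf; exact: (RintegralZl c measurable_D01 hf). Qed.

Lemma int01_cst c : int01 (fun _ => c) = c.
Proof.
rewrite -[RHS]mulr1; have /(congr1 fine)/= <- := mu_D01.
exact: (Rintegral_cst mu measurable_D01 c).
Qed.

Lemma int01_sum (J : Type) (s : seq J) (P : pred J) (F : J -> R -> R) :
  (forall i, P i -> integrable01 (F i)) ->
  int01 (fun x => \sum_(i <- s | P i) F i x) = \sum_(i <- s | P i) int01 (F i).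
Proof.
move=> hF; elim: s => [|i s ih].
  by rewrite big_nil -[RHS](int01_cst 0); apply: eq_int01 => x _; rewrite big_nil.
rewrite big_cons; case: ifPn => Pi.
  rewrite -ih -int01D; [|exact: hF|exact: integrable01_sum].
  by apply: eq_int01 => x _; rewrite big_cons Pi.
by rewrite -ih; apply: eq_int01 => x _; rewrite big_cons (negPf Pi).
Qed.

Lemma le_int01 f g : integrable01 f -> integrable01 g -> (forall x, D01 x -> f x <=
    g x) -> int01 f <= int01 g.
Proof. by move=> hf hg fg; exact: (le_Rintegral measurable_D01 hf hg fg). Qed.

Lemma int01_ge0 f : (forall x, D01 x -> 0 <= f x) -> 0 <= int01 f.
Proof. by move=> f0; apply: Rintegral_ge0. Qed.

Lemma le_normr_int01 f : integrable01 f -> `|int01 f| <= int01 (fun x => `|f x|).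
Proof. by move=> hf; exact: (le_normr_Rintegral measurable_D01 hf). Qed.

Lemma chi_ge0 u v x : 0 <= chi u v x.
Proof. by rewrite /chi ler0n. Qed.

Lemma chi_le1 u v x : chi u v x <= 1.
Proof. by rewrite /chi lern1 leq_b1. Qed.

Lemma chi0 u v x : ~~ (u <= x < v) -> chi u v x = 0.
Proof. by rewrite /chi => /negPf ->. Qed.

Lemma chi1 u v x : u <= x < v -> chi u v x = 1.
Proof. by rewrite /chi => ->. Qed.

Lemma chiE u v : chi u v = \1_(`[u, v[%classic : set R).
Proof.
apply/funext => x; rewrite /chi indicE; congr ((nat_of_bool _)%:R).
by rewrite mem_setE in_itv.
Qed.

Lemma bddmeas_chi u v : bddmeas (chi u v).
Proof.
split; last first.
  by exists 1 => x _; rewrite ger0_norm ?chi_ge0 ?chi_le1.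
by rewrite chiE; apply: measurable_indic.
Qed.

Lemma int01_chi u v : 0 <= u -> u <= v -> v <= 1 -> int01 (chi u v) = v - u.
Proof.
move=> u0 uv v1; rewrite /int01 /Rintegral chiE integral_indic//;
    last exact: measurable_D01.
have -> : `[u, v[ `&` D01 = `[u, v[%classic.
  apply/seteqP; split => x /=; first by case.
  rewrite in_itv/= => /andP[ux xv]; rewrite /D01/= !in_itv/= ux xv; split => //.
  by rewrite (le_trans u0 ux) (lt_le_trans xv v1).
rewrite [X in fine X]lebesgue_measure_itv/= lte_fin; case: ltP => // vu.
by rewrite /= ; apply/eqP; rewrite eq_sym subr_eq0 eq_le vu uv.
Qed.

Lemma chi_split u m v x : u <= m -> m <= v -> chi u v x = chi u m x + chi m v x.
Proof.
move=> um mv; rewrite /chi; have [xm|mx] := ltP x m.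
  by rewrite (lt_le_trans xm mv) !andbT addr0.
by rewrite (le_trans um mx) andbF add0r.
Qed.

Lemma ucont_measurable f : ucont f -> @measurable_fun _ _ (measurableTypeR R) R D01 f.
Proof.
move=> [_ hf]; apply: subspace_continuous_measurable_fun; first exact: measurable_D01.
apply/subspace_continuousP => x xD; apply/cvgrPdist_le => e e0.
have [d d0 hd] := hf e e0.
have hx : \forall y \near x, `|x - y| <= d.
  by apply/nbhs_ballP; exists d => //= y; rewrite /ball/= => /ltW.
by apply: filterS hx => y hy yD; apply: hd.
Qed.

Lemma ucont_bddmeas f : ucont f -> bddmeas f.
Proof. by move=> hf; split; [exact: ucont_measurable|case: hf]. Qed.

Lemma ucontD f g : ucont f -> ucont g -> ucont (fun x => f x + g x).
Proof.
move=> [[M hM] hf] [[N hN] hg]; split.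
  by exists (M + N) => x xD; rewrite (le_trans (ler_normD _ _))// lerD// ?hM// hN.
move=> e e0; have e2 : 0 < e / 2 by rewrite divr_gt0.
have [d d0 hd] := hf _ e2; have [d' d0' hd'] := hg _ e2.
exists (Num.min d d'); first by rewrite lt_min d0.
move=> s t sD tD; rewrite le_min => /andP[st st'].
rewrite opprD addrACA [leRHS]splitr (le_trans (ler_normD _ _))//.
by rewrite lerD ?hd ?hd'.
Qed.

Lemma ucontZ c f : ucont f -> ucont (fun x => c * f x).
Proof.
move=> [[M hM] hf]; split.
  by exists (`|c| * M) => x xD; rewrite normrM ler_wpM2l// hM.
move=> e e0; have c1 : 0 < `|c| + 1 by rewrite ltr_wpDl.
have [d d0 hd] := hf (e / (`|c| + 1)) (divr_gt0 e0 c1).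
exists d => // s t sD tD st; rewrite -mulrBr normrM.
rewrite (le_trans (ler_wpM2l _ (hd _ _ sD tD st)))//.
rewrite mulrCA ger_pMr// ler_pdivrMr// mul1r; lra.
Qed.

Lemma ucont_cst c : ucont (fun _ => c).
Proof.
by split; [by exists `|c| | move=> e e0; exists 1 => // *; rewrite subrr normr0 ltW].
Qed.

Lemma ucontB f g : ucont f -> ucont g -> ucont (fun x => f x - g x).
Proof.
move=> hf hg; have := ucontD hf (ucontZ (-1) hg).
by under [X in ucont X -> _]eq_fun do rewrite mulN1r.
Qed.

Lemma ucont_sum (J : Type) (s : seq J) (P : pred J) (F : J -> R -> R) :
  (forall i, P i -> ucont (F i)) -> ucont (fun x => \sum_(i <- s | P i) F i x).
Proof.
move=> hF; elim: s => [|i s ih].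
  rewrite [X in ucont X](_ : _ = fun=> 0); first exact: ucont_cst.
  by apply/funext => x; rewrite big_nil.
have [Pi|Pi] := boolP (P i).
  rewrite [X in ucont X](_ : _ = fun x => F i x + \sum_(j <- s | P j) F j x).
    by apply: ucontD => //; exact: hF.
  by apply/funext => x; rewrite big_cons Pi.
rewrite [X in ucont X](_ : _ = fun x => \sum_(j <- s | P j) F j x)//.
by apply/funext => x; rewrite big_cons (negPf Pi).
Qed.

Lemma eq_bddmeas f g : (forall x, D01 x -> g x = f x) -> bddmeas f -> bddmeas g.
Proof.
move=> fg [mf [M hM]]; split; last by exists M => x xD; rewrite fg// hM.
by apply: eq_measurable_fun mf => x /set_mem xD; rewrite fg.
Qed.

(** The variance of f is nonnegative. *)
Lemma int01_sqr_le f : bddmeas f -> int01 f ^+ 2 <= int01 (fun x => f x ^+ 2).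
Proof.
move=> hf; pose m := int01 f; have hi := bddmeas_integrable01 hf.
have : 0 <= int01 (fun x => f x * f x - (m * 2) * f x + m ^+ 2).
  by apply: int01_ge0 => x _; rewrite (_ : _ + _ = (f x - m) ^+ 2) ?sqr_ge0//; ring.
have hff : integrable01 (fun x => f x * f x) by apply: bddmeas_integrable01;
    exact: bddmeasM.
rewrite int01D; [|exact: integrable01B (integrable01Z _ _)|exact: integrable01_cst].
rewrite int01B; [|by []|exact: integrable01Z]. rewrite int01Z// int01_cst -/m.
rewrite (_ : int01 (fun x => f x ^+ 2) = int01 (fun x => f x * f x)) => [|]; first lra.
by apply: eq_int01 => x _; rewrite expr2.
Qed.

End integration.

(** * Finite atomic decompositions *)
Section atoms.
Context {R : realType}.
Implicit Types (f g h a : R -> R) (u v c K : R).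

(** Atoms modified on a null set so that the bound holds at every point and the
    support is half-open. *)
Definition bounded_atom a := exists u v, [/\ 0 <= u, u < v & v <= 1] /\
  [/\ bddmeas a, forall x, ~~ (u <= x < v) -> a x = 0,
      forall x, `|a x| <= (v - u)^-1 & int01 a = 0].

Definition atom_or_cst1 a := a = (fun=> 1) \/ bounded_atom a.

(** [finite_atomic f K]: on [0, 1[ the function f is a finite combination of
    atoms whose coefficients have absolute values of sum at most K.  All H^1
    estimates are carried out with such finite sums; infinite ones appear only
    when they are assembled. *)
Inductive finite_atomic : (R -> R) -> R -> Prop :=
| FinAtom0 : finite_atomic (fun=> 0) 0
| FinAtomS c a f K : atom_or_cst1 a -> finite_atomic f K ->
    finite_atomic (fun x => c * a x + f x) (`|c| + K)
| FinAtom_ext f g K K' : finite_atomic f K -> K <= K' ->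
    (forall x, D01 x -> g x = f x) -> finite_atomic g K'.

Lemma atom_or_cst1_bddmeas a : atom_or_cst1 a -> bddmeas a.
Proof. by case=> [->|[u [v [_ []]]]//]; exact: bddmeas_cst. Qed.

Lemma atom_or_cst1_L1 a : atom_or_cst1 a -> int01 (fun x => `|a x|) <= 1.
Proof.
case=> [->|[u [v [[u0 uv v1] [ba a0 aM _]]]]]; first by rewrite (eq_int01 (g :=
    fun=> 1)) ?int01_cst// => x _; rewrite normr1.
have := @le_int01 R (fun x => `|a x|) (fun x => (v - u)^-1 * chi u v x).
rewrite int01Z ?int01_chi ?(ltW uv)// ?mulVf ?subr_eq0 ?gt_eqF//;
    last exact/bddmeas_integrable01/bddmeas_chi.
apply; [by apply: integrable01_abs; apply: bddmeas_integrable01|by apply: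
    integrable01Z; apply: bddmeas_integrable01; exact: bddmeas_chi|move=> x _].
case: (boolP (u <= x < v)) => h; first by rewrite chi1// mulr1.
by rewrite a0// normr0 chi0// mulr0.
Qed.

Lemma fa_ge0 f K : finite_atomic f K -> 0 <= K.
Proof.
elim=> [//|c a {}f {}K _ _ K0|{}f g {}K K' _ K0 KK' _]; first by rewrite addr_ge0.
exact: le_trans KK'.
Qed.

Lemma fa_bddmeas f K : finite_atomic f K -> bddmeas f.
Proof.
elim=> [|c a {}f {}K ha _ ih|{}f g {}K K' _ ih _ fg]; first exact: bddmeas_cst.
  by apply: bddmeasD ih; apply: bddmeasZ; exact: atom_or_cst1_bddmeas.
exact: eq_bddmeas ih.
Qed.

Lemma fa_L1 f K : finite_atomic f K -> int01 (fun x => `|f x|) <= K.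
Proof.
elim=> [|c a {}f {}K ha hf ih|{}f g {}K K' _ ih KK' fg].
- by rewrite (eq_int01 (g := fun=> 0)) ?int01_cst// => x _; rewrite normr0.
- have bf := fa_bddmeas hf; have ba := atom_or_cst1_bddmeas ha.
  apply: (@le_trans _ _ (int01 (fun x => `|c| * `|a x| + `|f x|))).
    apply: le_int01 => [||x _].
    + by apply: integrable01_abs; apply: bddmeas_integrable01; apply: bddmeasD => //;
        exact: bddmeasZ.
    + by apply: bddmeas_integrable01; apply: bddmeasD; [apply: bddmeasZ|];
        exact: bddmeas_abs.
    + by rewrite (le_trans (ler_normD _ _))// normrM.
  have ia := bddmeas_integrable01 (bddmeas_abs ba); have jf :=
      bddmeas_integrable01 (bddmeas_abs bf).
  rewrite int01D// ?int01Z//; last exact: integrable01Z.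
  by rewrite lerD// ler_piMr//; exact: atom_or_cst1_L1.
- by rewrite (le_trans _ KK')//; rewrite (eq_int01 (g := fun x => `|f x|))// => x /fg ->.
Qed.

Lemma faD f g K L : finite_atomic f K -> finite_atomic g L ->
  finite_atomic (fun x => f x + g x) (K + L).
Proof.
move=> hf hg; elim: hf => [|c a {}f {}K ha hf ih|{}f h {}K K' hf ih KK' fg].
- by apply: (FinAtom_ext hg); rewrite ?add0r// => x _; rewrite add0r.
- by apply: (FinAtom_ext (FinAtomS c ha ih)); rewrite ?addrA// => x _; rewrite addrA.
- by apply: (FinAtom_ext ih) => [|x /fg ->//]; rewrite lerD2r.
Qed.

Lemma faZ c f K : finite_atomic f K -> finite_atomic (fun x => c * f x) (`|c| * K).
Proof.
elim=> [|d a {}f {}K ha hf ih|{}f h {}K K' hf ih KK' fg].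
- by apply: (FinAtom_ext FinAtom0); rewrite ?mulr0// => x _; rewrite mulr0.
- apply: (FinAtom_ext (FinAtomS (c * d) ha ih)); first by rewrite mulrDr normrM.
  by move=> x _; rewrite mulrDr mulrA.
- by apply: (FinAtom_ext ih) => [|x /fg ->//]; rewrite ler_wpM2l.
Qed.

Lemma fa_le f K L : finite_atomic f K -> K <= L -> finite_atomic f L.
Proof. by move=> hf KL; apply: (FinAtom_ext hf). Qed.

Lemma fa_sum (J : Type) (s : seq J) (P : pred J) (F : J -> R -> R) (K : J -> R) :
  (forall i, P i -> finite_atomic (F i) (K i)) ->
  finite_atomic (fun x => \sum_(i <- s | P i) F i x) (\sum_(i <- s | P i) K i).
Proof.
move=> hF; elim: s => [|i s ih].
  by apply: (FinAtom_ext FinAtom0) => [|x _]; rewrite big_nil.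
have [Pi|Pi] := boolP (P i).
  by apply: (FinAtom_ext (faD (hF i Pi) ih)) => [|x _]; rewrite big_cons Pi.
by apply: (FinAtom_ext ih) => [|x _]; rewrite big_cons (negPf Pi).
Qed.

Lemma fa_cst c : finite_atomic (fun=> c) `|c|.
Proof.
apply: (FinAtom_ext (FinAtomS c (or_introl erefl) FinAtom0)).
  by rewrite addr0.
by move=> x _; rewrite mulr1 addr0.
Qed.

(** The way to enter [finite_atomic]: b is M (v - u) times an atom.  The values of
    b outside [0, 1[ are arbitrary, hence the cut-off in the proof. *)
Lemma fa_atom b u v M : 0 <= u -> u < v -> v <= 1 -> bddmeas b ->
  (forall x, D01 x -> ~~ (u <= x < v) -> b x = 0) ->
  (forall x, D01 x -> `|b x| <= M) -> int01 b = 0 ->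
  finite_atomic b (M * (v - u)).
Proof.
move=> u0 uv v1 bb b0 bM Ib.
have uv0 : 0 < v - u by rewrite subr_gt0.
have M0 : 0 <= M.
  apply: le_trans (bM u _); first by [].
  by apply/D01P; split => //; exact: lt_le_trans v1.
have [/eqP M00|Mn0] := boolP (M == 0).
  apply: (FinAtom_ext FinAtom0); first by rewrite M00 mul0r.
  by move=> x xD; apply/eqP; rewrite -normr_eq0 eq_le normr_ge0 andbT -M00 bM.
have {Mn0 M0}M0 : 0 < M by rewrite lt_def Mn0.
pose k := M * (v - u); have k0 : 0 < k by rewrite mulr_gt0.
pose a x := k^-1 * (chi u v x * b x).
have ab x : D01 x -> a x = k^-1 * b x.
  move=> xD; rewrite /a; case: (boolP (u <= x < v)) => h; first by rewrite chi1// mul1r.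
  by rewrite b0// !mulr0.
have ha : atom_or_cst1 a.
  right; exists u, v; split; first by [].
  split.
  - by apply: bddmeasZ; apply: bddmeasM => //; exact: bddmeas_chi.
  - by move=> x h; rewrite /a chi0// mul0r mulr0.
  - move=> x; rewrite /a; case: (boolP (u <= x < v)) => h; last first.
      by rewrite chi0// mul0r mulr0 normr0 invr_ge0 ltW.
    move: (h) => /andP[ux xv]; rewrite chi1// mul1r normrM gtr0_norm ?invr_gt0// /k
        invfM mulrAC ler_piMl//.
      by rewrite invr_ge0 ltW.
    rewrite mulrC ler_pdivrMr// mul1r bM//; apply/D01P; split.
      exact: le_trans ux.
    exact: lt_le_trans v1.
  - by rewrite (eq_int01 ab) int01Z ?Ib ?mulr0//; exact: bddmeas_integrable01.
apply: (FinAtom_ext (FinAtomS k ha FinAtom0)); first by rewrite addr0 gtr0_norm.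
by move=> x xD; rewrite ab// mulrA mulfV ?gt_eqF// mul1r addr0.
Qed.

Lemma fa_list f K : finite_atomic f K -> exists L : seq (R * (R -> R)),
  [/\ forall i, (i < size L)%N -> atom_or_cst1 (nth (0, fun=> 1) L i).2,
      \sum_(p <- L) `|p.1| <= K &
      forall x, D01 x -> f x = \sum_(p <- L) p.1 * p.2 x].
Proof.
elim=> [|c a {}f {}K ha hf [L [h1 h2 h3]]|{}f g {}K K' hf [L [h1 h2 h3]] KK' fg].
- by exists [::]; split => // [|x _]; rewrite big_nil.
- exists ((c, a) :: L); split.
  + by case.
  + by rewrite big_cons/= lerD2l.
  + by move=> x xD; rewrite big_cons/= h3.
- exists L; split => //; first exact: le_trans KK'.
  by move=> x xD; rewrite fg// h3.
Qed.


(** * Dyadic averages and the passage from L^2 to H^1 *)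
Definition avg u v g : R := int01 (fun x => g x * chi u v x) / (v - u).

(** The conditional expectation of g on the 2^n equal parts of [u, v[. *)
Fixpoint dyavg (n : nat) u v g : R -> R := match n with
  | 0 => fun x => avg u v g * chi u v x
  | n.+1 => fun x => dyavg n u ((u + v) / 2) g x + dyavg n ((u + v) / 2) v g x
  end.

Lemma mid_lt u v : u < v -> u < (u + v) / 2 /\ (u + v) / 2 < v.
Proof. by move=> uv; split; lra. Qed.

Lemma notin_split u m v (x : R) : u <= m -> m <= v -> ~~ (u <= x < v) ->
  ~~ (u <= x < m) /\ ~~ (m <= x < v).
Proof.
move=> um mv; rewrite !negb_and -!ltNge -!leNgt => /orP[xu|vx].
  by rewrite xu/= (lt_le_trans xu um).
by rewrite vx (le_trans mv vx) !orbT.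
Qed.

Lemma dyavg_bddmeas n u v g : bddmeas (dyavg n u v g).
Proof.
elim: n u v => [|n ih] u v /=; first by apply: bddmeasZ; exact: bddmeas_chi.
exact: bddmeasD.
Qed.

Lemma dyavg0 n u v g x : u < v -> ~~ (u <= x < v) -> dyavg n u v g x = 0.
Proof.
elim: n u v => [|n ih] u v uv xuv /=; first by rewrite chi0 ?mulr0.
have [um mv] := mid_lt uv.
by have [h1 h2] := notin_split (ltW um) (ltW mv) xuv; rewrite !ih ?addr0.
Qed.

Lemma bddmeas_chiM u v g : bddmeas g -> bddmeas (fun x => g x * chi u v x).
Proof. by move=> hg; apply: bddmeasM => //; exact: bddmeas_chi. Qed.

Lemma int01_chi_split u m v g : u <= m -> m <= v -> bddmeas g ->
  int01 (fun x => g x * chi u v x) =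
  int01 (fun x => g x * chi u m x) + int01 (fun x => g x * chi m v x).
Proof.
move=> um mv hg; rewrite -int01D; try (by apply: bddmeas_integrable01; exact: bddmeas_chiM).
by apply: eq_int01 => x _; rewrite (chi_split _ um mv) mulrDr.
Qed.

Lemma int01_avg u v g : 0 <= u -> u < v -> v <= 1 -> bddmeas g ->
  int01 (fun x => avg u v g * chi u v x) = int01 (fun x => g x * chi u v x).
Proof.
move=> u0 uv v1 hg; rewrite int01Z; last exact/bddmeas_integrable01/bddmeas_chi.
by rewrite int01_chi ?(ltW uv)// /avg mulfVK// subr_eq0 gt_eqF.
Qed.

Lemma int01_dyavg n u v g : 0 <= u -> u < v -> v <= 1 -> bddmeas g ->
  int01 (dyavg n u v g) = int01 (fun x => g x * chi u v x).
Proof.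
move=> u0 uv v1 hg; elim: n u v u0 uv v1 => [|n ih] u v u0 uv v1 /=.
  exact: int01_avg.
have [um mv] := mid_lt uv.
rewrite int01D; try (by apply: bddmeas_integrable01; exact: dyavg_bddmeas).
rewrite !ih//; try lra.
by rewrite -int01_chi_split//; exact: ltW.
Qed.

(** The mean of g on [u, v[ is controlled by its mean square, since the variance
    on [u, v[ is nonnegative. *)
Lemma avg_le u v g s : 0 <= u -> u < v -> v <= 1 -> bddmeas g -> 0 <= s ->
  int01 (fun x => g x ^+ 2 * chi u v x) <= s ^+ 2 * (v - u) -> `|avg u v g| <= s.
Proof.
move=> u0 uv v1 hg s0 hs; set m := avg u v g.
have vu0 : 0 < v - u by rewrite subr_gt0.
rewrite -ler_sqr ?nnegrE// real_normK ?num_real//.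
rewrite -(ler_pM2r vu0); apply: le_trans hs.
have hgg : bddmeas (fun x => g x ^+ 2) by apply: eq_bddmeas (bddmeasM hg hg) => x _;
    rewrite expr2.
have : 0 <= int01 (fun x => (g x - m) ^+ 2 * chi u v x).
  by apply: int01_ge0 => x _; rewrite mulr_ge0 ?sqr_ge0 ?chi_ge0.
rewrite (eq_int01 (g := fun x => g x ^+ 2 * chi u v x - (m * 2) * (g x * chi u v x)
  + m ^+ 2 * chi u v x)); last by move=> x _; ring.
have i1 := bddmeas_integrable01 (bddmeas_chiM u v hgg); have i2 :=
    bddmeas_integrable01 (bddmeas_chiM u v hg).
have i3 := bddmeas_integrable01 (bddmeas_chi u v).
rewrite int01D; [|by apply: integrable01B => //; exact: integrable01Z|exact: integrable01Z].
rewrite int01B//; last exact: integrable01Z.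
rewrite !int01Z// int01_chi ?(ltW uv)//.
have -> : int01 (fun x => g x * chi u v x) = m * (v - u).
  by rewrite /m /avg mulfVK// gt_eqF.
move=> h; nra.
Qed.

Lemma avg_osc u v g e x : 0 <= u -> u < v -> v <= 1 -> bddmeas g -> 0 <= e ->
  (forall s t, u <= s < v -> u <= t < v -> `|g s - g t| <= e) ->
  u <= x < v -> `|g x - avg u v g| <= e.
Proof.
move=> u0 uv v1 hg e0 osc xuv.
have vu0 : 0 < v - u by rewrite subr_gt0.
rewrite -(ler_pM2r vu0).
have -> : `|g x - avg u v g| * (v - u) = `|int01 (fun y => (g x - g y) * chi u v y)|.
  rewrite -{1}(gtr0_norm vu0) -normrM; congr `|_|.
  rewrite (eq_int01 (g := fun y => g x * chi u v y - g y * chi u v y)); last first.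
    by move=> y _; ring.
  rewrite int01B; [|by apply: integrable01Z; apply: bddmeas_integrable01;
      exact: bddmeas_chi|by apply: bddmeas_integrable01; exact: bddmeas_chiM].
  rewrite int01Z ?int01_chi ?(ltW uv)//; last exact/bddmeas_integrable01/bddmeas_chi.
  by rewrite mulrBl /avg mulfVK// gt_eqF.
have hb : bddmeas (fun y => (g x - g y) * chi u v y).
  by apply: bddmeas_chiM; apply: bddmeasB => //; exact: bddmeas_cst.
apply: (le_trans (le_normr_int01 (bddmeas_integrable01 hb))).
have -> : e * (v - u) = int01 (fun y => e * chi u v y).
  by rewrite int01Z ?int01_chi ?(ltW uv)//; exact/bddmeas_integrable01/bddmeas_chi.
apply: le_int01 => [||y _]; [by apply: integrable01_abs;
    apply: bddmeas_integrable01|by apply: integrable01Z; apply: bddmeas_integrable01;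
    exact: bddmeas_chi|].
rewrite normrM (ger0_norm (chi_ge0 _ _ _)).
by case: (boolP (u <= y < v)) => h; rewrite ?(chi0 h) ?mulr0// (chi1 h) !mulr1 osc.
Qed.

(** On each of the 2^n parts g minus its average is a multiple of an atom, of size
    at most the oscillation of g there. *)
Lemma fa_dyavg_osc n u v g e : 0 <= u -> u < v -> v <= 1 -> bddmeas g -> 0 <= e ->
  (forall s t, D01 s -> D01 t -> `|s - t| <= (v - u) / 2 ^+ n -> `|g s - g t| <= e) ->
  finite_atomic (fun x => g x * chi u v x - dyavg n u v g x) (e * (v - u)).
Proof.
move=> u0 uv v1 hg e0; elim: n u v u0 uv v1 => [|n ih] u v u0 uv v1 osc /=.
  apply: fa_atom => //.
  - by apply: bddmeasB; [exact: bddmeas_chiM|apply: bddmeasZ; exact: bddmeas_chi].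
  - by move=> x _ xuv; rewrite chi0// !mulr0 subrr.
  - move=> x _; rewrite -mulrBl; case: (boolP (u <= x < v)) => xuv; last first.
      by rewrite chi0// mulr0 normr0.
    rewrite chi1// mulr1; apply: avg_osc => // s t /andP[us sv] /andP[ut tv].
    have [sD tD] : D01 s /\ D01 t by split; apply/D01P; split; lra.
    by apply: osc => //; rewrite expr0 divr1 ler_norml; apply/andP; split; lra.
  - rewrite int01B; [|by apply: bddmeas_integrable01;
      exact: bddmeas_chiM|by apply: integrable01Z; apply: bddmeas_integrable01;
      exact: bddmeas_chi].
    by rewrite int01_avg// subrr.
have [um mv] := mid_lt uv; set m := (u + v) / 2 in um mv *.
have E1 : (m - u) / 2 ^+ n = (v - u) / 2 ^+ n.+1.
  by rewrite exprS invfM mulrA; congr (_ / _); rewrite /m; lra.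
have E2 : (v - m) / 2 ^+ n = (v - u) / 2 ^+ n.+1.
  by rewrite exprS invfM mulrA; congr (_ / _); rewrite /m; lra.
have h1 := ih u m u0 um (ltW (lt_le_trans mv v1)).
have h2 := ih m v (ltW (le_lt_trans u0 um)) mv v1.
rewrite E1 in h1; rewrite E2 in h2.
apply: (FinAtom_ext (faD (h1 osc) (h2 osc))).
  by rewrite -mulrDr ler_wpM2l//; lra.
by move=> x _; rewrite (chi_split _ (ltW um) (ltW mv)); ring.
Qed.

End atoms.

Section calderon_zygmund.
Context {R : realType}.
Implicit Types (f g h a : R -> R) (u v s : R).

Local Notation msq g u v := (int01 (fun x => g x ^+ 2 * chi u v x)).

Lemma bddmeas_sqr g : bddmeas g -> bddmeas (fun x => g x ^+ 2).
Proof. by move=> hg; apply: eq_bddmeas (bddmeasM hg hg) => x _; rewrite expr2. Qed.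

Lemma msq_ge0 g u v : 0 <= msq g u v.
Proof. by apply: int01_ge0 => x _; rewrite mulr_ge0 ?sqr_ge0 ?chi_ge0. Qed.

(** The statement proved by strong induction on n, for all intervals and all
    heights s at once, since it is used with height 6 s on the stopped intervals. *)
Definition dyavg_bound (g : R -> R) (n : nat) := forall u v s, 0 <= u -> u < v -> v <= 1 ->
  0 < s -> msq g u v <= s ^+ 2 * (v - u) ->
  finite_atomic (fun x => dyavg n u v g x - dyavg 0 u v g x) (12 * s * (v - u)).

(** The stopping-time decomposition to depth n below one interval.  An interval is
    stopped when the mean square of g exceeds 16 s^2; since its parent was not, the
    mean square is still at most 32 s^2 <= (6 s)^2.  The function G carries the
    averages on stopped intervals and on unstopped intervals of the last
    generation, so it is bounded by 6 s and has the integral of g.  A stopped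
    interval contributes 12 (6 s) |Q|, at most 9/2 s^-1 times the integral of g^2 on
    Q: this is the cost in the conclusion. *)
Lemma cz_stopping g n s : bddmeas g -> 0 < s ->
  (forall m, (m <= n)%N -> dyavg_bound g m) ->
  forall u v, 0 <= u -> u < v -> v <= 1 -> msq g u v <= 32 * s ^+ 2 * (v - u) ->
  exists G, [/\ bddmeas G, forall x, ~~ (u <= x < v) -> G x = 0,
    forall x, `|G x| <= 6 * s, int01 G = int01 (fun x => g x * chi u v x) &
    finite_atomic (fun x => dyavg n u v g x - G x) (9 / 2 / s * msq g u v)].
Proof.
move=> hg s0; elim: n => [|n ih] T u v u0 uv v1 hs;
  have vu0 : 0 < v - u by rewrite subr_gt0.
  all: have s60 : 0 < 6 * s by rewrite mulr_gt0.
  all: have s2 : 0 < s ^+ 2 by rewrite exprn_gt0.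
  all: have hG : [/\ bddmeas (dyavg 0 u v g), forall x, ~~ (u <= x < v) ->
      dyavg 0 u v g x = 0,
      forall x, `|dyavg 0 u v g x| <= 6 * s & int01 (dyavg 0 u v g) = int01 (fun x => g
          x * chi u v x)].
  all: try (split; [exact: dyavg_bddmeas|by move=> x; exact: dyavg0| |exact: int01_dyavg];
      move=> x; rewrite /= normrM (ger0_norm (chi_ge0 _ _ _));
      apply: le_trans (_ : `|avg u v g| <= _); [by rewrite ler_piMr// chi_le1|];
      apply: avg_le => //; [exact: ltW|apply: (le_trans hs); rewrite ler_wpM2r ?ltW//;
          nra]).
  case: hG => G1 G2 G3 G4; exists (dyavg 0 u v g); split => //.
  apply: (FinAtom_ext FinAtom0); last by move=> x _; rewrite subrr.
  by rewrite mulr_ge0 ?msq_ge0// divr_ge0// ltW.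
have [stop|go] := ltP (16 * s ^+ 2 * (v - u)) (msq g u v).
  case: hG => G1 G2 G3 G4; exists (dyavg 0 u v g); split => //.
  have h6 : msq g u v <= (6 * s) ^+ 2 * (v - u).
    by apply: (le_trans hs); rewrite ler_wpM2r ?ltW//; nra.
  apply: (fa_le (T n.+1 (leqnn _) u v (6 * s) u0 uv v1 s60 h6)).
  rewrite -subr_ge0.
  have -> : 9 / 2 / s * msq g u v - 12 * (6 * s) * (v - u)
     = 9 / 2 / s * (msq g u v - 16 * s ^+ 2 * (v - u)).
    by field; rewrite gt_eqF.
  by rewrite mulr_ge0// ?divr_ge0 ?ltW// subr_gt0.
have [um mv] := mid_lt uv; set m := (u + v) / 2 in um mv *.
have E := int01_chi_split (ltW um) (ltW mv) (bddmeas_sqr hg).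
have p1 := msq_ge0 g u m; have p2 := msq_ge0 g m v.
have T' k : (k <= n)%N -> dyavg_bound g k by move=> kn; apply: T; exact: leqW.
have hm1 : m - u = (v - u) / 2 by rewrite /m; lra.
have hm2 : v - m = (v - u) / 2 by rewrite /m; lra.
have [||||G1 [b1 z1 l1 I1 f1]] := ih T' u m => //; [lra|rewrite hm1; lra|].
have [||||G2 [b2 z2 l2 I2 f2]] := ih T' m v => //; [lra|rewrite hm2; lra|].
exists (fun x => G1 x + G2 x); split.
- exact: bddmeasD.
- move=> x h; have [h1 h2] := notin_split (ltW um) (ltW mv) h.
  by rewrite z1// z2// addr0.
- move=> x; have [xm|mx] := ltP x m.
    by rewrite z2 ?addr0// leNgt xm.
  by rewrite z1 ?add0r// [x < m]ltNge mx andbF.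
- by rewrite int01D ?I1 ?I2 -?int01_chi_split//; try exact: bddmeas_integrable01;
    exact: ltW.
- apply: (FinAtom_ext (faD f1 f2)).
    by rewrite -mulrDr -E.
  by move=> x _ /=; rewrite -/m; ring.
Qed.

(** The top interval is never stopped, its mean square being at most s^2, so that
    the induction hypothesis is used at smaller depth only.  The bad part costs at
    most 9/2 s |J| and the good part is 7 s |J| times an atom, together less than
    12 s |J|. *)
Lemma dyavg_bounded g n : bddmeas g -> dyavg_bound g n.
Proof.
move=> hg; elim/ltn_ind: n => -[|n] ih u v s u0 uv v1 s0 hs;
  have vu0 : 0 < v - u by rewrite subr_gt0.
  apply: (FinAtom_ext FinAtom0); last by move=> x _; rewrite subrr.
  by rewrite !mulr_ge0 ?ltW.
have [um mv] := mid_lt uv; set m := (u + v) / 2 in um mv *.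
have E := int01_chi_split (ltW um) (ltW mv) (bddmeas_sqr hg).
have p1 := msq_ge0 g u m; have p2 := msq_ge0 g m v.
have s2 : 0 < s ^+ 2 by rewrite exprn_gt0.
have hm1 : m - u = (v - u) / 2 by rewrite /m; lra.
have hm2 : v - m = (v - u) / 2 by rewrite /m; lra.
have [||||G1 [b1 z1 l1 I1 f1]] := cz_stopping hg s0 ih (u := u) (v := m) => //.
- lra.
- by rewrite hm1; nra.
have [||||G2 [b2 z2 l2 I2 f2]] := cz_stopping hg s0 ih (u := m) (v := v) => //.
- lra.
- by rewrite hm2; nra.
have havg : `|avg u v g| <= s by apply: avg_le => //; exact: ltW.
have f3 : finite_atomic (fun x => G1 x + G2 x - avg u v g * chi u v x) (7 * s * (v - u)).
  apply: fa_atom => //.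
  - by apply: bddmeasB; [exact: bddmeasD|apply: bddmeasZ; exact: bddmeas_chi].
  - move=> x _ h; have [h1 h2] := notin_split (ltW um) (ltW mv) h.
    by rewrite z1// z2// chi0// mulr0 !addr0 subr0.
  - move=> x _; apply: (le_trans (ler_normB _ _)).
    have : `|avg u v g * chi u v x| <= s.
      rewrite normrM (ger0_norm (chi_ge0 _ _ _)) (le_trans _ havg)//.
      by rewrite ler_piMr// chi_le1.
    have : `|G1 x + G2 x| <= 6 * s; last by lra.
    have [xm|mx] := ltP x m.
      by rewrite z2 ?addr0// leNgt xm.
    by rewrite z1 ?add0r// [x < m]ltNge mx andbF.
  - rewrite int01B; [|by apply: integrable01D;
      exact: bddmeas_integrable01|by apply: integrable01Z; apply: bddmeas_integrable01;
      exact: bddmeas_chi].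
    rewrite int01D; [|exact: bddmeas_integrable01..].
    by rewrite I1 I2 -int01_chi_split ?int01_avg ?subrr//; exact: ltW.
apply: (FinAtom_ext (faD (faD f1 f2) f3)); last by move=> x _ /=; rewrite -/m; ring.
rewrite -mulrDr -E -subr_ge0.
have -> : 12 * s * (v - u) - (9 / 2 / s * msq g u v + 7 * s * (v - u)) =
  9 / 2 / s * (s ^+ 2 * (v - u) - msq g u v) + s * (v - u) / 2.
  by field; rewrite gt_eqF.
apply: addr_ge0; last by rewrite divr_ge0// mulr_ge0// ltW.
by apply: mulr_ge0; [rewrite divr_ge0// ltW|rewrite subr_ge0].
Qed.

(** For continuous g the dyadic averages at a small enough scale differ from g by
    at most s on the whole interval, and atoms on the small parts pay for this error
    at once: a single n suffices. *)
Lemma fa_L2 g u v s : ucont g -> 0 <= u -> u < v -> v <= 1 -> 0 < s ->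
  msq g u v <= s ^+ 2 * (v - u) ->
  finite_atomic (fun x => (g x - avg u v g) * chi u v x) (13 * s * (v - u)).
Proof.
move=> hg u0 uv v1 s0 hs; have [_ hu] := hg; have [d d0 hd] := hu _ s0.
have bg := ucont_bddmeas hg.
have [n hn] : exists n, (v - u) / 2 ^+ n <= d.
  exists (Num.bound d^-1); set n := Num.bound _.
  have h : d^-1 < 2 ^+ n.
    apply: (lt_le_trans (archi_boundP _)); first by rewrite invr_ge0 ltW.
    by rewrite -natrX ler_nat ltnW// ltn_expl.
  rewrite ler_pdivrMr ?exprn_gt0//.
  have : d * d^-1 <= d * 2 ^+ n by rewrite ler_wpM2l// ltW.
  by rewrite mulfV ?gt_eqF//; lra.
have osc x y : D01 x -> D01 y -> `|x - y| <= (v - u) / 2 ^+ n -> `|g x - g y| <= s.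
  by move=> xD yD xy; apply: hd => //; exact: le_trans hn.
have f1 := fa_dyavg_osc u0 uv v1 bg (ltW s0) osc.
have f2 := @dyavg_bounded g n bg _ _ _ u0 uv v1 s0 hs.
apply: (FinAtom_ext (faD f1 f2)); first by rewrite le_eqVlt; apply/orP; left;
    apply/eqP; ring.
by move=> x _ /=; ring.
Qed.

End calderon_zygmund.

(** * Functions concentrated near a point *)

(** Proves nonnegativity of products, quotients, sums and powers of nonnegative
    terms. *)
Ltac nonneg := solve [repeat first [assumption | exact: ler0n | exact: ler01
  | match goal with H : is_true (0 < ?x) |- is_true (0 <= ?x) => exact: (ltW H) end
  | apply: mulr_ge0 | apply: divr_ge0 | apply: addr_ge0 | apply: exprn_ge0
  | exact: chi_ge0 | by [] | exact: ltW]].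

Section molecules.
Context {R : realType}.
Implicit Types (f g h a : R -> R) (u v s : R).

Lemma geom_le (q : R) n : 0 <= q -> q < 1 -> \sum_(i < n) q ^+ i <= (1 - q)^-1.
Proof.
move=> q0 q1; have q10 : 0 < 1 - q by rewrite subr_gt0.
rewrite -[leRHS]mul1r ler_pdivlMr// mulrC.
have -> : (1 - q) * (\sum_(i < n) q ^+ i) = 1 - q ^+ n.
  by rewrite -[LHS]opprK -mulNr opprB -subrX1 opprB.
by rewrite gerBl exprn_ge0.
Qed.

Section boxes.
Variables (y : R) (N : nat).
Hypothesis yD : D01 y.

(** The box of index i is the neighbourhood of y of radius 2^i / 2^N, cut to [0, 1[;
    the box of index N is all of [0, 1[, so only finitely many scales occur. *)
Definition box_radius i : R := 2 ^+ i / 2 ^+ N.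
Definition box_lo i := Num.max 0 (y - box_radius i).
Definition box_hi i := Num.min 1 (y + box_radius i).
Definition box i := chi (box_lo i) (box_hi i).

Lemma box_radius_gt0 i : 0 < box_radius i.
Proof. by rewrite divr_gt0// exprn_gt0. Qed.

Lemma box_radius_le1 i : (i <= N)%N -> box_radius i <= 1.
Proof.
by move=> iN; rewrite ler_pdivrMr ?exprn_gt0// mul1r ler_weXn2l// ler1n.
Qed.

Lemma box_radiusS i : box_radius i.+1 = 2 * box_radius i.
Proof. by rewrite /box_radius exprS mulrA. Qed.

Lemma box_radiusN : box_radius N = 1.
Proof. by rewrite /box_radius mulfV// expf_neq0. Qed.

(** Cutting to [0, 1[ keeps at least half of the box because y is in [0, 1[. *)
Lemma box_itv i : (i <= N)%N -> [/\ 0 <= box_lo i, box_lo i < box_hi i, box_hi i <= 1,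
  box_radius i <= box_hi i - box_lo i & box_hi i - box_lo i <= 2 * box_radius i].
Proof.
move=> iN; have := box_radius_gt0 i; have := box_radius_le1 iN; move/D01P: yD => [y0 y1].
rewrite /box_lo /box_hi; case: (leP 0 (y - box_radius i)) => ?;
    case: (leP 1 (y + box_radius i)) => ? ? ?;
  split; lra.
Qed.

Lemma notin_box i x : D01 x -> ~~ (box_lo i <= x < box_hi i) -> box_radius i <= `|x - y|.
Proof.
move=> /D01P[x0 x1]; rewrite /box_lo /box_hi ge_max lt_min x0 x1/= negb_and -ltNge -leNgt.
case/orP => h; last by rewrite (le_trans _ (ler_norm _))//; lra.
by rewrite distrC (le_trans _ (ler_norm _))//; lra.
Qed.

Lemma boxS i x : box_lo i <= x < box_hi i -> box_lo i.+1 <= x < box_hi i.+1.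
Proof.
have := box_radius_gt0 i; rewrite /box_lo /box_hi box_radiusS !ge_max !lt_min => r0.
by case/andP => /andP[x0 h1] /andP[x1 h2]; rewrite x0 x1/=; apply/andP; split; lra.
Qed.

Lemma boxN x : D01 x -> box_lo N <= x < box_hi N.
Proof.
move: yD => /D01P[y0 y1] /D01P[x0 x1]; rewrite /box_lo /box_hi box_radiusN ge_max
    lt_min x0 x1/=.
by apply/andP; split; lra.
Qed.

Variables (q K : R) (f : R -> R).
Hypotheses (q0 : 0 < q) (q1 : q < 1) (K0 : 0 < K) (ucf : ucont f) (If : int01 f = 0).
Hypothesis fdecay : forall i x, (i < N)%N -> D01 x -> box_radius i <= `|x - y| ->
  `|f x| <= K * 2 ^+ N * (q / 2) ^+ i.

Let C0 : R := 4 / (1 - q).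
Let q10 : 0 < 1 - q. Proof. by rewrite subr_gt0. Qed.
Let C00 : 0 < C0. Proof. by rewrite divr_gt0. Qed.
Let bf := ucont_bddmeas ucf.

Let off_bddmeas i : bddmeas (fun x => f x * (1 - box i x)).
Proof. by apply: bddmeasM => //; apply: bddmeasB;
    [exact: bddmeas_cst|exact: bddmeas_chi]. Qed.

(** Downward induction on i, from the last box: the annulus between boxes i and
    i + 1 has length at most 4 times the radius of box i, so it carries at most
    4 K q^i. *)
Lemma off_mass i : (i <= N)%N ->
  int01 (fun x => `|f x * (1 - box i x)|) <= C0 * K * q ^+ i.
Proof.
  (* induct on the number of annuli outside box i *)
move=> iN; rewrite -(subKn iN); elim: (N - i)%N (leq_subr i N) => [_|j ih jN].
  rewrite subn0 (eq_int01 (g := fun=> 0)).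
    by rewrite int01_cst; nonneg.
  by move=> x xD; rewrite /box chi1 ?boxN// subrr mulr0 normr0.
have {ih}ih := ih (ltnW jN); set k := (N - j.+1)%N.
have kE : (N - j)%N = k.+1 by rewrite /k -subSn.
rewrite kE in ih; have kN : (k < N)%N by rewrite -kE leq_subr.
have [lo0 lh h1 hr hr2] := box_itv kN.
apply: (@le_trans _ _ (int01 (fun x => `|f x * (1 - box k.+1 x)|
    + K * 2 ^+ N * (q / 2) ^+ k * box k.+1 x))).
  apply: le_int01 => [||x xD].
  - by apply: integrable01_abs; apply: bddmeas_integrable01; exact: off_bddmeas.
  - apply: integrable01D; first by apply: integrable01_abs;
      apply: bddmeas_integrable01; exact: off_bddmeas.
    by apply: integrable01Z; apply: bddmeas_integrable01; exact: bddmeas_chi.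
  - rewrite /box; case: (boolP (box_lo k <= x < box_hi k)) => h.
      rewrite chi1// subrr mulr0 normr0; nonneg.
    rewrite (chi0 h) subr0 mulr1.
    case: (boolP (box_lo k.+1 <= x < box_hi k.+1)) => h'.
      rewrite (chi1 h') subrr !mulr0 normr0 add0r mulr1.
      by apply: fdecay => //; exact: notin_box.
    by rewrite (chi0 h') subr0 mulr0 !mulr1 addr0.
have i1 : integrable01 (fun x => `|f x * (1 - box k.+1 x)|).
  by apply: integrable01_abs; apply: bddmeas_integrable01; exact: off_bddmeas.
have i2 : integrable01 (box k.+1) by apply: bddmeas_integrable01; exact: bddmeas_chi.
rewrite int01D//; last exact: integrable01Z.
rewrite int01Z// int01_chi ?(ltW lh)//.
have E : K * 2 ^+ N * (q / 2) ^+ k * (2 * box_radius k.+1) = 4 * K * q ^+ k.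
  by rewrite box_radiusS /box_radius expr_div_n; field; rewrite !expf_neq0.
have hle : K * 2 ^+ N * (q / 2) ^+ k * (box_hi k.+1 - box_lo k.+1) <= 4 * K * q ^+ k.
  by rewrite -E ler_wpM2l//; nonneg.
have -> : C0 * K * q ^+ k = C0 * K * q ^+ k.+1 + 4 * K * q ^+ k.
  by rewrite /C0 exprS; field; rewrite gt_eqF.
exact: lerD.
Qed.

(** Since f has mean zero, its integral on a box is minus the one outside. *)
Lemma box_avg i : (i <= N)%N -> `|avg (box_lo i) (box_hi i) f| <=
    C0 * K * 2 ^+ N * (q / 2) ^+ i.
Proof.
move=> iN; have [lo0 lh h1 hr hr2] := box_itv iN; have r0 := box_radius_gt0 i.
have E : int01 (fun x => f x * box i x) = - int01 (fun x => f x * (1 - box i x)).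
  have := @int01B R f (fun x => f x * box i x) (bddmeas_integrable01 bf)
      (bddmeas_integrable01 (bddmeas_chiM _ _ bf)).
  rewrite If sub0r => /(congr1 -%R); rewrite opprK => <-; congr (- _).
  by apply: eq_int01 => x _; rewrite mulrBr mulr1.
rewrite /avg E normrM normrN normfV (gtr0_norm (_ : 0 < box_hi i - box_lo i)) ?subr_gt0//.
rewrite ler_pdivrMr ?subr_gt0//.
apply: (le_trans (le_normr_int01 (bddmeas_integrable01 (off_bddmeas i))));
    apply: (le_trans (off_mass iN)).
have -> : C0 * K * q ^+ i = C0 * K * 2 ^+ N * (q / 2) ^+ i * box_radius i.
  by rewrite /box_radius expr_div_n; field; rewrite !expf_neq0.
by rewrite ler_wpM2l//; nonneg.
Qed.

(** The first box costs 26; the differences form a geometric series of ratio q. *)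
Definition box_cst : R := 26 + 4 * (1 + 2 * (4 / (1 - q))) / (1 - q).

Hypothesis fL2 : int01 (fun x => f x ^+ 2) <= K ^+ 2 * 2 ^+ N.

(** With g_i the restriction of f to box i minus its mean there, g_0 is handled by
    its L^2 norm, and g_(i+1) - g_i is a multiple of an atom on box i + 1, small by
    the decay of f and by [box_avg]. *)
Lemma fa_box i : (i <= N)%N ->
  finite_atomic (fun x => (f x - avg (box_lo i) (box_hi i) f) * box i x)
    (26 * K + \sum_(j < i) 4 * (1 + 2 * C0) * K * q ^+ j).
Proof.
elim: i => [_|i ih iN].
  have [lo0 lh h1 hr hr2] := box_itv (leq0n N).
  have KN : 0 < K * 2 ^+ N by rewrite mulr_gt0// exprn_gt0.
  have hN : (2 : R) ^+ N * box_radius 0 = 1 by rewrite /box_radius expr0 mul1r mulfV//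
      expf_neq0.
  have hs : int01 (fun x => f x ^+ 2 * chi (box_lo 0) (box_hi 0) x)
      <= (K * 2 ^+ N) ^+ 2 * (box_hi 0 - box_lo 0).
    apply: (@le_trans _ _ (K ^+ 2 * 2 ^+ N)).
      apply: (le_trans _ fL2); apply: le_int01 => [||x _].
      - by apply: bddmeas_integrable01; apply: bddmeas_chiM; exact: bddmeas_sqr.
      - by apply: bddmeas_integrable01; exact: bddmeas_sqr.
      - by rewrite ler_piMr ?sqr_ge0 ?chi_le1.
    have -> : (K * 2 ^+ N) ^+ 2 * (box_hi 0 - box_lo 0) =
      K ^+ 2 * 2 ^+ N * (2 ^+ N * (box_hi 0 - box_lo 0)) by ring.
    rewrite ler_peMr//; first by nonneg.
    by rewrite -[X in X <= _]hN ler_wpM2l ?exprn_ge0.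
  apply: (fa_le (fa_L2 ucf lo0 lh h1 KN hs)); rewrite big_ord0 addr0.
  have -> : 26 * K = 13 * (K * 2 ^+ N) * (2 * box_radius 0).
    by transitivity (26 * K * (2 ^+ N * box_radius 0)); [rewrite hN mulr1|ring].
  by rewrite ler_wpM2l//; nonneg.
have {ih}ih := ih (ltnW iN).
have [lo0 lh h1 hr hr2] := box_itv iN.
have [lo0' lh' h1' hr' hr2'] := box_itv (ltnW iN).
set A := avg (box_lo i) (box_hi i) f in ih; set A' := avg (box_lo i.+1) (box_hi i.+1) f.
pose Z := K * 2 ^+ N * (q / 2) ^+ i.
have Z0 : 0 <= Z by nonneg.
have hA : `|A| <= C0 * Z.
  by apply: (le_trans (box_avg (ltnW iN))); rewrite /Z !mulrA.
have hA' : `|A'| <= C0 * Z.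
  apply: (le_trans (box_avg iN)); rewrite (_ : _ * _ = C0 * Z * (q / 2)).
    rewrite ler_piMr//; first by nonneg.
    by rewrite ler_pdivrMr// mul1r (le_trans (ltW q1))// ler1n.
  by rewrite /Z exprS; ring.
have bbox j : bddmeas (box j) by exact: bddmeas_chi.
have fd : finite_atomic (fun x => (f x - A') * box i.+1 x - (f x - A) * box i x)
    ((1 + 2 * C0) * Z * (box_hi i.+1 - box_lo i.+1)).
  apply: fa_atom => //.
  - by apply: bddmeasB; apply: bddmeasM => //; apply: bddmeasB => //; exact: bddmeas_cst.
  - move=> x xD h; rewrite /box (chi0 h) chi0 ?mulr0 ?subrr//.
    by apply: contra h; exact: boxS.
  - move=> x xD; rewrite /box.
    have C0Z : 0 <= C0 * Z by nonneg.
    have -> : (1 + 2 * C0) * Z = Z + (C0 * Z + C0 * Z) by ring.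
    case: (boolP (box_lo i <= x < box_hi i)) => h.
      rewrite (chi1 h) (chi1 (boxS h)).
      have -> : (f x - A') * 1 - (f x - A) * 1 = A - A' by ring.
      by apply: (le_trans (ler_normB _ _)); rewrite -[leLHS]add0r lerD// lerD.
    rewrite (chi0 h) mulr0 subr0.
    case: (boolP (box_lo i.+1 <= x < box_hi i.+1)) => h'; last first.
      by rewrite (chi0 h') mulr0 normr0 !addr_ge0.
    rewrite (chi1 h') mulr1; apply: (le_trans (ler_normB _ _)); apply: lerD.
      by apply: fdecay => //; exact: notin_box.
    by rewrite -[leLHS]add0r lerD.
  - have E j (a b : R) : 0 <= a -> a < b -> b <= 1 -> box j = chi a b ->
        int01 (fun x => (f x - avg a b f) * box j x) = 0.
      move=> a0 ab b1 ->.
      rewrite (eq_int01 (g := fun x => f x * chi a b x - avg a b f * chi a b x)).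
        rewrite int01B; [|by apply: bddmeas_integrable01;
            exact: bddmeas_chiM|by apply: integrable01Z; apply: bddmeas_integrable01;
            exact: bddmeas_chi].
        by rewrite int01_avg// subrr.
      by move=> x _; rewrite mulrBl.
    rewrite int01B; [|by apply: bddmeas_integrable01; apply: bddmeasM => //;
        apply: bddmeasB => //; exact: bddmeas_cst..].
    by rewrite (E i.+1 (box_lo i.+1) (box_hi i.+1))// (E i (box_lo i) (box_hi i))// subrr.
apply: (FinAtom_ext (faD ih fd)); last by move=> x _; ring.
rewrite big_ord_recr/= addrA lerD2l.
have -> : 4 * (1 + 2 * C0) * K * q ^+ i = (1 + 2 * C0) * Z * (2 * box_radius i.+1).
  by rewrite /Z box_radiusS /box_radius expr_div_n; field; rewrite !expf_neq0.
by rewrite ler_wpM2l//; nonneg.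
Qed.

Lemma fa_molecule : finite_atomic f (box_cst * K).
Proof.
have := fa_box (leqnn N); rewrite /avg.
have -> : int01 (fun x => f x * chi (box_lo N) (box_hi N) x) = 0.
  by rewrite -If; apply: eq_int01 => x xD; rewrite chi1 ?mulr1// boxN.
move=> h; apply: (FinAtom_ext h) => [|x xD]; last first.
  by rewrite mul0r subr0 /box chi1 ?mulr1// boxN.
rewrite /box_cst -/C0 [leRHS]mulrDl lerD2l -mulr_sumr.
have -> : 4 * (1 + 2 * C0) / (1 - q) * K = 4 * (1 + 2 * C0) * K * (1 - q)^-1 by ring.
rewrite ler_wpM2l ?geom_le ?(ltW q0)//.
by nonneg.
Qed.
End boxes.

End molecules.

(** * Levels, centers and dyadic weights *)
Section weights.
Context {R : realType}.
Implicit Types (x t : R) (s : seq nat) (n k i : nat).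

(** The level n and the center t_k of the index k.  The maximum with 1 gives the
    index 1, like the index 2, level 0 and center 1/2; the index 0 receives the same
    values, which do no harm as it is later attached to the zero function. *)
Definition wlevel k : nat := trunc_log 2 k.-1.
Definition wcenter k : R := (2 * (maxn 1 (k - 2 ^ wlevel k))%:R - 1) / 2 ^+ (wlevel k).+1.

Lemma wlevel_bounds k : (1 <= maxn 1 (k - 2 ^ wlevel k) <= 2 ^ wlevel k)%N.
Proof.
rewrite leq_maxl/= geq_max expn_gt0/= leq_subLR addnn -mul2n -expnS.
by have := @trunc_log_ltn 2 k.-1 isT; rewrite -/(wlevel k); case: k.
Qed.

Lemma wlevelE k : (1 < k)%N -> k = (maxn 1 (k - 2 ^ wlevel k) + 2 ^ wlevel k)%N.
Proof.
move=> k1; have := @trunc_logP 2 k.-1 isT; rewrite -/(wlevel k).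
have k0 : (0 < k.-1)%N by case: k k1 => [|[]].
move=> /(_ k0) h; have h' : (2 ^ wlevel k < k)%N by rewrite -[k]prednK// (ltn_trans _ k1).
by rewrite (maxn_idPr _) ?subn_gt0// subnK// ltnW.
Qed.

Lemma wcenter_D01 k : D01 (wcenter k).
Proof.
have /andP[h1 h2] := wlevel_bounds k; rewrite /wcenter; set j := maxn _ _ in h1 h2 *.
have H1 : (1 : R) <= j%:R by rewrite ler1n.
have H2 : (j%:R : R) <= 2 ^+ wlevel k by rewrite -natrX ler_nat.
have p0 : (0 : R) < 2 ^+ (wlevel k).+1 by rewrite exprn_gt0.
apply/D01P; split; first by rewrite divr_ge0 ?ltW//; lra.
by rewrite ltr_pdivrMr// mul1r exprS; lra.
Qed.

(** Apart from the indices 0 and 1, the centers of level n are 2^-n apart, so a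
    closed interval of length 2 2^i / 2^n contains at most 2 2^i + 1 of them. *)
Lemma count_wcenter s n i x r : uniq s -> r <= 2 ^+ i / 2 ^+ n ->
  (count (fun k => (wlevel k == n) && (`|x - wcenter k| <= r)%R) s <= 5 * 2 ^ i)%N.
Proof.
move=> us hr; rewrite -size_filter.
pose z : R := 2 ^+ n * x + 2^-1; pose a0 := Num.truncn (z - 2 ^+ i).
apply: (@leq_trans (size ([:: 0; 1] ++ iota (a0 + 2 ^ n) (2 * 2 ^ i + 1))%N)); last first.
  by rewrite size_cat size_iota/=; have := expn_gt0 2 i; lia.
apply: uniq_leq_size; first exact: filter_uniq.
move=> k; rewrite mem_filter => /andP[/andP[/eqP kn hk] _].
rewrite mem_cat !inE mem_iota.
have [k1|k1] := leqP k 1; first by case: k k1 {kn hk} => [|[]].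
apply/orP; right; have := wlevelE k1; rewrite kn; move: hk; rewrite /wcenter kn.
set j := maxn _ _ => hk ->; rewrite addnAC leq_add2r ltn_add2r.
have p0 : (0 : R) < 2 ^+ n by rewrite exprn_gt0.
have : `|z - j%:R| <= 2 ^+ i.
  have -> : z - j%:R = 2 ^+ n * (x - (2 * j%:R - 1) / 2 ^+ n.+1).
    by rewrite /z exprS; field; rewrite gt_eqF.
  rewrite normrM gtr0_norm// mulrC -ler_pdivlMr//; exact: le_trans hr.
rewrite ler_norml => /andP[z1 z2]; apply/andP; split.
  by rewrite truncn_le_nat -natr1; lra.
have := truncnS_gt (z - 2 ^+ i); rewrite -/a0 => h.
rewrite -(ltr_nat R) natrD natrD natrM natrX; move: h; rewrite -natr1; lra.
Qed.

Variable q : R.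
Hypotheses (q0 : 0 < q) (q1 : q < 1).
Let q20 : 0 <= q / 2. Proof. by rewrite divr_ge0// ltW. Qed.
Let q10 : 0 < 1 - q. Proof. by rewrite subr_gt0. Qed.
Let kap := (1 - q)^-1.

(** A substitute for (1 + 2^n |x - t|)^(-1 - delta): at distance about 2^i / 2^n
    from t it is of size (q / 2)^i, as is that power when q = 2^-delta. *)
Definition weight n x t := \sum_(i < n.+1) (q / 2) ^+ i * box t n i x.

Lemma weight_ge0 n x t : 0 <= weight n x t.
Proof. by apply: sumr_ge0 => i _; nonneg. Qed.

Lemma weight_bddmeas n t : bddmeas (fun x => weight n x t).
Proof. by apply: bddmeas_sum => i _; apply: bddmeasZ; exact: bddmeas_chi. Qed.

Lemma int01_box n i t : D01 t -> (i <= n)%N -> int01 (box t n i) <= 2 * box_radius n i.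
Proof.
by move=> tD /(box_itv tD)[h1 h2 h3 h4 h5]; rewrite int01_chi// ltW.
Qed.

Lemma in_box n i t x : box_lo t n i <= x < box_hi t n i -> `|x - t| <= box_radius n i.
Proof.
rewrite /box_lo /box_hi ge_max lt_min => /andP[/andP[_ h1] /andP[_ h2]].
by rewrite ler_norml; apply/andP; split; lra.
Qed.

Lemma int01_weight n t : D01 t -> int01 (fun x => weight n x t) <= 2 * kap / 2 ^+ n.
Proof.
move=> tD; rewrite int01_sum; last by move=> i _; apply: integrable01Z;
    apply: bddmeas_integrable01; exact: bddmeas_chi.
apply: (@le_trans _ _ (\sum_(i < n.+1) 2 / 2 ^+ n * q ^+ i)).
  apply: ler_sum => i _; rewrite int01Z; last by apply: bddmeas_integrable01;
      exact: bddmeas_chi.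
  apply: (le_trans (ler_wpM2l _ (int01_box tD _))); [by nonneg|by rewrite -ltnS|].
  rewrite le_eqVlt; apply/orP; left; apply/eqP.
  by rewrite /box_radius expr_div_n; field; rewrite !expf_neq0.
have -> : 2 * kap / 2 ^+ n = 2 / 2 ^+ n * kap by ring.
by rewrite -mulr_sumr ler_wpM2l// geom_le// ltW.
Qed.

Lemma box_radius_lt n i j : (i < j)%N -> box_radius n i < box_radius n j :> R.
Proof.
by move=> ij; rewrite ltr_pM2r ?invr_gt0 ?exprn_gt0// ltr_eXn2l// ltr1n.
Qed.

Lemma box_far n i j t x : (i < j)%N -> box_radius n j <= `|x - t| -> box t n i x = 0.
Proof.
move=> ij h; rewrite /box chi0//; apply/negP => /in_box.
by rewrite leNgt (lt_le_trans (box_radius_lt n ij) h).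
Qed.

Lemma geom_tail (z : R) i n : 0 <= z -> z < 1 ->
  \sum_(j < n | (i <= j)%N) z ^+ j <= z ^+ i / (1 - z).
Proof.
move=> z0 z1; have [ni|ni] := leqP n i.
  rewrite big_pred0; first by rewrite divr_ge0 ?exprn_ge0// subr_ge0 ltW.
  by move=> j; apply/negbTE; rewrite -ltnNge (leq_trans (ltn_ord j)).
rewrite -(big_mkord (fun j => (i <= j)%N) (fun j => z ^+ j)).
rewrite (big_cat_nat (n := i))//=; last exact: ltnW.
rewrite big_nat_cond big_pred0 ?add0r => [|j]; last first.
  by rewrite andbC; case: leqP => //= ij; rewrite ltnNge ij andbF.
rewrite -{1}[i]add0n big_addn big_mkcond/=.
rewrite (eq_bigr (fun j => z ^+ i * z ^+ j)) => [|j _];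
    last by rewrite leq_addl exprD mulrC.
by rewrite -mulr_sumr big_mkord ler_wpM2l ?exprn_ge0// geom_le.
Qed.

Lemma weight_tail n i x t : box_radius n i <= `|x - t| -> weight n x t <= 2 * (q / 2) ^+ i.
Proof.
move=> h; apply: (@le_trans _ _ (\sum_(j < n.+1 | (i <= j)%N) (q / 2) ^+ j)).
  rewrite [leRHS]big_mkcond; apply: ler_sum => j _; case: leqP => ij.
    by rewrite ler_piMr ?exprn_ge0// chi_le1.
  by rewrite (box_far ij h) mulr0.
have h2 : q / 2 < 1 by rewrite ltr_pdivrMr// mul1r (lt_trans q1)// ltr1n.
apply: (le_trans (geom_tail _ _ q20 h2)); rewrite mulrC ler_wpM2r ?exprn_ge0//.
rewrite -[leRHS]invrK lef_pV2 ?posrE ?invr_gt0 ?subr_gt0//.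
by have q1' := q1; lra.
Qed.

Lemma weight_le2 n x t : weight n x t <= 2.
Proof.
apply: (@le_trans _ _ (\sum_(j < n.+1 | (0 <= j)%N) (q / 2) ^+ j)).
  by apply: ler_sum => j _; rewrite ler_piMr ?exprn_ge0// chi_le1.
have h2 : q / 2 < 1 by rewrite ltr_pdivrMr// mul1r (lt_trans q1)// ltr1n.
apply: (le_trans (geom_tail _ _ q20 h2)); rewrite expr0 mul1r.
rewrite -[leRHS]invrK lef_pV2 ?posrE ?invr_gt0 ?subr_gt0//.
by have q1' := q1; lra.
Qed.

Lemma sum_near_le s n i (P : pred nat) (F : nat -> R) x r : uniq s ->
  (forall k, P k -> wlevel k = n) -> r <= 2 ^+ i / 2 ^+ n ->
  (forall k, P k -> F k <= (`|x - wcenter k| <= r)%R%:R) ->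
  \sum_(k <- s | P k) F k <= 5 * 2 ^+ i.
Proof.
move=> us Pn hr hF.
apply: (@le_trans _ _ (count (fun k => (wlevel k == n) && (`|x - wcenter k| <= r)) s)%:R).
  rewrite -sum1_count natr_sum [leLHS]big_mkcond [leRHS]big_mkcond/=.
  apply: ler_sum => k _; case: ifPn => [Pk|_]; last by case: ifP.
  by have := hF k Pk; rewrite (Pn k Pk) eqxx/=; case: (_ <= r).
have := count_wcenter x us hr; rewrite -(ler_nat R) natrM natrX.
exact: le_trans.
Qed.

Lemma box_near n i t x : box t n i x <= (`|x - t| <= box_radius n i)%R%:R.
Proof.
rewrite /box; case: (boolP (box_lo t n i <= x < box_hi t n i)) => h.
  by rewrite chi1// in_box.
by rewrite chi0.
Qed.

(** The factor 2^-i in the weight is exactly compensated by the number of centers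
    in a box of index i, and a geometric series of ratio q remains. *)
Lemma sum_weight_tail s n i x (P : pred nat) : uniq s ->
  (forall k, P k -> wlevel k = n) ->
  (forall k j, P k -> (j < i)%N -> box_radius n j < `|x - wcenter k|) ->
  \sum_(k <- s | P k) weight n x (wcenter k) <= 5 * kap * q ^+ i.
Proof.
move=> us Pn far; rewrite exchange_big/=.
apply: (@le_trans _ _ (\sum_(j < n.+1 | (i <= j)%N) 5 * q ^+ j)).
  rewrite [leRHS]big_mkcond; apply: ler_sum => j _; rewrite -mulr_sumr.
  case: leqP => ij; last first.
    rewrite big1 ?mulr0// => k Pk; rewrite /box chi0//; apply/negP => /in_box.
    by rewrite leNgt far.
  have -> : 5 * q ^+ j = (q / 2) ^+ j * (5 * 2 ^+ j).
    by rewrite expr_div_n; field; rewrite expf_neq0.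
  rewrite ler_wpM2l ?exprn_ge0//.
  apply: (sum_near_le (n := n) (r := box_radius n j) (x := x)) => // k Pk.
  exact: box_near.
rewrite -mulr_sumr -mulrA ler_wpM2l// [leRHS]mulrC.
by apply: geom_tail => //; exact: ltW.
Qed.

Lemma sum_weight s n x (P : pred nat) : uniq s -> (forall k, P k -> wlevel k = n) ->
  \sum_(k <- s | P k) weight n x (wcenter k) <= 5 * kap.
Proof.
by move=> us Pn; have := @sum_weight_tail s n 0 x P us Pn; rewrite expr0 mulr1; apply.
Qed.

(** A box of index j at level n has index j + d at level n + d. *)
Lemma sum_weight_fine s n d t (P : pred nat) : uniq s ->
  (forall k, P k -> wlevel k = (n + d)%N) ->
  \sum_(m <- s | P m) weight n (wcenter m) t <= 5 * kap * 2 ^+ d.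
Proof.
move=> us Pn; rewrite exchange_big/=.
apply: (@le_trans _ _ (\sum_(j < n.+1) 5 * 2 ^+ d * q ^+ j)).
  apply: ler_sum => j _; rewrite -mulr_sumr.
  have -> : 5 * 2 ^+ d * q ^+ j = (q / 2) ^+ j * (5 * 2 ^+ (j + d)).
    by rewrite expr_div_n exprD; field; rewrite expf_neq0.
  rewrite ler_wpM2l ?exprn_ge0//.
  apply: (sum_near_le (n := (n + d)%N) (r := box_radius n j) (x := t)) => // [|k Pk].
    by rewrite /box_radius !exprD -mulf_div divff ?mulr1// expf_neq0.
  by rewrite distrC; exact: box_near.
have -> : 5 * kap * 2 ^+ d = 5 * 2 ^+ d * kap by ring.
by rewrite -mulr_sumr ler_wpM2l// geom_le// ltW.
Qed.

End weights.

(** * Almost orthogonality *)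
Ltac fieldnz := field; repeat (apply/andP; split);
  solve [by [] | by rewrite expf_neq0 | by rewrite lt0r_neq0 ?subr_gt0].

Section wavelets.
Context {R : realType}.
Variables (rho C : R).
Hypotheses (rho0 : 0 < rho) (rho1 : rho < 1) (C0 : 0 < C).
Local Notation q := (rho ^+ 2).
Local Notation w := (Num.sqrt (2 : R)).
Local Notation kap := ((1 - q)^-1).
Local Notation kap' := ((1 - rho)^-1).
Local Notation W := (weight q).

Lemma w_gt0 : 0 < w. Proof. by rewrite sqrtr_gt0. Qed.
Lemma ww n : w ^+ n * w ^+ n = 2 ^+ n.
Proof. by rewrite -exprMn -expr2 sqr_sqrtr. Qed.
Let wn0 n : 0 < w ^+ n. Proof. by rewrite exprn_gt0// w_gt0. Qed.
Let q0 : 0 < q. Proof. exact: exprn_gt0. Qed.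
Let q1 : q < 1. Proof. by rewrite exprn_ilt1// ltW. Qed.
Let k0 : 0 < kap. Proof. by rewrite invr_gt0 subr_gt0. Qed.
Let k1 : 1 <= kap.
Proof. by rewrite invf_ge1 ?subr_gt0// gerBl ltW. Qed.
Let k0' : 0 < kap'. Proof. by rewrite invr_gt0 subr_gt0. Qed.
Let rn0 n : 0 < rho ^+ n. Proof. exact: exprn_gt0. Qed.
Let C0' : 0 <= C. Proof. exact: ltW. Qed.
Let w0' n : 0 <= w ^+ n. Proof. exact: ltW. Qed.
Let rn0' n : 0 <= rho ^+ n. Proof. exact: ltW. Qed.
Let wg0 n x t : 0 <= W n x t. Proof. exact: weight_ge0. Qed.

(** With w = sqrt 2, so that w^n is 2^(n/2).  Here rho^2 is the ratio q of the
    weights while rho itself is the gain per dyadic scale in the Hoelder condition;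
    the gap between rho and rho^2 makes the sums over scales converge. *)
Definition molecule (f : R -> R) (n : nat) (t : R) := [/\ ucont f, int01 f = 0,
  forall x, D01 x -> `|f x| <= C * w ^+ n * W n x t &
  forall d s s', D01 s -> D01 s' -> `|s - s'| <= 1 / 2 ^+ (n + d) ->
    `|f s - f s'| <= C * w ^+ n * rho ^+ d * W n s t].

Lemma molecule_bddmeas f n t : molecule f n t -> bddmeas f.
Proof. by case=> /ucont_bddmeas. Qed.

Lemma molecule_L1 f n t : D01 t -> molecule f n t -> int01 (fun x => `|f x|) <=
    2 * kap * C / w ^+ n.
Proof.
move=> tD hf; have [_ _ fW _] := hf; have bf := molecule_bddmeas hf.
apply: (@le_trans _ _ (int01 (fun x => C * w ^+ n * W n x t))).
  apply: le_int01 => //; [by apply: integrable01_abs; exact: bddmeas_integrable01|].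
  by apply: integrable01Z; apply: bddmeas_integrable01; exact: weight_bddmeas.
rewrite int01Z; last by apply: bddmeas_integrable01; exact: weight_bddmeas.
apply: (le_trans (ler_wpM2l _ (int01_weight q0 q1 n tD))); first by nonneg.
rewrite le_eqVlt; apply/orP; left; apply/eqP; rewrite -ww.
by fieldnz.
Qed.

(** The supremum norm 2 C w^n times the L^1 norm of order w^-n. *)
Lemma molecule_L2 f n t : D01 t -> molecule f n t -> int01 (fun x => f x ^+ 2) <=
    4 * kap * C ^+ 2.
Proof.
move=> tD hf; have [_ _ fW _] := hf; have bf := molecule_bddmeas hf.
apply: (@le_trans _ _ (int01 (fun x => 2 * C * w ^+ n * `|f x|))).
  apply: le_int01 => [||x xD].
  - by apply: bddmeas_integrable01; exact: bddmeas_sqr.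
  - by apply: integrable01Z; apply: integrable01_abs; exact: bddmeas_integrable01.
  - rewrite -[f x ^+ 2]ger0_norm ?sqr_ge0// normrX expr2 ler_wpM2r//.
    apply: (le_trans (fW x xD)).
    have -> : 2 * C * w ^+ n = C * w ^+ n * 2 by ring.
    by rewrite ler_wpM2l ?weight_le2//; nonneg.
rewrite int01Z; last by apply: integrable01_abs; exact: bddmeas_integrable01.
apply: (le_trans (ler_wpM2l _ (molecule_L1 tD hf))); first by nonneg.
rewrite le_eqVlt; apply/orP; left; apply/eqP.
by fieldnz.
Qed.

Definition molecule_cst : R := box_cst q * (4 * kap * C).

(** The decay of f and its L^2 norm are those required by [fa_molecule] with
    K = 4 kap C / w^n. *)
Lemma molecule_fa f n t : D01 t -> molecule f n t ->
    finite_atomic f (molecule_cst / w ^+ n).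
Proof.
move=> tD hf; have [uf If fW _] := hf.
have K0 : 0 < 4 * kap * C / w ^+ n by rewrite divr_gt0// !mulr_gt0.
rewrite /molecule_cst -mulrA; apply: (fa_molecule tD q0 q1 K0 uf If (N := n)).
  move=> i x _ xD far; apply: (le_trans (fW x xD)).
  apply: (le_trans (ler_wpM2l _ (weight_tail q0 q1 far))); first by nonneg.
  rewrite -ww.
  have -> : 4 * kap * C / w ^+ n * (w ^+ n * w ^+ n) * (q / 2) ^+ i =
    C * w ^+ n * (2 * (q / 2) ^+ i) * (2 * kap).
    by fieldnz.
  by rewrite ler_peMr//; [nonneg|rewrite mulr_ege1// ler1n].
apply: (le_trans (molecule_L2 tD hf)); rewrite -ww.
have -> : (4 * kap * C / w ^+ n) ^+ 2 * (w ^+ n * w ^+ n) = 4 * kap * C ^+ 2 * (4 * kap).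
  by fieldnz.
by rewrite ler_peMr//; [nonneg|rewrite mulr_ege1// ler1n].
Qed.

(** As g has mean zero, f may be replaced by f - f t'.  On the box of index i around
    t' this difference gains rho^(d - i) if i <= d, by the Hoelder condition; if
    i > d it is merely bounded, but then rho^i <= rho^d.  In both cases the factor
    rho^(2 i) of the weight of g pays for the loss and leaves rho^d rho^i. *)
Lemma gram_pair f g n d t t' : D01 t' -> molecule f n t -> molecule g (n + d) t' ->
  `|int01 (fun x => f x * g x)| <= C ^+ 2 * w ^+ n * w ^+ (n + d) * rho ^+ d *
    \sum_(i < (n + d).+1) (rho / 2) ^+ i *
      int01 (fun x => box t' (n + d) i x * (W n x t + W n t' t)).
Proof.
move=> tD hf hg; have [_ _ fW fH] := hf; have [_ Ig gW _] := hg.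
have bf := molecule_bddmeas hf; have bg := molecule_bddmeas hg.
have -> : int01 (fun x => f x * g x) = int01 (fun x => (f x - f t') * g x).
  rewrite [RHS](eq_int01 (g := fun x => f x * g x - f t' * g x)); last first.
    by move=> x _; rewrite mulrBl.
  rewrite int01B; [|by apply: bddmeas_integrable01;
      exact: bddmeasM|by apply: integrable01Z; exact: bddmeas_integrable01].
  by rewrite int01Z ?Ig ?mulr0 ?subr0//; exact: bddmeas_integrable01.
have bfg : bddmeas (fun x => (f x - f t') * g x).
  by apply: bddmeasM => //; apply: bddmeasB => //; exact: bddmeas_cst.
apply: (le_trans (le_normr_int01 (bddmeas_integrable01 bfg))).
have bb i : bddmeas (fun x => box t' (n + d) i x * (W n x t + W n t' t)).
  by apply: bddmeasM; [exact: bddmeas_chi|apply: bddmeasD;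
      [exact: weight_bddmeas|exact: bddmeas_cst]].
set A := _ * rho ^+ d.
apply: (@le_trans _ _ (int01 (fun x => A * \sum_(i < (n + d).+1) (rho / 2) ^+ i *
      (box t' (n + d) i x * (W n x t + W n t' t))))); last first.
  rewrite int01Z; last by apply: bddmeas_integrable01; apply: bddmeas_sum => i _;
      exact: bddmeasZ.
  rewrite int01_sum; last by move=> i _; apply: integrable01Z; exact: bddmeas_integrable01.
  by rewrite le_eqVlt; apply/orP; left; apply/eqP; congr (_ * _);
    apply: eq_bigr => i _; rewrite int01Z//; exact: bddmeas_integrable01.
apply: le_int01 => [||x xD].
- by apply: integrable01_abs; exact: bddmeas_integrable01.
- by apply: integrable01Z; apply: integrable01_sum => i _; apply: integrable01Z;
    exact: bddmeas_integrable01.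
rewrite normrM; apply: (le_trans (ler_wpM2l _ (gW x xD))) => //.
rewrite /weight mulrA !mulr_sumr; apply: ler_sum => i' _; rewrite -/(W n x t) -/(W n t' t).
move: (nat_of_ord i') => {i'} i.
case: (boolP (box_lo t' (n + d) i <= x < box_hi t' (n + d) i)) => h; last first.
  by rewrite /box chi0// mul0r !mulr0.
rewrite /box chi1// mulr1 mul1r; have /= xt := in_box h.
have hS : rho ^+ i * `|f x - f t'| <= C * w ^+ n * rho ^+ d * (W n x t + W n t' t).
  have [id|di] := leqP i d.
    have h1 : `|x - t'| <= 1 / 2 ^+ (n + (d - i)).
      apply: (le_trans xt); rewrite /box_radius -{1}(subnK id) addnA exprD.
      by rewrite le_eqVlt; apply/orP; left; apply/eqP; fieldnz.
    apply: (le_trans (ler_wpM2l _ (fH _ _ _ xD tD h1))) => //.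
    have -> : rho ^+ i * (C * w ^+ n * rho ^+ (d - i) * W n x t) =
      C * w ^+ n * rho ^+ d * W n x t.
      by rewrite -{2}(subnKC id) exprD; ring.
    by rewrite ler_wpM2l ?lerDl//; nonneg.
  have h1 : `|f x - f t'| <= C * w ^+ n * (W n x t + W n t' t).
    by rewrite (le_trans (ler_normB _ _))// mulrDr lerD// fW.
  apply: (le_trans (ler_wpM2l _ h1)) => //.
  have -> : C * w ^+ n * rho ^+ d * (W n x t + W n t' t) =
    rho ^+ d * (C * w ^+ n * (W n x t + W n t' t)) by ring.
  apply: ler_wpM2r; first by nonneg.
  by apply: ler_wiXn2l; [exact: ltW|exact: ltW|exact: ltnW].
have -> : `|f x - f t'| * (C * w ^+ (n + d)) * (q / 2) ^+ i =
  C * w ^+ (n + d) * (rho / 2) ^+ i * (rho ^+ i * `|f x - f t'|).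
  have E : q / 2 = rho * (rho / 2) by ring.
  by rewrite E exprMn; ring.
apply: (le_trans (ler_wpM2l _ hS)); first by nonneg.
by rewrite le_eqVlt /A; apply/orP; left; apply/eqP; ring.
Qed.

Variable phi : nat -> R -> R.
Hypothesis hphi : forall k, molecule (phi k) (wlevel k) (wcenter k).
Implicit Types (s : seq nat).

Definition gram_cst : R := 20 * C ^+ 2 * kap * kap'.

Let bphi k : bddmeas (phi k). Proof. exact: molecule_bddmeas (hphi k). Qed.
Let tD k : D01 (wcenter k : R). Proof. exact: wcenter_D01. Qed.
Let bb t n i a : bddmeas (fun x => box t n i x * (W n x a)).
Proof. by apply: bddmeasM; [exact: bddmeas_chi|exact: weight_bddmeas]. Qed.

Lemma geom_sum_pair (A B : R) (s : seq nat) (P : pred nat) N (G : nat -> R) (Y : nat ->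
    nat -> R) :
  0 <= A -> 0 <= B ->
  (forall m, P m -> G m <= A * \sum_(i < N) (rho / 2) ^+ i * Y m i) ->
  (forall i, (i < N)%N -> \sum_(m <- s | P m) Y m i <= B * 2 ^+ i) ->
  \sum_(m <- s | P m) G m <= A * B * kap'.
Proof.
move=> A0 B0 hG hY; apply: (le_trans (ler_sum _ hG)).
rewrite -mulr_sumr -mulrA ler_wpM2l// exchange_big/=.
apply: (@le_trans _ _ (\sum_(i < N) B * rho ^+ i)).
  apply: ler_sum => i _; rewrite -mulr_sumr.
  have -> : B * rho ^+ i = (rho / 2) ^+ i * (B * 2 ^+ i).
    by rewrite expr_div_n; fieldnz.
  by rewrite ler_wpM2l ?hY//; nonneg.
by rewrite -mulr_sumr ler_wpM2l// geom_le// ltW.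
Qed.

(** Summing over the finer functions: first over their boxes containing x, then
    over the values of the coarse weight at their centers. *)
Lemma gram_fine s (P : pred nat) n d k : uniq s -> wlevel k = n ->
  (forall m, P m -> wlevel m = (n + d)%N) ->
  \sum_(m <- s | P m) `|int01 (fun x => phi k x * phi m x)| <= gram_cst * w ^+ d * rho ^+ d.
Proof.
move=> us kn Pn; have hk := hphi k; rewrite kn in hk.
pose Y m i := int01 (fun x => box (wcenter m) (n + d) i x * (W n x (wcenter k) + W n
    (wcenter m) (wcenter k))).
have := @geom_sum_pair (C ^+ 2 * w ^+ n * w ^+ (n + d) * rho ^+ d) (20 * kap / 2 ^+ n)
  s P (n + d).+1 (fun m => `|int01 (fun x => phi k x * phi m x)|) Y.
have -> : C ^+ 2 * w ^+ n * w ^+ (n + d) * rho ^+ d * (20 * kap / 2 ^+ n) * kap' =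
  gram_cst * w ^+ d * rho ^+ d.
  rewrite /gram_cst exprD -ww; fieldnz.
apply => [|||i iN]; [nonneg|nonneg| |].
  by move=> m Pm; apply: gram_pair => //; rewrite -(Pn m Pm).
rewrite ltnS in iN.
have Ybound m : P m -> Y m i <= int01 (fun x => box (wcenter m) (n + d) i x * W n x
    (wcenter k))
    + 2 * 2 ^+ i / 2 ^+ (n + d) * W n (wcenter m) (wcenter k).
  move=> Pm; rewrite /Y.
  rewrite (eq_int01 (g := fun x => box (wcenter m) (n + d) i x * W n x (wcenter k) +
     W n (wcenter m) (wcenter k) * box (wcenter m) (n + d) i x)); last by move=> x _; ring.
  rewrite int01D; [|by apply: bddmeas_integrable01; apply: bddmeasM;
      [exact: bddmeas_chi|exact: weight_bddmeas]
    |by apply: integrable01Z; apply: bddmeas_integrable01; exact: bddmeas_chi].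
  rewrite int01Z; last by apply: bddmeas_integrable01; exact: bddmeas_chi.
  rewrite lerD2l mulrC ler_wpM2r// -mulrA; exact: int01_box.
apply: (le_trans (ler_sum _ Ybound)); rewrite big_split/=.
have -> : 20 * kap / 2 ^+ n * 2 ^+ i = 5 * 2 ^+ i * (2 * kap / 2 ^+ n) +
  2 * 2 ^+ i / 2 ^+ (n + d) * (5 * kap * 2 ^+ d).
  by rewrite exprD; fieldnz.
apply: lerD; last first.
  rewrite -mulr_sumr; apply: ler_wpM2l; [nonneg|exact: sum_weight_fine].
rewrite -int01_sum; last by move=> m _; apply: bddmeas_integrable01; apply: bddmeasM;
    [exact: bddmeas_chi|exact: weight_bddmeas].
apply: (@le_trans _ _ (int01 (fun x => 5 * 2 ^+ i * W n x (wcenter k)))).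
  apply: le_int01 => [||x xD].
  - by apply: integrable01_sum => m _; apply: bddmeas_integrable01; apply: bddmeasM;
      [exact: bddmeas_chi|exact: weight_bddmeas].
  - by apply: integrable01Z; apply: bddmeas_integrable01; exact: weight_bddmeas.
  - rewrite -mulr_suml ler_wpM2r//.
    apply: (sum_near_le (n := (n + d)%N) (r := box_radius (n + d) i) (x := x)) => // m Pm.
    exact: box_near.
rewrite int01Z; last by apply: bddmeas_integrable01; exact: weight_bddmeas.
by apply: ler_wpM2l; [nonneg|exact: int01_weight].
Qed.

(** Summing over the coarser functions, whose weights have bounded sum at any
    point. *)
Lemma gram_coarse s (P : pred nat) n d m : uniq s -> wlevel m = (n + d)%N ->
  (forall k, P k -> wlevel k = n) ->
  \sum_(k <- s | P k) `|int01 (fun x => phi k x * phi m x)| <= gram_cst / w ^+ d * rho ^+ d.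
Proof.
move=> us mn Pn; have hm := hphi m; rewrite mn in hm.
pose Y k i := int01 (fun x => box (wcenter m) (n + d) i x * (W n x (wcenter k) + W n
    (wcenter m) (wcenter k))).
have := @geom_sum_pair (C ^+ 2 * w ^+ n * w ^+ (n + d) * rho ^+ d) (20 * kap / 2 ^+ (n + d))
  s P (n + d).+1 (fun k => `|int01 (fun x => phi k x * phi m x)|) Y.
have -> : C ^+ 2 * w ^+ n * w ^+ (n + d) * rho ^+ d * (20 * kap / 2 ^+ (n + d)) * kap' =
  gram_cst / w ^+ d * rho ^+ d.
  rewrite /gram_cst -ww exprD; fieldnz.
apply => [|||i iN]; [nonneg|nonneg| |].
  by move=> k Pk; apply: gram_pair => //; rewrite -(Pn k Pk).
rewrite ltnS in iN.
rewrite /Y -int01_sum; last first.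
  move=> k _; apply: bddmeas_integrable01; apply: bddmeasM; first exact: bddmeas_chi.
  by apply: bddmeasD; [exact: weight_bddmeas|exact: bddmeas_cst].
apply: (@le_trans _ _ (int01 (fun x => 10 * kap * box (wcenter m) (n + d) i x))).
  apply: le_int01 => [||x xD].
  - apply: integrable01_sum => k _; apply: bddmeas_integrable01; apply: bddmeasM;
      first exact: bddmeas_chi.
    by apply: bddmeasD; [exact: weight_bddmeas|exact: bddmeas_cst].
  - by apply: integrable01Z; apply: bddmeas_integrable01; exact: bddmeas_chi.
  - rewrite -mulr_sumr mulrC ler_wpM2r ?chi_ge0// big_split/=.
    have -> : 10 * kap = 5 * kap + 5 * kap by ring.
    by apply: lerD; exact: sum_weight.
rewrite int01Z; last by apply: bddmeas_integrable01; exact: bddmeas_chi.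
apply: (le_trans (ler_wpM2l _ (int01_box (tD m) iN))); first by nonneg.
by rewrite le_eqVlt /box_radius; apply/orP; left; apply/eqP; ring.
Qed.

(** Both cases in the form needed for Schur's test with weights w^-n. *)
Lemma gram_level s (P : pred nat) n' k : uniq s -> (forall m, P m -> wlevel m = n') ->
  \sum_(m <- s | P m) w ^+ wlevel k / w ^+ n' * `|int01 (fun x => phi k x * phi m x)|
    <= gram_cst * rho ^+ ((wlevel k - n') + (n' - wlevel k)).
Proof.
move=> us Pn; rewrite -mulr_sumr; set n := wlevel k.
have [nn'|nn'] := leqP n n'.
  have E : n' = (n + (n' - n))%N by rewrite subnKC.
  have Pn2 m : P m -> wlevel m = (n + (n' - n))%N by rewrite -E; exact: Pn.
  apply: (le_trans (ler_wpM2l _ (gram_fine us (erefl : wlevel k = n) Pn2)));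
      first by nonneg.
  rewrite (eqP (nn' : n - n' == 0)%N) add0n {1}E exprD.
  by rewrite le_eqVlt; apply/orP; left; apply/eqP; fieldnz.
have E : n = (n' + (n - n'))%N by rewrite subnKC// ltnW.
have {}nn' := ltnW nn'.
rewrite (eq_bigr (fun m => `|int01 (fun x => phi m x * phi k x)|)); last first.
  by move=> m _; congr `|_|; apply: eq_int01 => x _; rewrite mulrC.
apply: (le_trans (ler_wpM2l _ (gram_coarse us (E : wlevel k = _) Pn))); first by nonneg.
rewrite (eqP (nn' : n' - n == 0)%N) addn0 {1}E exprD.
by rewrite le_eqVlt; apply/orP; left; apply/eqP; fieldnz.
Qed.

Lemma sum_dist_geom n M : \sum_(i < M) rho ^+ ((n - i) + (i - n)) <= 2 * kap'.
Proof.
have g N : \sum_(j < N) rho ^+ j <= kap' by apply: geom_le => //; exact: ltW.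
suff h : \sum_(i < M) rho ^+ ((n - i) + (i - n)) <= kap' + \sum_(j < n) rho ^+ j.+1.
  apply: (le_trans h); rewrite mulr_natl mulr2n lerD2l.
  by apply: (le_trans _ (g n.+1)); rewrite big_ord_recl lerDr.
elim: n M => [|n ih] M.
  by rewrite big_ord0 addr0; under eq_bigr do rewrite sub0n add0n subn0.
case: M => [|M]; first by rewrite big_ord0 addr_ge0 ?sumr_ge0// ltW.
rewrite big_ord_recl/= subn0 addn0 big_ord_recr/= addrA [leRHS]addrC lerD2l.
by apply: le_trans (ih M); apply: ler_sum => i _; rewrite /bump /= add1n !subSS.
Qed.

Lemma level_split s (P : pred nat) : exists M, forall X : nat -> R,
  \sum_(k <- s | P k) X k = \sum_(n < M) \sum_(k <- s | P k && (wlevel k == n)) X k.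
Proof.
exists (\max_(k <- s) wlevel k).+1 => X.
rewrite (exchange_big_dep P)/=; last by move=> n k _ /andP[].
rewrite big_seq_cond [RHS]big_seq_cond; apply: eq_bigr => k /andP[ks Pk].
have kM : (wlevel k < (\max_(k <- s) wlevel k).+1)%N by rewrite ltnS leq_bigmax_seq.
rewrite (big_pred1 (Ordinal kM))// => i; rewrite Pk/=.
by rewrite eq_sym.
Qed.

(** Schur's test: |b_k b_m| <= (b_k^2 r + b_m^2 / r) / 2 with r the ratio of the
    weights of k and m, and the two resulting double sums are equal by symmetry of
    the Gram matrix. *)
Lemma synthesis_L2 s (b : nat -> R) : uniq s ->
  int01 (fun x => (\sum_(k <- s) b k * phi k x) ^+ 2) <=
    2 * gram_cst * kap' * \sum_(k <- s) b k ^+ 2.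
Proof.
move=> us; pose G k m := int01 (fun x => phi k x * phi m x).
have bG k m : bddmeas (fun x => b k * phi k x * (b m * phi m x)).
  by apply: bddmeasM; exact: bddmeasZ.
have -> : int01 (fun x => (\sum_(k <- s) b k * phi k x) ^+ 2) =
    \sum_(k <- s) \sum_(m <- s) b k * b m * G k m.
  rewrite (eq_int01 (g := fun x => \sum_(k <- s) \sum_(m <- s) b k * phi k x * (b m *
      phi m x))).
    rewrite int01_sum; last by move=> k _; apply: bddmeas_integrable01;
        apply: bddmeas_sum => m _; exact: bG.
    apply: eq_bigr => k _; rewrite int01_sum; last by move=> m _;
        exact: bddmeas_integrable01.
    apply: eq_bigr => m _; rewrite -int01Z; last by apply: bddmeas_integrable01;
        exact: bddmeasM.
    by apply: eq_int01 => x _; ring.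
  by move=> x _; rewrite expr2 big_distrlr.
pose r k m : R := w ^+ wlevel k / w ^+ wlevel m.
have r0 k m : 0 < r k m by rewrite divr_gt0.
pose S := \sum_(k <- s) b k ^+ 2 * \sum_(m <- s) r k m * `|G k m|.
have h1 : \sum_(k <- s) \sum_(m <- s) b k * b m * G k m <= S.
  have -> : S = \sum_(k <- s) \sum_(m <- s)
      (b k ^+ 2 * r k m + b m ^+ 2 * r m k) / 2 * `|G k m|.
    transitivity ((S + S) / 2); first by field.
    rewrite {2}/S.
    under [X in (_ + X) / _]eq_bigr do rewrite mulr_sumr.
    rewrite [X in (_ + X) / _]exchange_big/= /S -big_split/= mulr_suml.
    apply: eq_bigr => k _; rewrite mulr_sumr -big_split/= mulr_suml.
    apply: eq_bigr => m _; have -> : G m k = G k m.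
      by apply: eq_int01 => x _; rewrite mulrC.
    by ring.
  apply: ler_sum => k _; apply: ler_sum => m _.
  apply: (le_trans (ler_norm _)); rewrite normrM ler_wpM2r//.
  have rr : r k m * r m k = 1 by rewrite /r; fieldnz.
  have := r0 k m; have := r0 m k; set a := r k m in rr *; set c := r m k in rr *.
  move=> c0 a0; rewrite ler_pdivlMr//.
  have : 0 <= c * (a * `|b k| - `|b m|) ^+ 2 by rewrite mulr_ge0 ?sqr_ge0// ltW.
  have -> : c * (a * `|b k| - `|b m|) ^+ 2 =
    (a * c) * a * `|b k| ^+ 2 - 2 * (a * c) * (`|b k| * `|b m|) + c * `|b m| ^+ 2 by ring.
  rewrite rr mul1r mulr1 !real_normK ?num_real// normrM; lra.
apply: (le_trans h1); rewrite /S mulr_sumr; apply: ler_sum => k _.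
rewrite mulrC ler_wpM2r ?sqr_ge0//.
have [M ->] := level_split s predT.
apply: (@le_trans _ _ (\sum_(n < M) gram_cst * rho ^+ ((wlevel k - n) + (n - wlevel k)))).
  apply: ler_sum => n _; have hl := @gram_level s (fun m => wlevel m == n) n k us (fun
      m => @eqP _ _ _).
  apply: le_trans hl.
  by rewrite le_eqVlt; apply/orP; left; apply/eqP; apply: eq_bigr => m /eqP <-.
rewrite -mulr_sumr; have -> : 2 * gram_cst * kap' = gram_cst * (2 * kap') by ring.
rewrite ler_wpM2l ?sum_dist_geom//; rewrite /gram_cst; nonneg.
Qed.

(** Dual to [synthesis_L2].  With h the sum of the b_k phi_k, the sum of the b_k^2 is
    the inner product of a and h; expanding the nonnegative integral of
    D (a - h / D)^2 avoids square roots. *)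
Lemma analysis_L2 s (a : R -> R) : uniq s -> bddmeas a ->
  \sum_(k <- s) int01 (fun x => a x * phi k x) ^+ 2 <=
    2 * gram_cst * kap' * int01 (fun x => a x ^+ 2).
Proof.
move=> us ba; pose b k := int01 (fun x => a x * phi k x); pose h x :=
    \sum_(k <- s) b k * phi k x.
pose D : R := 2 * gram_cst * kap'.
have D0 : 0 < D by rewrite !mulr_gt0// /gram_cst !mulr_gt0// exprn_gt0.
have bh : bddmeas h by apply: bddmeas_sum => k _; exact: bddmeasZ.
have ES : \sum_(k <- s) b k ^+ 2 = int01 (fun x => a x * h x).
  rewrite (eq_int01 (g := fun x => \sum_(k <- s) b k * (a x * phi k x))); last first.
    by move=> x _; rewrite mulr_sumr; apply: eq_bigr => k _; ring.
  rewrite int01_sum; last by move=> k _; apply: integrable01Z;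
      apply: bddmeas_integrable01; exact: bddmeasM.
  by apply: eq_bigr => k _; rewrite int01Z -?expr2//; apply: bddmeas_integrable01;
      exact: bddmeasM.
have hS := synthesis_L2 b us; rewrite -/D -/(h _) in hS; set S :=
    \sum_(k <- s) b k ^+ 2 in ES hS *.
have : 0 <= int01 (fun x => D * a x ^+ 2 - 2 * (a x * h x) + D^-1 * h x ^+ 2).
  apply: int01_ge0 => x _.
  have -> : D * a x ^+ 2 - 2 * (a x * h x) + D^-1 * h x ^+ 2 = D * (a x - D^-1 * h x) ^+ 2.
    by fieldnz.
  by rewrite mulr_ge0 ?sqr_ge0// ltW.
have i1 : integrable01 (fun x => a x ^+ 2) by apply: bddmeas_integrable01;
    exact: bddmeas_sqr.
have i2 : integrable01 (fun x => a x * h x) by apply: bddmeas_integrable01; exact: bddmeasM.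
have i3 : integrable01 (fun x => h x ^+ 2) by apply: bddmeas_integrable01;
    exact: bddmeas_sqr.
rewrite int01D; [|by apply: integrable01B; exact: integrable01Z|exact: integrable01Z].
rewrite int01B; [|exact: integrable01Z..].
rewrite !int01Z// -ES.
have : D^-1 * int01 (fun x => h x ^+ 2) <= S by rewrite ler_pdivrMl.
rewrite /D; lra.
Qed.

End wavelets.

(** * Uniform bound of the partial sums on atoms *)
Section atom_bound.
Context {R : realType}.
Variables (rho C : R).
Hypotheses (rho0 : 0 < rho) (rho1 : rho < 1) (C0 : 0 < C).
Local Notation q := (rho ^+ 2).
Local Notation w := (Num.sqrt (2 : R)).
Local Notation kap := ((1 - q)^-1).
Local Notation kap' := ((1 - rho)^-1).
Local Notation W := (weight q).

Let wn0 n : 0 < w ^+ n. Proof. by rewrite exprn_gt0// w_gt0. Qed.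
Let q0 : 0 < q. Proof. exact: exprn_gt0. Qed.
Let q1 : q < 1. Proof. by rewrite exprn_ilt1// ltW. Qed.
Let k0 : 0 < kap. Proof. by rewrite invr_gt0 subr_gt0. Qed.
Let k0' : 0 < kap'. Proof. by rewrite invr_gt0 subr_gt0. Qed.
Let rn0 n : 0 < rho ^+ n. Proof. exact: exprn_gt0. Qed.
Let C0' : 0 <= C. Proof. exact: ltW. Qed.
Let w0' n : 0 <= w ^+ n. Proof. exact: ltW. Qed.
Let rn0' n : 0 <= rho ^+ n. Proof. exact: ltW. Qed.
Let wg0 n x t : 0 <= W n x t. Proof. exact: weight_ge0. Qed.

Variables (phi psi : nat -> R -> R).
Hypothesis hphi : forall k, molecule rho C (phi k) (wlevel k) (wcenter k).
Hypothesis hpsi : forall k, molecule rho C (psi k) (wlevel k) (wcenter k).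
Implicit Types (s : seq nat).

Let bphi k : bddmeas (phi k). Proof. exact: molecule_bddmeas (hphi k). Qed.
Let bpsi k : bddmeas (psi k). Proof. exact: molecule_bddmeas (hpsi k). Qed.
Let tD k : D01 (wcenter k : R). Proof. exact: wcenter_D01. Qed.

Lemma level_sum_le s (P : pred nat) (X Y : nat -> R) (Z : R) :
  (forall n, \sum_(k <- s | P k && (wlevel k == n)) X k <= Y n) ->
  (forall M, \sum_(n < M) Y n <= Z) -> \sum_(k <- s | P k) X k <= Z.
Proof.
move=> XY YZ; have [M hM] := @level_split R s P; rewrite hM.
by apply: le_trans (YZ M); apply: ler_sum => n _; exact: XY.
Qed.

Lemma dyadic_scale (l : R) : 0 < l -> l <= 1 -> exists N,
  l <= 1 / 2 ^+ N /\ l^-1 <= 2 * 2 ^+ N.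
Proof.
move=> l0 l1; have ex : exists n, (1 / 2 ^+ n < l).
  exists (Num.bound l^-1); set n := Num.bound _.
  have h : l^-1 < 2 ^+ n.
    apply: (lt_le_trans (archi_boundP _)); first by rewrite invr_ge0 ltW.
    by rewrite -natrX ler_nat ltnW// ltn_expl.
  by rewrite ltr_pdivrMr ?exprn_gt0// mulrC -ltr_pdivrMr// mul1r.
case: (ex_minnP ex) => -[|N] hN minN.
  by move: hN; rewrite expr0 divr1 ltNge l1.
exists N; split.
  by rewrite leNgt; apply/negP => /minN; rewrite ltnn.
move: hN; rewrite exprS ltr_pdivrMr ?mulr_gt0 ?exprn_gt0// => h.
by rewrite -[l^-1]mul1r ler_pdivrMr// mulrC ltW.
Qed.

Let D : R := 2 * gram_cst rho C * kap'.
Let D0 : 0 < D.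
Proof. by rewrite /D /gram_cst !mulr_gt0// ?exprn_gt0. Qed.
Let H := molecule_cst rho C.
Let H0 : 0 < H.
Proof.
rewrite /H /molecule_cst /box_cst !mulr_gt0//.
by rewrite addr_gt0// divr_gt0 ?subr_gt0// mulr_gt0// addr_gt0// mulr_gt0// divr_gt0
    ?subr_gt0.
Qed.

Section one_atom.
Variables (a : R -> R) (u : R) (N : nat) (s : seq nat).
Hypotheses (us : uniq s) (uD : D01 u) (ba : bddmeas a) (Ia : int01 a = 0)
  (aM : forall x, D01 x -> `|a x| <= 2 * 2 ^+ N)
  (asupp : forall x, D01 x -> a x != 0 -> `|u - x| <= 1 / 2 ^+ N)
  (aL1 : int01 (fun x => `|a x|) <= 1).

Let b k := int01 (fun x => a x * psi k x).
Let bab : bddmeas (fun x => `|a x|). Proof. exact: bddmeas_abs. Qed.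
Let farP k := (2 / 2 ^+ N <= `|u - wcenter k|).

Lemma b_le k : `|b k| <= int01 (fun x => `|a x| * `|psi k x|).
Proof.
rewrite /b (eq_int01 (f := fun x => `|a x| * `|psi k x|) (g := fun x => `|a x * psi k x|)).
  by apply: le_normr_int01; apply: bddmeas_integrable01; exact: bddmeasM.
by move=> x _; rewrite normrM.
Qed.

(** a is used as a density of total mass at most 1. *)
Lemma aL1_cst (f : R -> R) c : bddmeas f -> 0 <= c ->
  (forall x, D01 x -> a x != 0 -> f x <= c) -> int01 (fun x => `|a x| * f x) <= c.
Proof.
move=> bf c0 hf; apply: (@le_trans _ _ (int01 (fun x => c * `|a x|))).
  apply: le_int01 => [||x xD].
  - by apply: bddmeas_integrable01; exact: bddmeasM.
  - by apply: integrable01Z; exact: bddmeas_integrable01.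
  - have [->|ax] := eqVneq (a x) 0; first by rewrite normr0 mul0r mulr0.
    by rewrite mulrC ler_wpM2r// hf.
by rewrite int01Z ?ler_piMr//; exact: bddmeas_integrable01.
Qed.

(** The cancellation of a allows subtracting psi_k u, and the support of a has
    radius 2^-n / 2^(N - n). *)
Lemma b_coarse k : (wlevel k <= N)%N ->
  `|b k| <= C * w ^+ wlevel k * rho ^+ (N - wlevel k) * W (wlevel k) u (wcenter k).
Proof.
move=> kN; have [_ _ _ hH] := hpsi k.
have bp : bddmeas (fun x => psi k x - psi k u) by apply: bddmeasB => //; exact: bddmeas_cst.
have -> : b k = int01 (fun x => a x * (psi k x - psi k u)).
  rewrite [RHS](eq_int01 (g := fun x => a x * psi k x - psi k u * a x)); last first.
    by move=> x _; ring.
  rewrite int01B; [|by apply: bddmeas_integrable01;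
      exact: bddmeasM|by apply: integrable01Z; exact: bddmeas_integrable01].
  by rewrite int01Z ?Ia ?mulr0 ?subr0//; exact: bddmeas_integrable01.
apply: (le_trans (le_normr_int01 (bddmeas_integrable01 (bddmeasM ba bp)))).
rewrite (eq_int01 (g := fun x => `|a x| * `|psi k x - psi k u|)); last first.
  by move=> x _; rewrite normrM.
apply: aL1_cst; [exact: bddmeas_abs|nonneg|move=> x xD ax].
rewrite distrC; apply: hH => //; rewrite subnKC//; exact: asupp.
Qed.

Lemma fa_term k : finite_atomic (fun x => b k * phi k x) (`|b k| * (H / w ^+ wlevel k)).
Proof. by apply: faZ; apply: molecule_fa. Qed.

(* the bound for the terms of level n, common to the coarse and far parts *)
Let Y n := H * C * (5 * kap) * rho ^+ ((N - n) + (n - N)).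

Lemma sum_Y M : \sum_(n < M) Y n <= H * C * (5 * kap) * (2 * kap').
Proof.
by rewrite -mulr_sumr ler_wpM2l ?sum_dist_geom//; nonneg.
Qed.

Lemma coarse_part :
  \sum_(k <- s | (wlevel k <= N)%N) `|b k| * (H / w ^+ wlevel k) <=
      H * C * (5 * kap) * (2 * kap').
Proof.
apply: level_sum_le sum_Y => n; have [nN|nN] := leqP n N; last first.
  rewrite big_pred0; first by rewrite /Y; nonneg.
  by move=> k; apply/negbTE/negP => /andP[kN /eqP kn]; move: kN; rewrite kn leqNgt nN.
apply: (@le_trans _ _ (\sum_(k <- s | (wlevel k <= N)%N && (wlevel k == n))
    H * C * rho ^+ (N - n) * W n u (wcenter k))).
  apply: ler_sum => k /andP[kN /eqP kn].
  have hH0 : 0 <= H / w ^+ wlevel k by nonneg.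
  apply: (le_trans (ler_wpM2r hH0 (b_coarse kN))); rewrite kn.
  by rewrite le_eqVlt; apply/orP; left; apply/eqP; fieldnz.
rewrite -mulr_sumr /Y (eqP (nN : n - N == 0)%N) addn0.
have -> : H * C * (5 * kap) * rho ^+ (N - n) = H * C * rho ^+ (N - n) * (5 * kap) by ring.
apply: ler_wpM2l; first by nonneg.
by apply: sum_weight => // k /andP[_ /eqP].
Qed.

(** On the support of a, a far center is at distance at least 2^-N, which is the
    radius of the box of index n - N at level n; so only the tails of the weights
    matter. *)
Lemma far_part :
  \sum_(k <- s | ~~ (wlevel k <= N)%N && farP k) `|b k| * (H / w ^+ wlevel k)
    <= H * C * (5 * kap) * (2 * kap').
Proof.
apply: level_sum_le sum_Y => n; have [nN|nN] := leqP n N.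
  rewrite big_pred0; first by rewrite /Y; nonneg.
  by move=> k; apply/negbTE/negP => /andP[/andP[kN _] /eqP kn]; move: kN; rewrite kn nN.
set P := fun k => ~~ (wlevel k <= N)%N && farP k && (wlevel k == n).
apply: (@le_trans _ _ (\sum_(k <- s | P k) H * C * int01 (fun x => `|a x| * W n x
    (wcenter k)))).
  apply: ler_sum => k /andP[_ /eqP kn].
  have hH0 : 0 <= H / w ^+ wlevel k by nonneg.
  apply: (le_trans (ler_wpM2r hH0 (b_le k))).
  apply: (@le_trans _ _ (int01 (fun x => C * w ^+ n * (`|a x| * W n x (wcenter k))) *
      (H / w ^+ wlevel k))).
    apply: ler_wpM2r => //; apply: le_int01 => [||x xD].
    - by apply: bddmeas_integrable01; apply: bddmeasM => //; exact: bddmeas_abs.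
    - by apply: integrable01Z; apply: bddmeas_integrable01; apply: bddmeasM => //;
        exact: weight_bddmeas.
    - have [_ _ hW _] := hpsi k; rewrite mulrCA ler_wpM2l//.
      by rewrite -kn; exact: hW.
  rewrite int01Z; last by apply: bddmeas_integrable01; apply: bddmeasM => //;
      exact: weight_bddmeas.
  by rewrite kn le_eqVlt; apply/orP; left; apply/eqP; fieldnz.
rewrite -mulr_sumr -int01_sum; last by move=> k _; apply: bddmeas_integrable01;
    apply: bddmeasM => //; exact: weight_bddmeas.
have -> : Y n = H * C * (5 * kap * rho ^+ ((N - n) + (n - N))) by rewrite /Y; ring.
apply: ler_wpM2l; first by nonneg.
rewrite (eq_int01 (g := fun x => `|a x| * \sum_(k <- s | P k) W n x (wcenter k)));
    last first.
  by move=> x _; rewrite mulr_sumr.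
apply: aL1_cst; [by apply: bddmeas_sum => k _; exact: weight_bddmeas|nonneg|move=> x xD ax].
rewrite (eqP (ltnW nN : N - n == 0)%N) add0n.
apply: (@le_trans _ _ (5 * kap * q ^+ (n - N))).
  apply: sum_weight_tail => // [k /andP[_ /eqP]//|k j /andP[/andP[_ kf] _] jn].
  have hr : box_radius n (n - N) = 1 / 2 ^+ N :> R.
    by rewrite /box_radius -{2}(subnK (ltnW nN)) exprD; fieldnz.
  apply: (lt_le_trans (box_radius_lt n jn)); rewrite hr.
  have := ler_distD x u (wcenter k); have := asupp xD ax; move: kf; rewrite /farP.
  have -> : 2 / 2 ^+ N = 1 / 2 ^+ N + 1 / 2 ^+ N :> R by rewrite -mulrDl.
  by lra.
rewrite -exprM mulnC exprM expr2; apply: ler_wpM2l; first by nonneg.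
by rewrite ler_piMr// exprn_ile1// ltW.
Qed.

Let nearP k := ~~ (wlevel k <= N)%N && ~~ farP k.
Let f x := \sum_(k <- s | nearP k) b k * phi k x.
(* the decay of f accounts for the first term, its L^2 norm for the second *)
Let K1 : R := 4 * 4 * 4 * 5 * kap * kap' * C ^+ 2 + 3 * D.
Let K10 : 0 < K1.
Proof. by rewrite addr_gt0// !mulr_gt0// ?exprn_gt0. Qed.

Lemma sqr_a_le : int01 (fun x => a x ^+ 2) <= 2 * 2 ^+ N.
Proof.
apply: (@le_trans _ _ (int01 (fun x => `|a x| * `|a x|))).
  rewrite le_eqVlt; apply/orP; left; apply/eqP; apply: eq_int01 => x _.
  by rewrite -normrM -expr2 ger0_norm// sqr_ge0.
by apply: aL1_cst => [//||x xD _]; [nonneg|exact: aM].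
Qed.

(** The boxes used for the near part start at radius 4 2^-N instead of 2^-N, to
    contain all near centers; N - 2 is truncated subtraction, and for N < 2 the
    first box is already [0, 1[. *)
Lemma pow_N2 : (2 : R) ^+ N <= 4 * 2 ^+ (N - 2).
Proof.
have -> : 4 * 2 ^+ (N - 2) = 2 ^+ ((N - 2) + 2) :> R by rewrite exprD; ring.
by rewrite ler_weXn2l ?ler1n// addnC -leq_subLR.
Qed.

Lemma near_L2 : int01 (fun x => f x ^+ 2) <= K1 ^+ 2 * 2 ^+ (N - 2).
Proof.
pose s' := [seq k <- s | nearP k].
have us' : uniq s' by exact: filter_uniq.
have hs := synthesis_L2 rho0 rho1 C0 hphi b us'.
have -> : int01 (fun x => f x ^+ 2) = int01 (fun x => (\sum_(k <- s') b k * phi k x) ^+ 2).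
  by apply: eq_int01 => x _; rewrite /f /s' big_filter.
apply: (le_trans hs); rewrite -/D.
have hb := analysis_L2 rho0 rho1 C0 hpsi us' ba.
have h1 : D * \sum_(k <- s') b k ^+ 2 <= D * (D * (2 * 2 ^+ N)).
  rewrite ler_wpM2l ?(ltW D0)//; apply: (le_trans hb).
  by rewrite ler_wpM2l ?(ltW D0)// sqr_a_le.
apply: (le_trans h1).
have -> : D * (D * (2 * 2 ^+ N)) = 2 * D ^+ 2 * 2 ^+ N by ring.
apply: (@le_trans _ _ (2 * D ^+ 2 * (4 * 2 ^+ (N - 2)))).
  by rewrite ler_wpM2l ?pow_N2//; nonneg.
rewrite mulrA ler_wpM2r ?exprn_ge0//.
apply: (@le_trans _ _ ((3 * D) ^+ 2)).
  have -> : (3 * D) ^+ 2 = 9 * D ^+ 2 by ring.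
  by have := sqr_ge0 D; move: (D ^+ 2) => z; lra.
rewrite ler_sqr ?nnegrE; [|nonneg|exact: ltW].
by rewrite lerDr; nonneg.
Qed.

Lemma near_b k : `|b k| <= 4 * kap * C * 2 ^+ N / w ^+ wlevel k.
Proof.
apply: (le_trans (b_le k)).
apply: (@le_trans _ _ (int01 (fun x => 2 * 2 ^+ N * `|psi k x|))).
  apply: le_int01 => [||x xD].
  - by apply: bddmeas_integrable01; apply: bddmeasM => //; exact: bddmeas_abs.
  - by apply: integrable01Z; apply: integrable01_abs; exact: bddmeas_integrable01.
  - by rewrite ler_wpM2r// aM.
rewrite int01Z; last by apply: integrable01_abs; exact: bddmeas_integrable01.
have hL := molecule_L1 rho0 rho1 C0 (tD k) (hpsi k).
apply: (le_trans (ler_wpM2l _ hL)); first by nonneg.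
by rewrite le_eqVlt; apply/orP; left; apply/eqP; ring.
Qed.

(** Outside the box of index i, of radius 4 2^i 2^-N, every near center is at
    distance at least 2 2^i 2^-N from x, where the weight of level n is at most
    2 (q/2)^(n - N + i + 1); there are at most 5 2^(n - N + 1) near centers of level
    n. *)
Lemma near_decay i x : (i < N - 2)%N -> D01 x -> box_radius (N - 2) i <= `|x - u| ->
  `|f x| <= K1 * 2 ^+ (N - 2) * (q / 2) ^+ i.
Proof.
move=> iN xD far.
have N2 : (2 <= N)%N by rewrite ltnW// -subn_gt0 (leq_ltn_trans _ iN).
have hq : 0 <= (q / 2) ^+ i by nonneg.
apply: (le_trans (ler_norm_sum _ _ _)).
apply: (@le_trans _ _ (\sum_(k <- s | nearP k) 4 * kap * C ^+ 2 * 2 ^+ N * W (wlevel k)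
    x (wcenter k))).
  apply: ler_sum => k _; rewrite normrM; have [_ _ hW _] := hphi k.
  apply: (le_trans (ler_pM _ _ (near_b k) (hW x xD))) => //.
  by rewrite le_eqVlt; apply/orP; left; apply/eqP; fieldnz.
rewrite -mulr_sumr.
have hsum : \sum_(k <- s | nearP k) W (wlevel k) x (wcenter k) <=
    10 * (q / 2) ^+ i * (2 * kap').
  pose Y' n := 10 * (q / 2) ^+ i * rho ^+ ((N - n) + (n - N)).
  apply: (@level_sum_le _ _ _ Y') => [n|M]; last first.
    by rewrite -mulr_sumr; apply: ler_wpM2l; [nonneg|exact: sum_dist_geom].
  have [nN|nN] := leqP n N.
    rewrite big_pred0; first by rewrite /Y'; nonneg.
    by move=> k; apply/negbTE/negP => /andP[/andP[kN _] /eqP kn]; move: kN; rewrite kn nN.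
  pose d := (n - N)%N; have nE : n = (d + N)%N by rewrite subnK// ltnW.
  apply: (@le_trans _ _ (\sum_(k <- s | nearP k && (wlevel k == n)) 2 * (q / 2) ^+ (d +
      i.+1) * 1)).
    apply: ler_sum => k /andP[/andP[_ kn] /eqP ->]; rewrite mulr1.
    apply: weight_tail => //; have := ler_distD (wcenter k) x u; move: kn;
        rewrite /farP -ltNge.
    rewrite [`|wcenter k - u|]distrC => h1 h2; move: far; rewrite /box_radius => far.
    have E1 : 2 ^+ (d + i.+1) / 2 ^+ n = 2 * 2 ^+ i / 2 ^+ N :> R.
      by rewrite nE !exprD exprS; fieldnz.
    have E2 : 2 ^+ i / 2 ^+ (N - 2) = 4 * 2 ^+ i / 2 ^+ N :> R.
      by rewrite -{2}(subnK N2) exprD; fieldnz.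
    rewrite E1; rewrite E2 in far.
    have E3 : 1 / 2 ^+ N <= 2 ^+ i / 2 ^+ N :> R.
      by rewrite ler_wpM2r ?exprn_ege1 ?ler1n// invr_ge0 exprn_ge0.
    move: far h1 h2 E3; rewrite -!mulrA !mul1r; lra.
  rewrite -mulr_sumr.
  have hc : \sum_(k <- s | nearP k && (wlevel k == n)) (1 : R) <= 5 * 2 ^+ d.+1.
    apply: (@sum_near_le _ _ n _ _ _ u (2 / 2 ^+ N)) => // [k /andP[_ /eqP]//||k].
      by rewrite nE exprS exprD le_eqVlt; apply/orP; left; apply/eqP; fieldnz.
    by case/andP => /andP[_]; rewrite /farP -ltNge => /ltW -> _.
  apply: (le_trans (ler_wpM2l _ hc)); first by nonneg.
  have -> : 2 * (q / 2) ^+ (d + i.+1) * (5 * 2 ^+ d.+1) = 10 * (q / 2) ^+ i * (q ^+ d * q).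
    by rewrite exprD (exprS _ i) (exprS 2 d) [(q / 2) ^+ d]expr_div_n; fieldnz.
  rewrite /Y' (eqP (ltnW nN : N - n == 0)%N) add0n -/d.
  apply: ler_wpM2l; first by nonneg.
  rewrite -exprM mulnC exprM [_ ^+ 2]expr2 -mulrA ler_piMr// mulr_ile1 ?exprn_ile1 ?ltW//.
apply: (le_trans (ler_wpM2l _ hsum)); first by nonneg.
apply: (@le_trans _ _ (4 * 4 * 4 * 5 * kap * kap' * C ^+ 2 * 2 ^+ (N - 2) * (q / 2) ^+ i)).
  have := ler_wpM2l (_ : 0 <= 4 * 4 * 5 * kap * kap' * C ^+ 2 * (q / 2) ^+ i) pow_N2.
  have h : 0 <= 4 * 4 * 5 * kap * kap' * C ^+ 2 * (q / 2) ^+ i by nonneg.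
  move=> /(_ h) {h}; rewrite !mulrA => h; apply: le_trans (le_trans h _).
    by rewrite le_eqVlt; apply/orP; left; apply/eqP; ring.
  by rewrite le_eqVlt; apply/orP; left; apply/eqP; ring.
apply: ler_wpM2r => //; apply: ler_wpM2r; first by nonneg.
by rewrite lerDl; nonneg.
Qed.

Lemma near_part : finite_atomic f (box_cst q * K1).
Proof.
have ucf : ucont f by apply: ucont_sum => k _; apply: ucontZ; case: (hphi k).
have If : int01 f = 0.
  rewrite int01_sum; last by move=> k _; apply: integrable01Z; exact: bddmeas_integrable01.
  by rewrite big1// => k _; rewrite int01Z; [case: (hphi k) => _ -> _ _;
      rewrite mulr0|exact: bddmeas_integrable01].
exact: (fa_molecule uD q0 q1 K10 ucf If near_decay near_L2).
Qed.

Definition atom_cst : R := 2 * (H * C * (5 * kap) * (2 * kap')) + box_cst q * K1.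

Lemma one_atom_bound : finite_atomic (fun x => \sum_(k <- s) b k * phi k x) atom_cst.
Proof.
have h1 := fa_sum s (fun k (_ : (wlevel k <= N)%N) => fa_term k).
have h2 := fa_sum s (fun k (_ : ~~ (wlevel k <= N)%N && farP k) => fa_term k).
apply: (FinAtom_ext (faD (faD h1 h2) near_part)).
  by rewrite /atom_cst mulr_natl mulr2n lerD2r lerD// ?coarse_part ?far_part.
move=> x _; rewrite (bigID (fun k => (wlevel k <= N)%N))/= -addrA; congr (_ + _).
by rewrite (bigID farP).
Qed.

End one_atom.

Lemma atom_bound a s : bounded_atom a -> uniq s ->
  finite_atomic (fun x => \sum_(k <- s) int01 (fun y => a y * psi k y) * phi k x) atom_cst.
Proof.
move=> ha us; have aL1 := atom_or_cst1_L1 (or_intror ha).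
have [u [v [[u0 uv v1] [ba a0 aM Ia]]]] := ha.
have [N [h1 h2]] := @dyadic_scale (v - u) ltac:(by rewrite subr_gt0) ltac:(lra).
apply: (@one_atom_bound a u N s) => //.
- by apply/D01P; split => //; exact: lt_le_trans v1.
- by move=> x _; apply: (le_trans (aM x)).
- move=> x _ ax; case: (boolP (u <= x < v)) => [/andP[ux xv]|/a0 ax0];
    last by rewrite ax0 eqxx in ax.
  by rewrite ler_norml; apply/andP; split; lra.
Qed.

End atom_bound.

(** * Norms on the unit interval *)
Section conversions.
Context {R : realType}.
Local Notation mu := (@lebesgue_measure R).
Local Notation mR := (measurableTypeR R).
Implicit Types (f g h a : R -> R) (c : nat -> R).

Lemma unit_D01 (x : R) : D01 x -> unit_itv x.
Proof. by move=> /D01P[x0 x1]; rewrite /unit_itv/= in_itv/= x0 ltW. Qed.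

Lemma measurable_unit : @measurable _ mR (unit_itv : set R).
Proof. exact: measurable_itv. Qed.

Lemma integral_unit f : @measurable_fun _ _ mR R D01 f ->
  (\int[mu]_(x in unit_itv) (f x)%:E = \int[mu]_(x in D01) (f x)%:E)%E.
Proof.
move=> mf; rewrite /unit_itv /D01 integral_itv_bndo_bndc//.
exact/measurable_EFinP.
Qed.

Lemma integrable01_measurable f : integrable01 f -> @measurable_fun _ _ mR R D01 f.
Proof. by move=> /measurable_int /measurable_EFinP. Qed.

Lemma EFin_int01 f : integrable01 f -> (\int[mu]_(x in D01) (f x)%:E = (int01 f)%:E)%E.
Proof.
move=> hf; rewrite /int01 /Rintegral fineK//.
exact: (integrable_fin_num measurable_D01 hf).
Qed.

Lemma integral_unit_int01 f : integrable01 f ->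
    (\int[mu]_(x in unit_itv) (f x)%:E = (int01 f)%:E)%E.
Proof. by move=> hf; rewrite integral_unit ?EFin_int01//;
    exact: integrable01_measurable. Qed.

Lemma Lp01_norm1 f : integrable01 f -> Lp01_norm 1%E f = (int01 (fun x => `|f x|))%:E.
Proof.
move=> hf; rewrite /Lp01_norm Lnorm1 -(integral_unit_int01 (integrable01_abs hf))
    [RHS]integral_mkcond.
apply: eq_integral => x _ /=.
by rewrite /patch/=; case: ifPn => _ //=; rewrite normr0.
Qed.

Lemma Lp01_norm2 g : bddmeas g ->
  (Lp01_norm 2%:E g `^ 2 = (int01 (fun x => g x ^+ 2))%:E)%E.
Proof.
move=> hg; rewrite /Lp01_norm poweR_Lnorm//.
have hg2 : integrable01 (fun x => g x ^+ 2).
  by apply: bddmeas_integrable01; apply: eq_bddmeas (bddmeasM hg hg) => x _; rewrite expr2.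
rewrite -(integral_unit_int01 hg2) [RHS]integral_mkcond.
apply: eq_integral => x _ /=.
rewrite /patch/=; case: ifPn => _ /=.
  by rewrite powR_mulrn// real_normK// num_real.
by rewrite normr0 powR0.
Qed.

Lemma Lp01_norm2_lt g e : bddmeas g -> (Lp01_norm 2%:E g <= e%:E)%E ->
  int01 (fun x => g x ^+ 2) <= e ^+ 2.
Proof.
move=> hg he; have := Lp01_norm2 hg.
have h0 : (0 <= Lp01_norm 2%:E g)%E by exact: Lnorm_ge0.
move: h0 he; case: (Lp01_norm 2%:E g) => [r| |]//; rewrite !lee_fin => r0 re.
rewrite poweR_EFin powR_mulrn// => -[<-].
by rewrite ler_sqr// nnegrE (le_trans r0).
Qed.

Lemma Lp01_1_integrable01 f : Lp01 1%E f -> integrable01 f.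
Proof.
move=> /Lfun1_integrable; rewrite -restrict_EFin.
move=> /(integrable_mkcond _ measurable_unit).
apply: integrableS; [exact: measurable_unit|exact: measurable_D01|].
by move=> x; exact: unit_D01.
Qed.

Lemma Lp01_2_bounded f : bddmeas f -> (forall x, ~ D01 x -> f x = 0) -> Lp01 2%:E f.
Proof.
move=> hf f0; have E : f \_ unit_itv = f \_ D01.
  apply/funext => x; rewrite /patch; case: ifPn => h; case: ifPn => h' //.
    by rewrite f0//; move: h'; rewrite notin_setE.
  by move: h; rewrite notin_setE; case; apply: unit_D01; exact: set_mem h'.
rewrite /Lp01/= inE/=; apply/andP; split.
  by rewrite inE/= E; apply/(measurable_restrictT _ measurable_D01); case: hf.
rewrite inE/= /finite_norm.
have := Lp01_norm2 hf; rewrite /Lp01_norm.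
have := Lnorm_ge0 mu 2%:E (EFin \o f \_ unit_itv).
case: ('N[mu]_2%:E[EFin \o f \_ unit_itv])%E => [r _ _| |]//; first exact: ltry.
by move=> _; rewrite poweRyr.
Qed.

Lemma cvg0_ereal (u : nat -> \bar R) : (forall n, 0 <= u n)%E ->
  u @ \oo --> (0 : \bar R)%E <->
  (forall e : R, 0 < e -> exists N, forall n, (N <= n)%N -> (u n <= e%:E)%E).
Proof.
move=> u0; split.
  move=> /fine_cvgP[hfin /cvgrPdist_le hc] e e0.
  have [N _ hN] := filterI hfin (hc e e0).
  exists N => n /hN[/= nfin]; rewrite sub0r normrN => he.
  by rewrite -(fineK nfin) lee_fin (le_trans (ler_norm _)).
move=> h; apply/fine_cvgP; split.
  have [N hN] := h 1 ltr01; exists N => // n /= /hN un.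
  by rewrite ge0_fin_numE// (le_lt_trans un)// ltry.
apply/cvgrPdist_le => e e0; have [N hN] := h e e0.
exists N => // n /= /hN un; rewrite sub0r normrN ger0_norm ?fine_ge0//.
have fn : u n \is a fin_num by rewrite ge0_fin_numE// (le_lt_trans un)// ltry.
by rewrite -lee_fin fineK.
Qed.

(** * Countable atomic sums *)

(** [countably_atomic f K]: f is an L^1-convergent series of finite atomic sums of
    total cost at most K.  Grouping the atoms makes sums and multiples immediate;
    [ca_decomposition] flattens the groups into one series of atoms. *)
Definition countably_atomic f (K : R) := integrable01 f /\ exists (F : nat -> R ->
    R) (k : nat -> R),
  [/\ forall i, finite_atomic (F i) (k i),
      forall n, \sum_(i < n) k i <= K &
      forall e, 0 < e -> exists N, forall n, (N <= n)%N ->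
        int01 (fun x => `|f x - \sum_(i < n) F i x|) <= e].

Lemma fa_integrable01 f K : finite_atomic f K -> integrable01 f.
Proof. by move=> /fa_bddmeas/bddmeas_integrable01. Qed.

Lemma integrable01_sub_fa f (F : nat -> R -> R) (k : nat -> R) n : integrable01 f ->
  (forall i, finite_atomic (F i) (k i)) -> integrable01 (fun x => f x - \sum_(i < n) F i x).
Proof.
by move=> hf hF; apply: integrable01B => //; apply: integrable01_sum => i _;
    exact: fa_integrable01 (hF i).
Qed.

Lemma L1_triangle f g : integrable01 f -> integrable01 g ->
  int01 (fun x => `|f x + g x|) <= int01 (fun x => `|f x|) + int01 (fun x => `|g x|).
Proof.
move=> hf hg; rewrite -int01D; try exact: integrable01_abs.
apply: le_int01 => [||x _]; [by apply: integrable01_abs;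
    exact: integrable01D|by apply: integrable01D; exact: integrable01_abs|].
exact: ler_normD.
Qed.

Lemma ca_fa f K : finite_atomic f K -> countably_atomic f K.
Proof.
move=> hf; split; first exact: fa_integrable01 hf.
have K0 := fa_ge0 hf.
exists (fun i => if i is 0 then f else fun=> 0), (fun i => if i is 0 then K else 0); split.
- by case=> [//|i]; exact: FinAtom0.
- by case=> [|n]; [rewrite big_ord0|rewrite big_ord_recl/= big1// addr0].
- move=> e e0; exists 1%N => -[//|n] _.
  rewrite (eq_int01 (g := fun=> 0)) ?int01_cst; first exact: ltW.
  by move=> x _; rewrite big_ord_recl/= big1// addr0 subrr normr0.
Qed.

Lemma caD f g K L : countably_atomic f K -> countably_atomic g L ->
    countably_atomic (fun x => f x + g x) (K + L).
Proof.
move=> [hf [F [k [hF hk hc]]]] [hg [G [l [hG hl hd]]]]; split; first exact: integrable01D.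
exists (fun i x => F i x + G i x), (fun i => k i + l i); split.
- by move=> i; exact: faD.
- by move=> n; rewrite big_split; apply: lerD; [exact: hk|exact: hl].
- move=> e e0; have e2 : 0 < e / 2 by rewrite divr_gt0.
  have [N hN] := hc _ e2; have [M hM] := hd _ e2.
  exists (maxn N M) => n; rewrite geq_max => /andP[/hN h1 /hM h2].
  rewrite (eq_int01 (g := fun x => `|(f x - \sum_(i < n) F i x) + (g x - \sum_(i < n) G
      i x)|)).
    apply: (le_trans (L1_triangle _ _)); try exact: integrable01_sub_fa.
    by rewrite [leRHS]splitr lerD.
  by move=> x _; rewrite big_split/= opprD addrACA.
Qed.

Lemma caZ (a : R) f K : countably_atomic f K ->
    countably_atomic (fun x => a * f x) (`|a| * K).
Proof.
move=> [hf [F [k [hF hk hc]]]]; split; first exact: integrable01Z.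
exists (fun i x => a * F i x), (fun i => `|a| * k i); split.
- by move=> i; exact: faZ.
- by move=> n; rewrite -mulr_sumr ler_wpM2l.
- move=> e e0; have a1 : 0 < `|a| + 1 by rewrite ltr_wpDl.
  have [N hN] := hc _ (divr_gt0 e0 a1); exists N => n /hN h.
  rewrite (eq_int01 (g := fun x => `|a| * `|f x - \sum_(i < n) F i x|)).
    rewrite int01Z; last by apply: integrable01_abs; exact: integrable01_sub_fa.
    apply: (le_trans (ler_wpM2l _ h)) => //.
    by rewrite mulrCA ger_pMr// ler_pdivrMr// mul1r lerDl.
  by move=> x _; rewrite -normrM mulrBr mulr_sumr.
Qed.

Lemma ca_le f K L : countably_atomic f K -> K <= L -> countably_atomic f L.
Proof.
move=> [hf [F [k [hF hk hc]]]] KL; split => //; exists F, k; split => // n.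
exact: le_trans KL.
Qed.

Lemma eq_ca f g K : (forall x, D01 x -> f x = g x) -> countably_atomic f K ->
    countably_atomic g K.
Proof.
move=> fg [hf [F [k [hF hk hc]]]]; split; first exact: eq_integrable01 hf.
exists F, k; split => // e /hc[N hN]; exists N => n /hN.
by rewrite (eq_int01 (g := fun x => `|g x - \sum_(i < n) F i x|))// => x /fg ->.
Qed.

Lemma ca_L1 f K : countably_atomic f K -> int01 (fun x => `|f x|) <= K.
Proof.
move=> [hf [F [k [hF hk hc]]]]; apply/ler_addgt0Pr => e e0.
have [N /(_ N (leqnn _)) hN] := hc e e0.
have hS : finite_atomic (fun x => \sum_(i < N) F i x) (\sum_(i < N) k i) by exact: fa_sum.
rewrite (eq_int01 (g := fun x => `|\sum_(i < N) F i x + (f x - \sum_(i < N) F i x)|)).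
  apply: (le_trans (L1_triangle _ _)); [exact: fa_integrable01 hS|exact:
      integrable01_sub_fa|].
  by apply: lerD => //; rewrite (le_trans (fa_L1 hS)).
by move=> x _; rewrite addrC subrK.
Qed.

(** The tail of the series has small cost. *)
Lemma ca_tail f K e : countably_atomic f K -> 0 < e -> exists g L,
  finite_atomic g L /\ countably_atomic (fun x => f x - g x) e.
Proof.
move=> [hf [F [k [hF hk hc]]]] e0.
have k0 i : 0 <= k i := fa_ge0 (hF i).
pose A := [set s | exists n, s = \sum_(i < n) k i].
have hA : has_sup A.
  split; first by exists 0, 0%N; rewrite big_ord0.
  by exists K => _ [n ->].
have [_ [N ->] hN] := sup_adherent e0 hA.
have tail n : \sum_(i < n) k (N + i)%N <= e.
  have h : \sum_(i < N + n) k i <= sup A by apply: ub_le_sup; [case: hA|exists (N + n)%N].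
  rewrite big_split_ord/= in h; lra.
exists (fun x => \sum_(i < N) F i x), (\sum_(i < N) k i); split; first exact: fa_sum.
split; first exact: integrable01_sub_fa.
exists (fun i => F (N + i)%N), (fun i => k (N + i)%N); split => // d /hc[M hM].
exists M => n Mn; rewrite (eq_int01 (g := fun x => `|f x - \sum_(i < N + n) F i x|)).
  by apply: hM; rewrite (leq_trans Mn)// leq_addl.
by move=> x _; rewrite big_split_ord/= opprD addrA.
Qed.

End conversions.

(** * Comparison with atomic decompositions *)
Section decompositions.
Context {R : realType}.
Local Notation mu := (@lebesgue_measure R).
Local Notation mR := (measurableTypeR R).
Implicit Types (f g h a : R -> R) (c : nat -> R).

Lemma ae_mono (P Q : R -> Prop) : (forall x, P x -> Q x) ->
  {ae mu, forall x, P x} -> {ae mu, forall x, Q x}.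
Proof. by move=> PQ; apply: filterS; first exact: (ae_filter_ringOfSetsType mu). Qed.

Lemma ae_and (P Q : R -> Prop) : {ae mu, forall x, P x} ->
  {ae mu, forall x, Q x} -> {ae mu, forall x, P x /\ Q x}.
Proof.
move=> hP hQ; apply: (@filterI _ _ _ P Q hP hQ).
exact: (ae_filter_ringOfSetsType mu).
Qed.

Lemma ae_integral (F G : R -> \bar R) :
  @measurable_fun _ _ mR (\bar R) D01 F -> @measurable_fun _ _ mR (\bar R) D01 G ->
  {ae mu, forall x, D01 x -> F x = G x} ->
  (\int[mu]_(x in D01) F x = \int[mu]_(x in D01) G x)%E.
Proof. by move=> mF mG FG; apply: ae_eq_integral mF mG FG; exact: measurable_D01. Qed.

Lemma ae_integrable01 f g : @measurable_fun _ _ mR R D01 f -> integrable01 g ->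
  {ae mu, forall x, D01 x -> f x = g x} ->
  [/\ integrable01 f, int01 f = int01 g & int01 (fun x => `|f x - g x|) = 0].
Proof.
move=> mf hg fg; have mg := integrable01_measurable hg.
have hf : integrable01 f.
  apply/integrableP; split; first exact/measurable_EFinP.
  have /integrableP[_] := hg; apply: le_lt_trans.
  rewrite le_eqVlt; apply/orP; left; apply/eqP.
  apply: ae_integral.
  - by apply: measurableT_comp => //; exact/measurable_EFinP.
  - by apply: measurableT_comp => //; exact/measurable_EFinP.
  - by apply: ae_mono fg => x h xD /=; rewrite h.
split => //.
  rewrite /int01 /Rintegral; congr (fine _); apply: ae_integral.
  - exact/measurable_EFinP.
  - exact/measurable_EFinP.
  - by apply: ae_mono fg => x h xD /=; rewrite h.
rewrite -[RHS](int01_cst 0) /int01 /Rintegral; congr (fine _); apply: ae_integral.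
- by apply/measurable_EFinP; apply: measurableT_comp => //; exact: measurable_funB.
- exact: measurable_cst.
- by apply: ae_mono fg => x h xD /=; rewrite h// subrr normr0.
Qed.

Lemma muT_gt0 : (0 < mu [set: R])%E.
Proof.
apply: (@lt_le_trans _ _ (mu (D01 : set R))).
  by rewrite [X in (_ < X)%E]mu_D01 lte_fin.
by apply: le_measure; rewrite ?inE//; exact: measurable_D01.
Qed.

Lemma Lnoo_le f M : ('N[mu]_+oo[EFin \o f] <= M%:E)%E <-> {ae mu, forall x, `|f x| <= M}.
Proof.
rewrite unlock /Lnorm muT_gt0; split.
  move=> /ess_supP h; apply: ae_mono h => x /=; by rewrite lee_fin.
by move=> h; apply/ess_supP; apply: ae_mono h => x /=; rewrite lee_fin.
Qed.

(** Truncate a where it exceeds its essential bound, and remove the right end point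
    of its support. *)
Lemma strict_atom a : atom a -> exists a', [/\ bounded_atom a', integrable01 a &
  int01 (fun x => `|a x - a' x|) = 0].
Proof.
move=> [u [v [[u0 uv v1] [ma a0 /Lnoo_le aM aI]]]].
set M := (v - u)^-1 in aM; have M0 : 0 < M by rewrite invr_gt0 subr_gt0.
have ma' : @measurable_fun _ _ mR R D01 a by apply: measurable_funTS.
pose h x := if `|a x| <= M then a x else 0.
have hh : bddmeas h.
  split; last by exists M => x _; rewrite /h; case: ifPn => // _; rewrite normr0 ltW.
  apply: measurable_fun_if; [exact: measurable_D01| | |exact: measurable_cst].
    by apply: measurable_fun_ler => //; exact: measurableT_comp.
  by apply: measurable_funS ma' => [|x []//]; exact: measurable_D01.
pose a' x := h x * chi u v x.
have ba' : bddmeas a' by apply: bddmeasM => //; exact: bddmeas_chi.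
have hae : {ae mu, forall x, D01 x -> a x = a' x}.
  have hv : {ae mu, forall x, x <> v}.
    exists [set v]; split => //; first exact: lebesgue_measure_set1.
    by move=> x /=; rewrite not_notP.
  apply: ae_mono (ae_and aM hv) => x [ax xv] _; rewrite /a' /h ax.
  case: (boolP (u <= x < v)) => hx; first by rewrite chi1// mulr1.
  rewrite chi0// mulr0 a0//; apply: contra hx; rewrite in_itv/= => /andP[-> /=].
  by rewrite le_eqVlt => /predU1P[/xv|].
have [ia Iaa Id] := ae_integrable01 ma' (bddmeas_integrable01 ba') hae.
exists a'; split => //; exists u, v; split => //; split => //.
- by move=> x hx; rewrite /a' chi0// mulr0.
- move=> x; rewrite /a' normrM (ger0_norm (chi_ge0 _ _ _)).
  apply: (@le_trans _ _ `|h x|); first by rewrite ler_piMr// chi_le1.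
  by rewrite /h; case: ifPn => // _; rewrite normr0 ltW.
- by rewrite -Iaa; have := integral_unit_int01 ia; rewrite aI => -[<-].
Qed.

Lemma atom_or_one_strict a : atom_or_one a -> exists a',
  [/\ atom_or_cst1 a', integrable01 a & int01 (fun x => `|a x - a' x|) = 0].
Proof.
case=> [a1|/strict_atom[a' [h1 h2 h3]]]; last by exists a'; split => //; right.
exists (fun=> 1); split; first by left.
- by apply: eq_integrable01 (integrable01_cst 1) => x /unit_D01 /a1.
- by rewrite (eq_int01 (g := fun=> 0)) ?int01_cst// => x /unit_D01 /a1 ->;
    rewrite subrr normr0.
Qed.

Lemma Lp01_norm_ge0 p f : (0 <= Lp01_norm p f)%E.
Proof. exact: Lnorm_ge0. Qed.

Lemma decomposition_ca f c (a : nat -> R -> R) K : integrable01 f ->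
    atomic_decomposition f c a ->
  (\sum_(0 <= i <oo) `|c i|%:E <= K%:E)%E -> countably_atomic f K.
Proof.
move=> hf [ha _ hc] hK; split => //.
have /choice[a' ha'] := fun i => atom_or_one_strict (ha i).
exists (fun i x => c i * a' i x), (fun i => `|c i|); split.
- move=> i; have [h _ _] := ha' i.
  by apply: (FinAtom_ext (FinAtomS (c i) h FinAtom0)) => [|x _]; rewrite addr0.
- move=> n; rewrite -lee_fin; apply: le_trans hK; rewrite -sumEFin.
  have := @nneseries_lim_ge R (fun i => `|c i|%:E) predT 0 n.
  by rewrite big_mkord; apply => i _ _; rewrite lee_fin.
- move=> e e0; have /(_ e e0)[N hN] := (cvg0_ereal (fun n => Lp01_norm_ge0 1%E _)).1 hc.
  exists N => n /hN.
  have ia i : integrable01 (a i) by have [] := ha' i.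
  have ia' i : integrable01 (a' i) by have [/atom_or_cst1_bddmeas/bddmeas_integrable01]
      := ha' i.
  have isum (b : nat -> R -> R) : (forall i, integrable01 (b i)) ->
      integrable01 (fun x => \sum_(i < n) c i * b i x).
    by move=> hb; apply: integrable01_sum => i _; exact: integrable01Z.
  rewrite Lp01_norm1; last by apply: integrable01B => //; exact: isum.
  rewrite lee_fin => h.
  rewrite (eq_int01 (g := fun x => `|(f x - \sum_(i < n) c i * a i x) +
     \sum_(i < n) c i * (a i x - a' i x)|)); last first.
    move=> x _; congr `|_|.
    have -> : \sum_(i < n) c i * (a i x - a' i x) =
      \sum_(i < n) c i * a i x - \sum_(i < n) c i * a' i x.
      by rewrite -sumrB; apply: eq_bigr => i _; rewrite mulrBr.
    by rewrite addrA subrK.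
  have id i : integrable01 (fun x => a i x - a' i x) by exact: integrable01B.
  apply: (le_trans (L1_triangle _ _)).
  + by apply: integrable01B => //; exact: isum.
  + by apply: integrable01_sum => i _; exact: integrable01Z.
  + rewrite -[leRHS]addr0 lerD//.
    apply: (@le_trans _ _ (int01 (fun x => \sum_(i < n) `|c i| * `|a i x - a' i x|))).
      apply: le_int01 => [||x _].
      - by apply: integrable01_abs; apply: integrable01_sum => i _; exact: integrable01Z.
      - by apply: integrable01_sum => i _; apply: integrable01Z; exact: integrable01_abs.
      - by apply: (le_trans (ler_norm_sum _ _ _)); apply: ler_sum => i _; rewrite normrM.
    rewrite int01_sum; last by move=> i _; apply: integrable01Z; exact: integrable01_abs.
    rewrite big1// => i _; rewrite int01Z; last exact: integrable01_abs.
    by have [_ _ ->] := ha' i; rewrite mulr0.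
Qed.

Lemma atom_of_bounded a : bounded_atom a -> atom a.
Proof.
move=> [u [v [[u0 uv v1] [ba a0 aM Ia]]]]; exists u, v; split => //; split.
- have E : a = a \_ D01.
    apply/funext => x; rewrite /patch; case: ifPn => // h; apply: a0.
    apply: contra h => /andP[ux xv]; rewrite inE; apply/D01P; split.
      exact: le_trans ux.
    exact: lt_le_trans v1.
  rewrite E; apply/(measurable_restrictT _ measurable_D01); case: ba => mf _.
  exact: mf.
- move=> x xuv; apply: a0; apply: contra xuv; rewrite in_itv/= => /andP[-> /ltW //].
- by apply/Lnoo_le; apply: aeW => x.
- by rewrite integral_unit_int01 ?Ia//; exact: bddmeas_integrable01.
Qed.

Lemma atom_or_one_of a : atom_or_cst1 a -> atom_or_one a.
Proof. by case=> [->|/atom_of_bounded]; [left|right]. Qed.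

(** Put in front of every list to make it nonempty, so that the concatenation of
    the first m lists has length at least m. *)
Definition null_term : R * (R -> R) := (0, fun=> 1).

Definition atoms_list (L : seq (R * (R -> R))) := forall p, p \in L -> atom_or_cst1 p.2.

Lemma fa_of_list (L : seq (R * (R -> R))) : atoms_list L ->
  finite_atomic (fun x => \sum_(p <- L) p.1 * p.2 x) (\sum_(p <- L) `|p.1|).
Proof.
elim: L => [_|p L ih hL].
  by apply: (FinAtom_ext FinAtom0) => [|x _]; rewrite big_nil.
have hp : atom_or_cst1 p.2 by apply: hL; rewrite inE eqxx.
have hL' : atoms_list L by move=> r rL; apply: hL; rewrite inE rL orbT.
by apply: (FinAtom_ext (FinAtomS p.1 hp (ih hL'))) => [|x _]; rewrite big_cons.
Qed.

(** Within e of the supremum of the partial sums, no later term exceeds e. *)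
Lemma sum_small (k : nat -> R) K e : (forall i, 0 <= k i) ->
  (forall n, \sum_(i < n) k i <= K) -> 0 < e ->
  exists N, forall n, (N <= n)%N -> k n <= e.
Proof.
move=> k0 hk e0; pose A := [set s | exists n, s = \sum_(i < n) k i].
have hA : has_sup A.
  split; first by exists 0, 0%N; rewrite big_ord0.
  by exists K => _ [n ->].
have [_ [N ->] hN] := sup_adherent e0 hA.
exists N => n Nn.
have h : \sum_(i < n.+1) k i <= sup A by apply: ub_le_sup; [case: hA|exists n.+1].
have : \sum_(i < N) k i <= \sum_(i < n) k i.
  rewrite -(subnKC Nn) big_split_ord/= lerDl sumr_ge0//.
by move: h; rewrite big_ord_recr/=; lra.
Qed.

Section concat.
Variable L : nat -> seq (R * (R -> R)).
Hypothesis hL : forall i, atoms_list (L i).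

Fixpoint concat_terms m := if m is m.+1 then concat_terms m ++ (null_term :: L m) else [::].
Definition concat_term n := nth null_term (concat_terms n.+1) n.

Lemma size_concat_terms m : (m <= size (concat_terms m))%N.
Proof. by elim: m => //= m ih; rewrite size_cat/= addnS ltnS (leq_trans ih)// leq_addr. Qed.

Lemma nth_concat_terms m d n : (n < size (concat_terms m))%N ->
    nth null_term (concat_terms (m + d)) n = nth null_term (concat_terms m) n.
Proof.
move=> nm; elim: d => [|d ih]; first by rewrite addn0.
rewrite addnS/= nth_cat -ih.
have hs : (size (concat_terms m) <= size (concat_terms (m + d)))%N.
  by elim: (d) => [|j jh]; rewrite ?addn0// addnS/= size_cat (leq_trans jh)// leq_addr.
by rewrite (leq_trans nm hs).
Qed.

Lemma concat_termE m n : (n < size (concat_terms m))%N ->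
    concat_term n = nth null_term (concat_terms m) n.
Proof.
move=> nm; rewrite /concat_term; have [h|h] := leqP n.+1 m.
  by rewrite -(subnKC h) nth_concat_terms// size_concat_terms.
by rewrite -(subnKC (ltnW h)) nth_concat_terms.
Qed.

Lemma sum_concat_term (V : zmodType) (h : R * (R -> R) -> V) m n : (n <=
    size (concat_terms m))%N ->
  \sum_(i < n) h (concat_term i) = \sum_(p <- take n (concat_terms m)) h p.
Proof.
move=> nm; have -> : take n (concat_terms m) = mkseq concat_term n.
  apply: (@eq_from_nth _ null_term); first by rewrite size_takel// size_mkseq.
  move=> i; rewrite size_takel// => ni; rewrite nth_take// nth_mkseq//.
  by rewrite (@concat_termE m)// (leq_trans ni).
by rewrite big_map -(big_mkord xpredT (fun i => h (concat_term i))) /index_iota subn0.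
Qed.

Lemma atoms_concat_terms m : atoms_list (concat_terms m).
Proof.
elim: m => [p//|m ih p]; rewrite mem_cat inE => /orP[/ih//|/predU1P[->|]]; first by left.
exact: hL.
Qed.

Lemma concat_term_atom n : atom_or_cst1 (concat_term n).2.
Proof. by apply: (@atoms_concat_terms n.+1); rewrite mem_nth// size_concat_terms. Qed.

Lemma sum_concat_terms (V : zmodType) (h : R * (R -> R) -> V) m : h null_term = 0 ->
  \sum_(p <- concat_terms m) h p = \sum_(i < m) \sum_(p <- L i) h p.
Proof.
move=> h0; elim: m => [|m ih]; first by rewrite big_nil big_ord0.
by rewrite big_cat/= ih big_cons h0 add0r big_ord_recr.
Qed.

Lemma concat_terms_between N n : (size (concat_terms N) <= n)%N -> exists m, [/\ (N <= m)%N,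
  (size (concat_terms m) <= n)%N & (n <= size (concat_terms m.+1))%N].
Proof.
move=> hN; have ex : exists m, (n <= size (concat_terms m.+1))%N.
  by exists n; rewrite (leq_trans _ (size_concat_terms _)).
case: (ex_minnP ex) => m hm min_m; have [Nm|mN] := leqP N m.
  exists m; split => //; case: m hm min_m Nm => [//|m] hm min_m _.
  by rewrite leqNgt; apply/negP => /ltnW /min_m; rewrite ltnn.
exists N; split => //.
apply: (leq_trans hm).
have := mN; rewrite -(subnKC mN) => _.
elim: (N - m.+1)%N => [|j jh]; rewrite ?addn0.
  by rewrite /= !size_cat leq_addr.
by rewrite (leq_trans jh)// addnS [leqRHS]/= size_cat leq_addr.
Qed.

End concat.

(** A partial sum of the concatenated series is a partial sum of the groups plus an
    initial segment of one further group, whose L^1 norm is at most the cost of that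
    group and therefore tends to 0. *)
Lemma ca_decomposition f K : countably_atomic f K -> exists (c : nat -> R) (a : nat ->
    R -> R), atomic_decomposition f c a /\
  (\sum_(0 <= i <oo) `|c i|%:E <= K%:E)%E.
Proof.
move=> [hf [F [k [hF hk hc]]]].
have /choice[L hL] : forall i, exists L, [/\ atoms_list L, \sum_(p <- L) `|p.1| <= k i &
    forall x, D01 x -> F i x = \sum_(p <- L) p.1 * p.2 x].
  move=> i; have [L [h1 h2 h3]] := fa_list (hF i); exists L; split => // p pL.
  by rewrite -(nth_index null_term pL); apply: h1; rewrite index_mem.
have aL i : atoms_list (L i) by have [] := hL i.
have k0 i : 0 <= k i := fa_ge0 (hF i).
pose c i := (concat_term L i).1; pose a i := (concat_term L i).2.
have hsum n : \sum_(i < n) `|c i| <= K.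
  have := @sum_concat_term L _ (fun p => `|p.1|) n n (size_concat_terms _ _) => /= ->.
  apply: (@le_trans _ _ (\sum_(p <- concat_terms L n) `|p.1|)).
    by rewrite -{2}(cat_take_drop n (concat_terms L n)) big_cat/= lerDl sumr_ge0.
  rewrite sum_concat_terms ?normr0//; apply: le_trans (hk n).
  by apply: ler_sum => i _; have [] := hL i.
have hser : (\sum_(0 <= i <oo) `|c i|%:E <= K%:E)%E.
  apply: lime_le.
    by apply: is_cvg_nneseries => n _ _; rewrite lee_fin.
  by apply: nearW => n; rewrite sumEFin lee_fin big_mkord.
exists c, a; split => //; split.
- by move=> i; apply: atom_or_one_of; exact: concat_term_atom.
- by apply: (le_lt_trans hser); exact: ltry.
apply/(cvg0_ereal (fun n => Lp01_norm_ge0 1%E _)) => e e0.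
have e2 : 0 < e / 2 by rewrite divr_gt0.
have [N1 hN1] := hc _ e2; have [N2 hN2] := sum_small k0 hk e2.
exists (size (concat_terms L (maxn N1 N2))) => n /concat_terms_between[m [Nm mn nm]].
have [h1 h2] : (N1 <= m)%N /\ (N2 <= m)%N by move: Nm; rewrite geq_max => /andP.
set j := (n - size (concat_terms L m))%N.
have tE : take n (concat_terms L m.+1) = concat_terms L m ++ take j (null_term :: L m).
  by rewrite /= take_cat ltnNge mn.
have aT : atoms_list (take j (null_term :: L m)).
  by move=> p /mem_take; rewrite inE => /predU1P[->|]; [left|exact: aL].
have fT := fa_of_list aT.
have E x : D01 x -> f x - \sum_(i < n) c i * a i x = (f x - \sum_(i < m) F i x) +
    -1 * \sum_(p <- take j (null_term :: L m)) p.1 * p.2 x.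
  move=> xD; have := @sum_concat_term L _ (fun p => p.1 * p.2 x) m.+1 n nm => /= ->.
  have := tE => /= ->; rewrite big_cat/= sum_concat_terms ?mul0r//.
  have -> : \sum_(i < m) \sum_(p <- L i) p.1 * p.2 x = \sum_(i < m) F i x.
    by apply: eq_bigr => i _; have [_ _ ->] := hL i.
  by ring.
have iT := fa_integrable01 (faZ (-1) fT).
have iF := integrable01_sub_fa m hf hF.
rewrite Lp01_norm1; last by apply: eq_integrable01 (integrable01D iF iT) => x /E ->.
rewrite lee_fin (eq_int01 (g := fun x => `|(f x - \sum_(i < m) F i x) +
    -1 * \sum_(p <- take j (null_term :: L m)) p.1 * p.2 x|)); last by move=> x /E ->.
apply: (le_trans (L1_triangle iF iT)); rewrite [leRHS]splitr lerD ?hN1//.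
apply: (le_trans (fa_L1 (faZ (-1) fT))); rewrite normrN1 mul1r.
apply: (le_trans _ (hN2 m h2)).
apply: (@le_trans _ _ (\sum_(p <- null_term :: L m) `|p.1|)).
  by rewrite -{2}(cat_take_drop j (null_term :: L m)) big_cat/= lerDl sumr_ge0.
by rewrite big_cons/= normr0 add0r; have [] := hL m.
Qed.

Lemma ca_H1_norm f K : countably_atomic f K -> (H1_norm f <= K%:E)%E.
Proof.
move=> /ca_decomposition[c [a [hd hK]]]; apply: le_trans hK.
by apply: ereal_inf_lbound; exists c, a.
Qed.

Lemma H1_norm_ge0 f : (0 <= H1_norm f)%E.
Proof.
apply: le_ereal_inf_tmp => _ [c [a [_ ->]]].
by apply: nneseries_ge0 => n _ _; rewrite lee_fin.
Qed.

Lemma H1_norm_lt_ca f e : integrable01 f -> (H1_norm f < e%:E)%E -> countably_atomic f e.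
Proof.
move=> hf /ereal_inf_lt[_ [c [a [hd ->]]] /ltW h].
exact: decomposition_ca hd h.
Qed.

Lemma H1_ca f : H1 f -> exists K, countably_atomic f K.
Proof.
move=> [/Lp01_1_integrable01 hf [c [a hd]]]; have [_ hc _] := hd.
exists (fine (\sum_(0 <= i <oo) `|c i|%:E)%E); apply: (decomposition_ca hf hd).
by rewrite fineK// ge0_fin_numE// nneseries_ge0.
Qed.

End decompositions.

(** * Wavelet bounds in terms of dyadic weights *)
Section from_bounds.
Context {R : realType}.
Local Notation w := (Num.sqrt (2 : R)).
Variables (delta c alpha : R).
Hypotheses (d0 : 0 < delta) (c0 : 0 < c) (a0 : 0 < alpha).

(** Both bounds are weakened to a common exponent: q = 2^(-2 decay_exp) is at least
    2^-delta, and rho = 2^(- decay_exp) is at least 2^-alpha. *)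
Definition decay_exp : R := Num.min alpha (delta / 2).
Definition decay_rate : R := 2 `^ (- decay_exp).
Local Notation rho := decay_rate.
Local Notation q := (rho ^+ 2).
Definition decay_cst : R := 2 * c / q.

Lemma decay_exp_gt0 : 0 < decay_exp.
Proof. by rewrite lt_min a0 divr_gt0. Qed.

Lemma decay_rate_gt0 : 0 < rho. Proof. by rewrite powR_gt0. Qed.

Lemma decay_rate_lt1 : rho < 1.
Proof.
rewrite /decay_rate powRN invf_lt1 ?powR_gt0//.
have := @gt0_ltr_powR R decay_exp decay_exp_gt0 1 2; rewrite !nnegrE powR1.
by apply => //; rewrite ltr1n.
Qed.

Let q0 : 0 < q. Proof. by rewrite exprn_gt0// decay_rate_gt0. Qed.
Let q1 : q < 1. Proof. by rewrite exprn_ilt1 ?decay_rate_lt1// ltW// decay_rate_gt0. Qed.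

Lemma decay_cst_gt0 : 0 < decay_cst. Proof. by rewrite divr_gt0// mulr_gt0. Qed.

Lemma half_q : q / 2 = 2 `^ (- 1 - 2 * decay_exp).
Proof.
rewrite powRD ?pnatr_eq0 ?implybT// powR_inv1// mulrC; congr (_ * _).
by rewrite /decay_rate -powR_mulrn ?powR_ge0// -powRrM mulrC mulrN.
Qed.

Lemma xi_pow (j : nat) (z : R) : 2 ^+ j <= `|z| -> xi delta z <= (q / 2) ^+ j.
Proof.
move=> hz; rewrite /xi.
have p1 : 1 <= (2 : R) ^+ j by rewrite exprn_ege1// ler1n.
have p0 : 0 < (2 : R) ^+ j by rewrite exprn_gt0.
have e1 : - 1 - delta = - (1 + delta) by ring.
apply: (@le_trans _ _ ((2 ^+ j) `^ (- 1 - delta))).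
  have z1 : 0 < 1 + `|z| by rewrite ltr_pwDl.
  rewrite e1 !powRN lef_pV2 ?posrE ?powR_gt0//.
  apply: ge0_ler_powR; rewrite ?nnegrE; [by rewrite addr_ge0// ltW|exact: ltW|by
      rewrite addr_ge0|].
  by rewrite (le_trans hz)// lerDr.
apply: (@le_trans _ _ ((2 ^+ j) `^ (- 1 - 2 * decay_exp))).
  apply: ler_powR => //; rewrite lerD2l lerN2.
  have : decay_exp <= delta / 2 by rewrite /decay_exp ge_min lexx orbT.
  lra.
by rewrite half_q -[in leLHS]powR_mulrn// -powRrM (mulrC j%:R) powRrM powR_mulrn ?powR_ge0.
Qed.

Lemma xi_le1 (z : R) : xi delta z <= 1.
Proof.
rewrite /xi -[leRHS](powRr0 (1 + `|z|)); apply: ler_powR; first by rewrite lerDl.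
by rewrite -opprD oppr_le0 addr_ge0// ltW.
Qed.

(** Look at the smallest box around t containing x: its coefficient bounds the
    weight from below, and x lies outside the previous box. *)
Lemma xi_weight n x t : D01 x -> D01 t ->
  xi delta (2 ^+ n * (x - t)) <= 2 / q * weight q n x t.
Proof.
move=> xD tD.
have ex : exists i, (box_lo t n i <= x) && (x < box_hi t n i) by exists n; exact: boxN.
case: (ex_minnP ex) => i hi min_i.
have i_n : (i <= n)%N by apply: min_i; exact: boxN.
have hW : (q / 2) ^+ i <= weight q n x t.
  have i_n' : (i < n.+1)%N by [].
  rewrite /weight (bigD1 (Ordinal i_n'))//= /box chi1// mulr1 lerDl.
  apply: sumr_ge0 => j _; nonneg.
have q20 : 0 < 2 / q by rewrite divr_gt0.
apply: le_trans (ler_wpM2l (ltW q20) hW).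
case: i hi min_i {i_n hW} => [|j] hi min_i.
  rewrite expr0 mulr1 (le_trans (xi_le1 _))// ler_pdivlMr// mul1r.
  by rewrite (le_trans (ltW q1))// ler1n.
have -> : 2 / q * (q / 2) ^+ j.+1 = (q / 2) ^+ j.
  have E : 2 / q * (q / 2) = 1 by field; rewrite lt0r_neq0// decay_rate_gt0.
  by rewrite [(q / 2) ^+ _]exprS mulrA E mul1r.
apply: xi_pow; have nj : ~~ (box_lo t n j <= x < box_hi t n j).
  by apply/negP => /min_i; rewrite ltnn.
have := notin_box xD nj; rewrite /box_radius normrM gtr0_norm ?exprn_gt0//.
by rewrite ler_pdivrMr ?exprn_gt0// mulrC.
Qed.

Lemma pow_half n : 2 `^ (n%:R / 2) = w ^+ n :> R.
Proof. by rewrite mulrC powRrM powR12_sqrt// powR_mulrn// sqrtr_ge0. Qed.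

Section one_function.
Variables (f : R -> R) (n : nat) (t : R).
Hypothesis tD : D01 t.
Hypothesis fS : forall x, unit_itv x -> `|f x| <=
    c * 2 `^ (n%:R / 2) * xi delta (2 ^+ n * (x - t)).
Hypothesis fH : forall s s', unit_itv s -> unit_itv s' -> `|s - s'| <= 2 ^- n ->
  `|f s - f s'| <= c * 2 `^ (n%:R / 2) * (2 ^+ n * `|s - s'|) `^ alpha
     * xi delta (2 ^+ n * (s - t)).

Lemma weight_size x : D01 x -> `|f x| <= decay_cst * w ^+ n * weight q n x t.
Proof.
move=> xD; apply: (le_trans (fS (unit_D01 xD))); rewrite pow_half.
have h : 0 <= c * w ^+ n by rewrite mulr_ge0 ?exprn_ge0 ?sqrtr_ge0// ltW.
apply: (le_trans (ler_wpM2l h (xi_weight n xD tD))).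
by rewrite /decay_cst le_eqVlt; apply/orP; left; apply/eqP; ring.
Qed.

Lemma weight_hoelder d s s' : D01 s -> D01 s' -> `|s - s'| <= 1 / 2 ^+ (n + d) ->
  `|f s - f s'| <= decay_cst * w ^+ n * rho ^+ d * weight q n s t.
Proof.
move=> sD s'D ss'.
have hs : `|s - s'| <= 2 ^- n.
  apply: (le_trans ss'); rewrite mul1r lef_pV2 ?posrE ?exprn_gt0//.
  by rewrite ler_weXn2l ?ler1n// leq_addr.
apply: (le_trans (fH (unit_D01 sD) (unit_D01 s'D) hs)); rewrite pow_half.
have hr : (2 ^+ n * `|s - s'|) `^ alpha <= rho ^+ d.
  apply: (@le_trans _ _ ((2 ^- d) `^ alpha)).
    apply: ge0_ler_powR; rewrite ?nnegrE; [exact: ltW|by rewrite mulr_ge0// exprn_ge0| |].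
      by rewrite invr_ge0 exprn_ge0.
    have -> : 2 ^- d = 2 ^+ n * (1 / 2 ^+ (n + d)) :> R.
      by rewrite exprD; field; rewrite !expf_neq0.
    by rewrite ler_wpM2l// exprn_ge0.
  have -> : rho ^+ d = (2 ^- d) `^ decay_exp.
    rewrite /decay_rate -(powR_mulrn d (powR_ge0 _ _)) -powRrM mulNr.
    by rewrite powRN mulrC powRrM powR_mulrn// -powRN -powR_inv1 ?powR_ge0 ?exprn_ge0//
      -powRrM mulN1r.
  rewrite -powR_inv1 ?exprn_ge0// -!powRrM !mulN1r; apply: ler_powR.
    by rewrite exprn_ege1// ler1n.
  by rewrite lerN2 /decay_exp ge_min lexx.
have h : 0 <= c * w ^+ n by rewrite mulr_ge0 ?exprn_ge0 ?sqrtr_ge0// ltW.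
have h2 : 0 <= (2 ^+ n * `|s - s'|) `^ alpha by exact: powR_ge0.
have h3 : 0 <= xi delta (2 ^+ n * (s - t)) by exact: powR_ge0.
rewrite -!mulrA mulrA.
apply: (le_trans (ler_wpM2l h (ler_pM h2 h3 hr (xi_weight n sD tD)))).
by rewrite /decay_cst le_eqVlt; apply/orP; left; apply/eqP; ring.
Qed.

Lemma bounds_ucont : ucont f.
Proof.
have C0 := decay_cst_gt0; have w0 : 0 < w by rewrite sqrtr_gt0.
have wn : 0 < w ^+ n by rewrite exprn_gt0.
have K0 : 0 < decay_cst * w ^+ n * 2 by rewrite mulr_gt0// mulr_gt0.
split.
  exists (decay_cst * w ^+ n * 2) => x xD; apply: (le_trans (weight_size xD)).
  by rewrite ler_wpM2l ?weight_le2// mulr_ge0 ?exprn_ge0// ltW.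
move=> e e0; have ek : 0 < e / (decay_cst * w ^+ n * 2) by rewrite divr_gt0.
have [d hd] : exists d, rho ^+ d <= e / (decay_cst * w ^+ n * 2).
  have r1 : `|rho| < 1 by rewrite gtr0_norm ?decay_rate_gt0 ?decay_rate_lt1.
  have /cvgrPdist_le/(_ _ ek)[N _ hN] := cvg_expr r1.
  exists N; have := hN N (leqnn _); rewrite /= sub0r normrN => h.
  exact: le_trans (ler_norm _) h.
exists (1 / 2 ^+ (n + d)); first by rewrite divr_gt0 ?exprn_gt0.
move=> s s' sD s'D ss'; apply: (le_trans (weight_hoelder sD s'D ss')).
have h : 0 <= decay_cst * w ^+ n * rho ^+ d.
  have r0 := decay_rate_gt0; have rd : 0 < rho ^+ d by rewrite exprn_gt0.
  by rewrite ltW// mulr_gt0// mulr_gt0.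
apply: (le_trans (ler_wpM2l h (weight_le2 q0 q1 n s t))).
move: hd; rewrite ler_pdivlMr// => hd; apply: le_trans hd.
by rewrite le_eqVlt; apply/orP; left; apply/eqP; ring.
Qed.

Lemma bounds_molecule : int01 f = 0 -> molecule rho decay_cst f n t.
Proof.
move=> If; split => //; [exact: bounds_ucont|exact: weight_size|].
by move=> d s s'; exact: weight_hoelder.
Qed.
End one_function.

Lemma wavelet_bounds_each n t f g : wavelet_bounds c delta alpha n t f g ->
  [/\ forall x, unit_itv x -> `|f x| <= c * 2 `^ (n%:R / 2) * xi delta (2 ^+ n * (x - t)),
    forall s s', unit_itv s -> unit_itv s' -> `|s - s'| <= 2 ^- n ->
  `|f s - f s'| <= c * 2 `^ (n%:R / 2) * (2 ^+ n * `|s - s'|) `^ alpha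
     * xi delta (2 ^+ n * (s - t)),
   forall x, unit_itv x -> `|g x| <= c * 2 `^ (n%:R / 2) * xi delta (2 ^+ n * (x - t)) &
    forall s s', unit_itv s -> unit_itv s' -> `|s - s'| <= 2 ^- n ->
  `|g s - g s'| <= c * 2 `^ (n%:R / 2) * (2 ^+ n * `|s - s'|) `^ alpha
     * xi delta (2 ^+ n * (s - t))].
Proof.
move=> [hS hH]; split.
- by move=> x /hS; apply: le_trans; rewrite lerDl.
- by move=> s s' su s'u ss'; apply: le_trans (hH s s' su s'u ss'); rewrite lerDl.
- by move=> x /hS; apply: le_trans; rewrite lerDr.
- by move=> s s' su s'u ss'; apply: le_trans (hH s s' su s'u ss'); rewrite lerDr.
Qed.

End from_bounds.

(** * Convergence of the expansions in H^1 *)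
Section expansions.
Context {R : realType}.
Variables phi psi : nat -> R -> R.
Hypotheses (uphi : forall k, ucont (phi k)) (upsi : forall k, ucont (psi k)).
Hypothesis bi : forall k m, int01 (fun x => phi k x * psi m x) = (k == m)%:R.
Hypothesis phi0 : forall x, D01 x -> phi 0%N x = 1.
Variable B : R.
Hypothesis B1 : 1 <= B.

Definition proj (s : seq nat) (f : R -> R) x :=
  \sum_(k <- s) int01 (fun y => f y * psi k y) * phi k x.

Hypothesis atomB : forall a s, bounded_atom a -> uniq s -> finite_atomic (proj s a) B.
Hypothesis hbasis : schauder_basis (Lp01 2%:E) (Lp01_norm 2%:E) phi.

Implicit Types (s : seq nat) (f g h a : R -> R).

Let bphi k : bddmeas (phi k). Proof. exact: ucont_bddmeas. Qed.
Let bpsi k : bddmeas (psi k). Proof. exact: ucont_bddmeas. Qed.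
Let B0 : 0 <= B. Proof. exact: le_trans B1. Qed.

Lemma integrable01_psi f k : integrable01 f -> integrable01 (fun x => f x * psi k x).
Proof. by move=> hf; exact: integrable01M. Qed.

Lemma proj_bddmeas s f : bddmeas (proj s f).
Proof. by apply: bddmeas_sum => k _; exact: bddmeasZ. Qed.

Lemma projD s f g x : integrable01 f -> integrable01 g ->
  proj s (fun x => f x + g x) x = proj s f x + proj s g x.
Proof.
move=> hf hg; rewrite /proj -big_split/=; apply: eq_bigr => k _; rewrite -mulrDl.
rewrite -int01D; try exact: integrable01_psi.
by congr (_ * _); apply: eq_int01 => y _; rewrite mulrDl.
Qed.

Lemma projZ s (c : R) f x : integrable01 f -> proj s (fun x => c * f x) x = c * proj s f x.
Proof.
move=> hf; rewrite /proj mulr_sumr; apply: eq_bigr => k _; rewrite mulrA -int01Z.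
  by congr (_ * _); apply: eq_int01 => y _; rewrite mulrA.
exact: integrable01_psi.
Qed.

Lemma eq_proj s f g x : (forall y, D01 y -> f y = g y) -> proj s f x = proj s g x.
Proof.
move=> fg; apply: eq_bigr => k _; congr (_ * _).
by apply: eq_int01 => y /fg ->.
Qed.

Lemma projB s f g x : integrable01 f -> integrable01 g ->
  proj s (fun x => f x - g x) x = proj s f x - proj s g x.
Proof.
move=> hf hg; rewrite (@eq_proj _ _ (fun y => f y + -1 * g y)); last first.
  by move=> y _; rewrite mulN1r.
by rewrite projD ?projZ ?mulN1r//; exact: integrable01Z.
Qed.

Lemma proj_sum s n (F : nat -> R -> R) x : (forall i, integrable01 (F i)) ->
  proj s (fun x => \sum_(i < n) F i x) x = \sum_(i < n) proj s (F i) x.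
Proof.
move=> hF; elim: n => [|n ih].
  rewrite big_ord0 (@eq_proj _ _ (fun y => 0 * F 0%N y)) ?projZ ?mul0r//.
  by move=> y _; rewrite big_ord0 mul0r.
rewrite big_ord_recr/= -ih -projD//; last exact: integrable01_sum.
by apply: eq_proj => y _; rewrite big_ord_recr.
Qed.

Lemma proj_phi s m x : uniq s -> proj s (phi m) x = (m \in s)%:R * phi m x.
Proof.
move=> us; rewrite /proj; have [ms|ms] := boolP (m \in s).
  rewrite mul1r (bigD1_seq m)//= bi eqxx mul1r big1 ?addr0// => k km.
  by rewrite bi eq_sym (negPf km) mul0r.
rewrite mul0r big_seq big1// => k ks; rewrite bi (_ : (m == k) = false) ?mul0r//.
by apply/negP => /eqP mk; move: ms; rewrite mk ks.
Qed.

(** By biorthogonality, since the constant 1 is phi_0. *)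
Lemma proj_cst1 s : uniq s -> finite_atomic (proj s (fun=> 1)) B.
Proof.
move=> us; have E x : D01 x -> proj s (fun=> 1) x = (0%N \in s)%:R.
  move=> xD; rewrite (@eq_proj _ _ (phi 0%N)) ?proj_phi ?phi0 ?mulr1// => y yD.
  by rewrite phi0.
apply: (FinAtom_ext (fa_cst (0%N \in s)%:R)) => //.
by rewrite (le_trans _ B1)//; case: (_ \in _); rewrite ?normr1 ?normr0.
Qed.

Lemma proj_fa s f K : uniq s -> finite_atomic f K -> finite_atomic (proj s f) (B * K).
Proof.
move=> us; elim=> [|c a {}f {}K ha hf ih|{}f g {}K K' hf ih KK' fg].
- apply: (FinAtom_ext FinAtom0); first by rewrite mulr0.
  move=> x _; apply: big1 => k _; rewrite (eq_int01 (g := fun=> 0)) ?int01_cst ?mul0r//.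
  by move=> y _; rewrite mul0r.
- have pa : finite_atomic (proj s a) B.
    by case: ha => [->|/atomB]; [exact: proj_cst1|exact].
  have ia := bddmeas_integrable01 (atom_or_cst1_bddmeas ha); have jf := fa_integrable01 hf.
  apply: (FinAtom_ext (faD (faZ c pa) ih)).
    by rewrite mulrDr lerD2r mulrC.
  by move=> x _; rewrite projD ?projZ//; exact: integrable01Z.
- apply: (FinAtom_ext ih); first by rewrite ler_wpM2l.
  by move=> x _; exact: eq_proj.
Qed.

Lemma Ipsi_le m : exists M, 0 <= M /\ forall f, integrable01 f ->
  `|int01 (fun x => f x * psi m x)| <= M * int01 (fun x => `|f x|).
Proof.
have [_ [M hM]] := bpsi m.
have M0 : 0 <= M by apply: le_trans (hM 0 _); [exact: normr_ge0|apply/D01P].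
exists M; split => // f hf; apply: (le_trans (le_normr_int01 (integrable01_psi m hf))).
rewrite -int01Z; last exact: integrable01_abs.
apply: le_int01 => [||x xD]; [by apply: integrable01_abs;
    exact: integrable01_psi|by apply: integrable01Z; exact: integrable01_abs|].
by rewrite normrM mulrC ler_wpM2r// hM.
Qed.

Lemma proj_L1 s : exists M, 0 <= M /\ forall f, integrable01 f ->
  int01 (fun x => `|proj s f x|) <= M * int01 (fun x => `|f x|).
Proof.
elim: s => [|k s [M [M0 hM]]].
  exists 0; split => // f _; rewrite mul0r (eq_int01 (g := fun=> 0)) ?int01_cst// => x _.
  by rewrite /proj big_nil normr0.
have [N [N0 hN]] := Ipsi_le k.
have P0 : 0 <= int01 (fun x => `|phi k x|) by exact: int01_ge0.
exists (N * int01 (fun x => `|phi k x|) + M); split; first by rewrite addr_ge0// mulr_ge0.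
move=> f hf; rewrite (eq_int01 (g := fun x => `|int01 (fun y => f y * psi k y) * phi k
    x + proj s f x|)).
  have i1 : integrable01 (phi k) by exact: bddmeas_integrable01.
  apply: (le_trans (L1_triangle (integrable01Z _ i1) (bddmeas_integrable01
      (proj_bddmeas _ _)))).
  rewrite mulrDl lerD ?hM//.
  rewrite (eq_int01 (g := fun x => `|int01 (fun y => f y * psi k y)| * `|phi k x|)).
    rewrite int01Z; last exact: integrable01_abs.
    by rewrite mulrAC ler_wpM2r// hN.
  by move=> x _; rewrite normrM.
by move=> x _; rewrite /proj big_cons.
Qed.

(** For a fixed s the projection is bounded on L^1, which transports the
    convergence; the cost is bounded uniformly in s. *)
Lemma proj_ca s f K : uniq s -> countably_atomic f K -> countably_atomic (proj s f) (B * K).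
Proof.
move=> us [hf [F [k [hF hk hc]]]]; split; first by apply: bddmeas_integrable01;
    exact: proj_bddmeas.
exists (fun i => proj s (F i)), (fun i => B * k i); split.
- by move=> i; exact: proj_fa.
- by move=> n; rewrite -mulr_sumr ler_wpM2l.
- have [M [M0 hM]] := proj_L1 s.
  move=> e e0; have M1 : 0 < M + 1 by rewrite ltr_wpDl.
  have [N hN] := hc _ (divr_gt0 e0 M1); exists N => n /hN h.
  have iF i : integrable01 (F i) by exact: fa_integrable01 (hF i).
  rewrite (eq_int01 (g := fun x => `|proj s (fun x => f x - \sum_(i < n) F i x) x|)).
    apply: (le_trans (hM _ (integrable01_sub_fa n hf hF))).
    apply: (le_trans (ler_wpM2l M0 h)).
    by rewrite mulrCA ger_pMr// ler_pdivrMr// mul1r lerDl.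
  by move=> x _; rewrite projB ?proj_sum//; exact: integrable01_sum.
Qed.

(** Membership in the span of the phi_k, in the form in which it is used. *)
Definition reproduced g := bddmeas g /\ exists N, forall s, uniq s ->
    {subset iota 0 N <= s} ->
  forall x, D01 x -> proj s g x = g x.

Lemma reproduced_phi k : reproduced (phi k).
Proof.
split => //; exists k.+1 => s us hs x _; rewrite proj_phi//.
by rewrite hs ?mul1r// mem_iota add0n ltnS leqnn.
Qed.

Lemma reproducedD g h : reproduced g -> reproduced h -> reproduced (fun x => g x + h x).
Proof.
move=> [bg [N hN]] [bh [M hM]]; split; first exact: bddmeasD.
exists (maxn N M) => s us hs x xD; rewrite projD; try exact: bddmeas_integrable01.
have sub k m : (k <= maxn N M)%N -> m \in iota 0 k -> m \in s.
  move=> kNM; rewrite mem_iota add0n => /andP[_ mk]; apply: hs.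
  by rewrite mem_iota add0n/= (leq_trans mk).
rewrite (hN s us) ?(hM s us)// => m; apply: sub; [exact: leq_maxr|exact: leq_maxl].
Qed.

Lemma reproducedZ (c : R) g : reproduced g -> reproduced (fun x => c * g x).
Proof.
move=> [bg [N hN]]; split; first exact: bddmeasZ.
by exists N => s us hs x xD; rewrite projZ ?(hN s us hs x xD)//;
    exact: bddmeas_integrable01.
Qed.

Lemma eq_reproduced f g : (forall x, D01 x -> f x = g x) -> reproduced g -> reproduced f.
Proof.
move=> fg [bg [N hN]]; split; first exact: eq_bddmeas bg.
by exists N => s us hs x xD; rewrite fg// -(hN s us hs x xD); exact: eq_proj.
Qed.

Lemma reproduced0 : reproduced (fun=> 0).
Proof. by apply: eq_reproduced (reproducedZ 0 (reproduced_phi 0)) => x _;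
    rewrite mul0r. Qed.

Lemma reproduced_sum n (c : nat -> R) : reproduced (fun x => \sum_(k < n) c k * phi k x).
Proof.
elim: n => [|n ih]; first by apply: eq_reproduced reproduced0 => x _; rewrite big_ord0.
by apply: eq_reproduced (reproducedD ih (reproducedZ (c n) (reproduced_phi n))) => x _;
    rewrite big_ord_recr.
Qed.

(** [fa_L2] on all of [0, 1[, the mean being a multiple of the constant 1. *)
Lemma fa_ucont g (s : R) : ucont g -> 0 < s -> int01 (fun x => g x ^+ 2) <= s ^+ 2 ->
  finite_atomic g (14 * s).
Proof.
move=> ug s0 hs; have bg := ucont_bddmeas ug.
have E x : D01 x -> chi (0 : R) 1 x = 1 by move=> /D01P[x0 x1]; rewrite chi1// x0.
have I1 : int01 g = int01 (fun x => g x * chi 0 1 x) by apply: eq_int01 => x xD;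
    rewrite E ?mulr1.
have h : int01 (fun x => g x ^+ 2 * chi 0 1 x) <= s ^+ 2 * (1 - 0).
  rewrite subr0 mulr1; apply: le_trans hs.
  by rewrite le_eqVlt; apply/orP; left; apply/eqP; apply: eq_int01 => x xD;
      rewrite E ?mulr1.
have f1 := fa_L2 ug (lexx 0) ltr01 (lexx 1) s0 h.
have f2 := fa_cst (avg 0 1 g).
apply: (FinAtom_ext (faD f1 f2)); last by move=> x xD; rewrite E// mulr1 subrK.
have := avg_le (lexx 0) ltr01 (lexx 1) bg (ltW s0) h.
by rewrite subr0; lra.
Qed.

Lemma sqr_int_le f g (s : R) : bddmeas f -> bddmeas g -> int01 (fun x => f x ^+ 2) <=
    s ^+ 2 ->
  int01 (fun x => g x ^+ 2) <= s ^+ 2 -> int01 (fun x => (f x - g x) ^+ 2) <= (2 * s) ^+ 2.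
Proof.
move=> bf bg hf hg.
have i1 := bddmeas_integrable01 (bddmeas_sqr bf); have i2 :=
    bddmeas_integrable01 (bddmeas_sqr bg).
apply: (@le_trans _ _ (int01 (fun x => 2 * f x ^+ 2 + 2 * g x ^+ 2))).
  apply: le_int01 => [||x _]; [by apply: bddmeas_integrable01; apply: bddmeas_sqr;
      exact: bddmeasB|by apply: integrable01D; exact: integrable01Z|].
  by have := sqr_ge0 (f x + g x); nra.
rewrite int01D; try exact: integrable01Z.
rewrite !int01Z//; nra.
Qed.

(** With S_n the partial sums of the L^2 expansion of a, choose indices n_m such
    that a - S_(n_m) has L^2 norm at most eta / 2^m.  The differences of consecutive
    S_(n_m) are continuous, so they have H^1 cost at most 28 eta / 2^m, and they sum
    up to a - S_(n_0) in L^1. *)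
Lemma dense_atom a e : bounded_atom a -> 0 < e ->
    exists g, reproduced g /\ countably_atomic (fun x => a x - g x) e.
Proof.
move=> ha e0; have [u [v [[u0 uv v1] [ba a0 _ _]]]] := ha.
have La : Lp01 2%:E a.
  apply: Lp01_2_bounded => // x xD; apply: a0; apply/negP => /andP[ux xv]; apply: xD.
  by apply/D01P; split; [exact: le_trans ux|exact: lt_le_trans v1].
have [_ /(_ a La)[c [hc _]]] := hbasis.
pose S n x := \sum_(k < n) c k * phi k x.
have uS n : ucont (S n) by apply: ucont_sum => k _; exact: ucontZ.
have bS n : bddmeas (S n) by exact: ucont_bddmeas.
pose eta := e / 56; have eta0 : 0 < eta by rewrite divr_gt0.
pose et m : R := eta / 2 ^+ m.
have et0 m : 0 < et m by rewrite divr_gt0// exprn_gt0.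
have /choice[nn hnn] : forall m, exists n, int01 (fun x => (a x - S n x) ^+ 2) <= et m ^+ 2.
  move=> m; have /(_ _ (et0 m))[N hN] := (cvg0_ereal (fun n => Lp01_norm_ge0 2%:E _)).1 hc.
  by exists N; apply: Lp01_norm2_lt; [exact: bddmeasB|exact: hN].
exists (S (nn 0%N)); split; first exact: reproduced_sum.
have iaS n : integrable01 (fun x => a x - S n x) by apply: bddmeas_integrable01;
    exact: bddmeasB.
split => //.
exists (fun m x => S (nn m.+1) x - S (nn m) x), (fun m => 14 * (2 * et m)); split.
- move=> m; apply: fa_ucont; [exact: ucontB|by rewrite mulr_gt0|].
  rewrite (eq_int01 (g := fun x => ((a x - S (nn m) x) - (a x - S (nn m.+1) x)) ^+ 2)).
    apply: sqr_int_le; [exact: bddmeasB|exact: bddmeasB|exact: hnn|].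
    apply: (le_trans (hnn m.+1)); rewrite ler_sqr ?nnegrE; try exact: ltW.
    by rewrite ler_pM2l// lef_pV2 ?posrE ?exprn_gt0// ler_weXn2l// ler1n.
  by move=> x _; congr (_ ^+ 2); ring.
- move=> n; rewrite (eq_bigr (fun m : 'I_n => 28 * eta * (1 / 2) ^+ m)); last first.
    by move=> m _; rewrite /et expr_div_n expr1n; ring.
  rewrite -mulr_sumr.
  have g2 : \sum_(m < n) (1 / 2 : R) ^+ m <= 2.
    by have := @geom_le R (1 / 2) n; rewrite (_ : (1 - 1 / 2)^-1 = 2 :> R); [apply;
        lra|field].
  have h28 : 0 <= 28 * eta by rewrite mulr_ge0// ltW.
  by apply: (le_trans (ler_wpM2l h28 g2)); rewrite /eta; lra.
- move=> d d0; have [n hn] : exists n, et n <= d.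
    exists (Num.bound (eta / d)); set n := Num.bound _.
    have h : eta / d < 2 ^+ n.
      apply: (lt_le_trans (archi_boundP _)); first by rewrite divr_ge0// ltW.
      by rewrite -natrX ler_nat ltnW// ltn_expl.
    by rewrite /et ler_pdivrMr ?exprn_gt0// mulrC -ler_pdivrMr// ltW.
  exists n => m nm.
  rewrite (eq_int01 (g := fun x => `|a x - S (nn m) x|)); last first.
    move=> x _; rewrite -(big_mkord xpredT (fun i => S (nn i.+1) x - S (nn i) x)).
    by rewrite telescope_sumr//; congr `|_|; ring.
  have bd : bddmeas (fun x => `|a x - S (nn m) x|) by apply: bddmeas_abs; exact: bddmeasB.
  have h1 := int01_sqr_le bd.
  have h2 : int01 (fun x => `|a x - S (nn m) x| ^+ 2) <= et m ^+ 2.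
    apply: le_trans (hnn m); rewrite le_eqVlt; apply/orP; left; apply/eqP.
    by apply: eq_int01 => x _; rewrite real_normK// num_real.
  have h3 : int01 (fun x => `|a x - S (nn m) x|) <= et m.
    rewrite -ler_sqr ?nnegrE; [exact: le_trans h2|exact: int01_ge0|exact: ltW].
  apply: (le_trans h3); apply: le_trans hn; rewrite ler_pM2l// lef_pV2 ?posrE ?exprn_gt0//.
  by rewrite ler_weXn2l// ler1n.
Qed.

Lemma dense_fa f K : finite_atomic f K -> forall e, 0 < e ->
  exists g, reproduced g /\ countably_atomic (fun x => f x - g x) e.
Proof.
elim=> [|c a {}f {}K ha hf ih|{}f g {}K K' hf ih KK' fg] e e0.
- exists (fun=> 0); split; first exact: reproduced0.
  apply: (@eq_ca _ (fun=> 0)); first by move=> x _; rewrite subrr.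
  by apply: ca_le (ca_fa FinAtom0) _; exact: ltW.
- have e2 : 0 < e / 2 by rewrite divr_gt0.
  have c1 : 0 < `|c| + 1 by rewrite ltr_wpDl.
  have [g [gg hg]] := ih _ e2.
  have [h [gh hh]] : exists h, reproduced h /\ countably_atomic (fun x => a x - h x) (e
      / 2 / (`|c| + 1)).
    case: ha => [->|ba]; last by apply: dense_atom => //; exact: divr_gt0.
    exists (phi 0%N); split; first exact: reproduced_phi.
    apply: (@eq_ca _ (fun=> 0)); first by move=> x xD; rewrite phi0// subrr.
    by apply: ca_le (ca_fa FinAtom0) _; rewrite ltW// divr_gt0.
  exists (fun x => c * h x + g x); split; first by apply: reproducedD => //;
      exact: reproducedZ.
  apply: (@eq_ca _ (fun x => c * (a x - h x) + (f x - g x))); first by move=> x _; ring.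
  apply: ca_le (caD (caZ c hh) hg) _.
  rewrite [leRHS]splitr lerD2r mulrCA ger_pMr// ler_pdivrMr// mul1r.
  by rewrite lerDl.
- have [h [gh hh]] := ih _ e0; exists h; split => //.
  by apply: eq_ca hh => x /fg ->.
Qed.

Lemma dense_ca f K e : countably_atomic f K -> 0 < e ->
    exists g, reproduced g /\ countably_atomic (fun x => f x - g x) e.
Proof.
move=> hf e0; have e2 : 0 < e / 2 by rewrite divr_gt0.
have [h [L [fh hh]]] := ca_tail hf e2.
have [g [gg hg]] := dense_fa fh e2; exists g; split => //.
apply: (@eq_ca _ (fun x => (f x - h x) + (h x - g x))); first by move=> x _; ring.
by apply: ca_le (caD hh hg) _; rewrite -splitr.
Qed.

(** If g is reproduced by P_s then f - P_s f = (f - g) - P_s (f - g), and f - g has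
    cost e / (1 + B). *)
Lemma proj_converges f K e : countably_atomic f K -> 0 < e -> exists N, forall s, uniq s ->
  {subset iota 0 N <= s} -> countably_atomic (fun x => f x - proj s f x) e.
Proof.
move=> hf e0; have B11 : 0 < 1 + B by rewrite ltr_pwDl.
have [g [[bg [N hN]] hg]] := dense_ca hf (divr_gt0 e0 B11).
exists N => s us hs; have hp := proj_ca us hg.
have [iff _] := hf.
apply: (@eq_ca _ (fun x => (f x - g x) + -1 * proj s (fun x => f x - g x) x)).
  by move=> x xD; rewrite projB ?(hN s us hs x xD)//; [ring|exact: bddmeas_integrable01].
apply: ca_le (caD hg (caZ (-1) hp)) _.
rewrite normrN1 mul1r le_eqVlt; apply/orP; left; apply/eqP.
by field; rewrite gt_eqF.
Qed.

Lemma norm_sums_H1P f (e : nat -> R -> R) (c : nat -> R) :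
  norm_sums H1_norm e c f <-> forall d : R, 0 < d -> exists N, forall n, (N <= n)%N ->
    (H1_norm (fun x => f x - \sum_(k < n) c k * e k x)%R <= d%:E)%E.
Proof. by apply: cvg0_ereal => n; exact: H1_norm_ge0. Qed.

(** Convergence in H^1 implies convergence in L^1, hence of the integrals against
    the bounded function psi_m. *)
Lemma coef_unique f c m : integrable01 f -> norm_sums H1_norm phi c f ->
  c m = int01 (fun x => f x * psi m x).
Proof.
move=> hf /norm_sums_H1P hc; have [M [M0 hM]] := Ipsi_le m.
apply/eqP; rewrite eq_sym -subr_eq0 -normr_le0; apply/ler_addgt0Pr => e e0.
rewrite add0r; have M1 : 0 < 2 * (M + 1) by rewrite mulr_gt0// ltr_wpDl.
pose d := e / (2 * (M + 1)); have d0 : 0 < d by rewrite divr_gt0.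
have [N hN] := hc d d0; pose n := maxn N m.+1.
pose S x := \sum_(k < n) c k * phi k x.
have bS : bddmeas S by apply: bddmeas_sum => k _; exact: bddmeasZ.
have ig : integrable01 (fun x => f x - S x) by apply: integrable01B => //;
    exact: bddmeas_integrable01.
have hH : countably_atomic (fun x => f x - S x) (2 * d).
  apply: H1_norm_lt_ca => //; apply: (le_lt_trans (hN n (leq_maxl _ _))).
  by rewrite lte_fin; lra.
have E : int01 (fun x => f x * psi m x) - c m = int01 (fun x => (f x - S x) * psi m x).
  rewrite [RHS](eq_int01 (g := fun x => f x * psi m x - S x * psi m x)); last first.
    by move=> x _; rewrite mulrBl.
  rewrite int01B; [|exact: integrable01_psi|by apply: integrable01_psi;
      exact: bddmeas_integrable01].
  congr (_ - _).
  rewrite (eq_int01 (g := fun x => \sum_(k < n) c k * (phi k x * psi m x))); last first.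
    by move=> x _; rewrite /S mulr_suml; apply: eq_bigr => k _; rewrite mulrA.
  rewrite int01_sum; last by move=> k _; apply: integrable01Z;
      apply: bddmeas_integrable01; exact: bddmeasM.
  have mn : (m < n)%N by rewrite /n leq_max ltnSn orbT.
  rewrite (bigD1 (Ordinal mn))//= int01Z; last by apply: bddmeas_integrable01;
      exact: bddmeasM.
  rewrite bi eqxx mulr1 big1 ?addr0// => k km.
  rewrite int01Z; last by apply: bddmeas_integrable01; exact: bddmeasM.
  rewrite bi (_ : (_ == m) = false) ?mulr0//.
  by apply/negbTE; apply: contra km => /eqP km; apply/eqP; exact: val_inj.
rewrite E; apply: (le_trans (hM _ ig)).
apply: (le_trans (ler_wpM2l M0 (ca_L1 hH))).
have -> : M * (2 * d) = e * (M / (M + 1)).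
  by rewrite /d; field; rewrite gt_eqF// ltr_wpDl.
by rewrite ger_pMr// ler_pdivrMr ?ltr_wpDl// mul1r lerDl.
Qed.

(** The first n terms of the rearranged series form a projection on the set of the
    sigma k with k < n, which eventually contains any given finite set. *)
Lemma norm_sums_perm f K (sigma : nat -> nat) : countably_atomic f K -> bijective sigma ->
  norm_sums H1_norm (phi \o sigma) ((fun k => int01 (fun x => f x * psi k x)) \o sigma) f.
Proof.
move=> hf [tau st ts]; apply/norm_sums_H1P => d d0.
have [N hN] := proj_converges hf d0.
exists (\max_(k <- iota 0 N) (tau k).+1) => n hn; apply: ca_H1_norm.
apply: (@eq_ca _ (fun x => f x - proj [seq sigma k | k <- iota 0 n] f x)).
  move=> x _; rewrite /proj big_map; congr (_ - _).
  by rewrite -[RHS](big_mkord xpredT (fun k => int01 (fun y => f y * psi (sigma k) y) *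
      phi (sigma k) x))
    /index_iota subn0.
apply: hN; first by rewrite map_inj_uniq ?iota_uniq//; exact: can_inj st.
move=> k kN; rewrite -(ts k) map_f// mem_iota add0n/=.
by apply: leq_trans hn; exact: (@leq_bigmax_seq _ (iota 0 N) xpredT (fun k => (tau
    k).+1) k kN isT).
Qed.

Hypothesis phiH1 : forall k, H1 (phi k).

Lemma unconditional_H1 : unconditional_basis H1 H1_norm phi.
Proof.
split.
  split => // f hf; have [K hK] := H1_ca hf.
  exists (fun k => int01 (fun x => f x * psi k x)); split.
    by apply: (norm_sums_perm hK (sigma := id)); exists id.
  move=> c hc; apply/funext => m.
  by rewrite (coef_unique m _ hc)//; case: hf => /Lp01_1_integrable01.
move=> f c hf hc sigma bs; have [K hK] := H1_ca hf.
have -> : c = fun k => int01 (fun x => f x * psi k x).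
  by apply/funext => m; apply: coef_unique hc; case: hf => /Lp01_1_integrable01.
exact: norm_sums_perm hK bs.
Qed.

End expansions.

(** * The theorem *)
Section main.
Context {R : realType}.

Lemma int01_of_unit (f g : R -> R) (r : R) : bddmeas f -> bddmeas g ->
  (\int[@lebesgue_measure R]_(x in unit_itv) (f x * g x)%:E = r%:E)%E ->
  int01 (fun x => f x * g x) = r.
Proof.
by move=> bf bg; rewrite integral_unit_int01; [case|apply: bddmeas_integrable01;
    exact: bddmeasM].
Qed.

(** Hoelder's inequality, with 1 as the other factor. *)
Lemma Lp01_2_1 (f : R -> R) : Lp01 2%:E (fun _ : R => 1 : R) -> Lp01 2%:E f -> Lp01 1%E f.
Proof.
move=> h1 hf; have := Lfun2_mul_Lfun1 hf h1; rewrite /Lp01/=.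
rewrite (_ : (f \_ unit_itv) \* _ = f \_ unit_itv)//.
by apply/funext => x; rewrite /= /patch; case: ifPn => _; rewrite ?mulr1 ?mulr0.
Qed.

End main.

Theorem corollary6p1 (R : realType) (phi psi : nat -> R -> R)
    (hsys : wavelet_type_system phi psi)
    (hbasis : schauder_basis (Lp01 2%:E) (Lp01_norm 2%:E) phi) :
  unconditional_basis H1 H1_norm phi.
Proof.
have [hbi [delta [c [alpha [[/andP[d0 d1] c0 /andP[a0 a1]] [h0 h1 hk]]]]]] := hsys.
pose rho := decay_rate delta alpha; pose C := decay_cst delta c alpha.
have r0 : 0 < rho by exact: decay_rate_gt0.
have r1 : rho < 1 := decay_rate_lt1 d0 a0.
have C0 : 0 < C by exact: decay_cst_gt0.
have hb k : (0 < k)%N -> wavelet_bounds c delta alpha (wlevel k) (wcenter k) (phi k)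
    (psi k).
  case: k => [//|[_|k _]].
    rewrite (_ : wcenter 1 = 2^-1)// /wcenter (_ : wlevel 1 = 0%N)// (_ : maxn _ _ = 1%N)//.
    by rewrite expr1; lra.
  have := hk (wlevel k.+2) (maxn 1 (k.+2 - 2 ^ wlevel k.+2)) (wlevel_bounds _).
  by rewrite addnC -wlevelE.
have uc1 (f : R -> R) : (forall x, unit_itv x -> f x = 1) -> ucont f.
  move=> f1; split; first by exists 1 => x /unit_D01 /f1 ->; rewrite normr1.
  by move=> e e0; exists 1 => // s t /unit_D01/f1 -> /unit_D01/f1 -> _;
      rewrite subrr normr0 ltW.
have uphi k : ucont (phi k).
  have [->|k0] := posnP k; first by apply: uc1 => x /h0[].
  have [b1 b2 _ _] := wavelet_bounds_each (hb k k0).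
  exact: (bounds_ucont d0 c0 a0 (wcenter_D01 k) b1 b2).
have upsi k : ucont (psi k).
  have [->|k0] := posnP k; first by apply: uc1 => x /h0[].
  have [_ _ b1 b2] := wavelet_bounds_each (hb k k0).
  exact: (bounds_ucont d0 c0 a0 (wcenter_D01 k) b1 b2).
have bi k m : int01 (fun x => phi k x * psi m x) = (k == m)%:R.
  by apply: int01_of_unit; [exact: ucont_bddmeas|exact: ucont_bddmeas|exact: hbi].
have phi0 x : D01 x -> phi 0%N x = 1 by move=> /unit_D01/h0[].
have psi0 x : D01 x -> psi 0%N x = 1 by move=> /unit_D01/h0[].
have Iphi k : (0 < k)%N -> int01 (phi k) = 0.
  move=> k0; have := bi k 0%N; rewrite (gtn_eqF k0) => E; apply: etrans E.
  by apply: eq_int01 => x xD; rewrite psi0 ?mulr1.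
have Ipsi k : (0 < k)%N -> int01 (psi k) = 0.
  move=> k0; have := bi 0%N k; rewrite (ltn_eqF k0) => E; apply: etrans E.
  by apply: eq_int01 => x xD; rewrite phi0 ?mul1r.
(* phi_0 and psi_0 have no cancellation; they do not interact with atoms, whose
   mean is zero, and are replaced by 0 *)
pose phi' k := if k == 0%N then fun=> 0 else phi k.
pose psi' k := if k == 0%N then fun=> 0 else psi k.
have mol0 k : molecule rho C (fun=> 0) (wlevel k) (wcenter k).
  split; [exact: ucont_cst|exact: int01_cst|move=> x _|move=> d s s' _ _ _];
    have W0 z := weight_ge0 (exprn_gt0 2 r0) (wlevel k) z (wcenter k);
    have w0 : 0 <= Num.sqrt (2 : R) by exact: sqrtr_ge0.
    by rewrite normr0; apply: mulr_ge0 => //; nonneg.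
  by rewrite subrr normr0; apply: mulr_ge0 => //; nonneg.
have hphi k : molecule rho C (phi' k) (wlevel k) (wcenter k).
  rewrite /phi'; have [_|k0] := posnP k; first exact: mol0.
  have [b1 b2 _ _] := wavelet_bounds_each (hb k k0).
  exact: (bounds_molecule d0 c0 a0 (wcenter_D01 k) b1 b2 (Iphi k k0)).
have hpsi k : molecule rho C (psi' k) (wlevel k) (wcenter k).
  rewrite /psi'; have [_|k0] := posnP k; first exact: mol0.
  have [_ _ b1 b2] := wavelet_bounds_each (hb k k0).
  exact: (bounds_molecule d0 c0 a0 (wcenter_D01 k) b1 b2 (Ipsi k k0)).
pose B := Num.max 1 (atom_cst rho C).
have B1 : 1 <= B by rewrite le_max lexx.
have atomB a s : bounded_atom a -> uniq s -> finite_atomic (proj phi psi s a) B.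
  move=> ha us; have := atom_bound r0 r1 C0 hphi hpsi ha us.
  have [u [v [_ [_ _ _ Ia]]]] := ha.
  move=> h; apply: (FinAtom_ext h); first by rewrite le_max lexx orbT.
  move=> x _; apply: eq_bigr => k _; rewrite /phi' /psi'; case: eqP => [->|//].
  rewrite mulr0 (eq_int01 (g := a)) ?Ia ?mul0r// => y yD.
  by rewrite psi0 ?mulr1.
apply: (unconditional_H1 uphi upsi bi phi0 B1 atomB hbasis) => k.
have L1 : Lp01 1%E (phi k).
  apply: Lp01_2_1; last by case: hbasis.
  have [/(_ 0%N) + _] := hbasis; rewrite /Lp01/=.
  rewrite (_ : phi 0%N \_ unit_itv = (fun _ : R => 1 : R) \_ unit_itv)//.
  by apply/funext => x; rewrite /patch; case: ifPn => // /set_mem /h0[->].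
split => //.
have [K hK] : exists K, finite_atomic (phi k) K.
  have [->|k0] := posnP k.
    by exists (`|1|); apply: (FinAtom_ext (fa_cst 1)) => // x /phi0.
  have hk' : molecule rho C (phi k) (wlevel k) (wcenter k) by have := hphi k;
      rewrite /phi' gtn_eqF.
  by eexists; exact: (molecule_fa r0 r1 C0 (wcenter_D01 k) hk').
have [c' [a' [hd _]]] := ca_decomposition (ca_fa hK).
by exists c', a'.
Qed.
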